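(* Suppose that Assumptions 1, 2, 3 and 4 (listed in the context) hold. Then, under the alternative hypothesis $H_1$ of the context (a change of parameter from $\boldsymbol\theta_0$ to $\boldsymbol\theta_*\ne\boldsymbol\theta_0$ after observation $N+K_*$), as $N\to\infty$, $$\sup_{K\ge1}\left\{\frac{\|\hat{\boldsymbol\Gamma}(N,K)\|}{\ell_\gamma(K/N)}\right\}\longrightarrow\infty\quad\text{in probability}.$$ In particular, $\lim_{N\to\infty}P\{\tau_{\hat{\boldsymbol\Gamma}}(N)<\infty\}=1$.
   Context: $\|\cdot\|$ denotes the absolute maximum norm of vectors and matrices. Parameters. Let $p\ge1$, $\sigma>0$, $\boldsymbol\theta_0=(\boldsymbol\mu^\top,a)^\top=(\mu_1,\dots,\mu_p,a)^\top$ and $\boldsymbol\theta_*=(\boldsymbol\mu_*^\top,a_* )^\top=(\mu_{1*},\dots,\mu_{p*},a_* )^\top$ be elements of the parameter space $\mathcal O\subset\mathbb{R}^p\times(0,\infty)$, and let $\boldsymbol\varphi(t)=(\varphi_1(t),\dots,\varphi_p(t))^\top$ be real-valued functions of $t$. $(B_t)_{t\ge0}$ is a standard Brownian motion on a complete probability space. Assumption 1: the law of $X_0$ does not depend on the drift parameter, $X_0$ is independent of $(B_t)_{t\ge0}$, and $E[|X_0|^d]<\infty$ for some $d\ge2$. Assumption 2: for every $T>0$, $\boldsymbol\varphi$ is Riemann-integrable on $[0,T]$; $\varphi_1\equiv1$; $\boldsymbol\varphi$ is periodic with period $1$ (the paper takes the period to be $1$ without loss of generality); $\int_0^1\boldsymbol\varphi(t)\boldsymbol\varphi^\top(t)\,dt=I_p$.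 Assumption 3: $0\le\gamma<1/2$, $N=\lfloor T^{\delta}\rfloor$ with $2<\delta<1/\gamma$ ($1/\gamma=\infty$ if $\gamma=0$), and $\Delta_N=T/N\to0$ as $T\to\infty$. Limits $N\to\infty$ are taken along $T\to\infty$. Put $t_i=i\Delta_N$ for all $i\ge0$. Assumption 4: $C(\Delta_N)=O(\Delta_N^{1/2})$, where $C(\Delta_N)=\sup_{i\ge1}\frac1{\Delta_N}\int_{t_{i-1}}^{t_i}\|\boldsymbol\varphi(s)-\boldsymbol\varphi(t_{i-1})\|\,ds$. Alternative hypothesis $H_1$: there is $K_*\ge0$ such that the parameter is $\boldsymbol\theta_0$ for observations $i\le N+K_*$ and $\boldsymbol\theta_*\neq\boldsymbol\theta_0$ for $i>N+K_*$; that is, $X$ is the continuous process with $dX_t=(\boldsymbol\mu^\top\boldsymbol\varphi(t)-aX_t)\,dt+\sigma\,dB_t$ for $0\le t\le t_{N+K_*}$ and $dX_t=(\boldsymbol\mu_*^\top\boldsymbol\varphi(t)-a_*X_t)\,dt+\sigma\,dB_t$ for $t>t_{N+K_*}$. Discrete observations. For $i\ge1$, $Y_{N,i}=(X_{t_i}-X_{t_{i-1}})/\Delta_N^{1/2}$, $\mathbf{Z}_{N,i}=\Delta_N^{1/2}(\varphi_1(t_{i-1}),\dots,\varphi_p(t_{i-1}),-X_{t_{i-1}})^\top$. $\mathbf{Z}_N$ is the $N\times(p+1)$ matrix with rows $\mathbf{Z}_{N,i}^\top$, $1\le i\le N$. For $K\ge0$, $\hat{\boldsymbol\theta}_{N+K}=\left(\sum_{i=1}^{N+K}\mathbf{Z}_{N,i}\mathbf{Z}_{N,i}^\top\right)^{-1}\sum_{i=1}^{N+K}\mathbf{Z}_{N,i}Y_{N,i}$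 (least-squares estimator based on the first $N+K$ observations, with mesh $\Delta_N$). Detector. For $K\ge1$, $\hat{\boldsymbol\Gamma}(N,K)=T^{1/2}\left(\frac1T\mathbf{Z}_N^\top\mathbf{Z}_N\right)^{1/2}\left(\hat{\boldsymbol\theta}_{N+K}-\hat{\boldsymbol\theta}_N\right)$, where $(\cdot)^{1/2}$ is the symmetric positive semidefinite square root; $\ell_\gamma(s)=\left(\frac{s}{1+s}\right)^\gamma$ with the same $\gamma$ as in Assumption 3; $\tau_{\hat{\boldsymbol\Gamma}}(N)=\inf\{K\ge1:\|\hat{\boldsymbol\Gamma}(N,K)\|\ge c\,\ell_\gamma(K/N)\}$ with $c>0$ a fixed constant and $\inf\emptyset=\infty$. *)

(* Defs.v *)
From HB Require Import structures.
From Stdlib Require Import Reals.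
From Coquelicot Require Hierarchy RInt.
From mathcomp Require Import all_boot all_order all_algebra.
From mathcomp Require Import all_classical all_reals all_analysis.
From mathcomp Require Import Rstruct Rstruct_topology.

Set Implicit Arguments.
Unset Strict Implicit.
Unset Printing Implicit Defensive.

Import Order.TTheory GRing.Theory Num.Theory.
Import numFieldNormedType.Exports.

Local Open Scope classical_set_scope.
Local Open Scope ring_scope.

(* MathComp-Analysis has no Riemann integral, so the carrier is Stdlib's R (a
   realType), on which time integrals are Coquelicot's Riemann integrals; all
   the probability theory is that of MathComp-Analysis. *)
Notation R := Rdefinitions.R.

(* The Borel sigma-algebra that MathComp-Analysis puts on every realType. *)
HB.instance Definition _ := Measurable.copy R (Real.sort R).

Definition is_riemann (f : R -> R) (a b v : R) : Prop :=
  @RInt.is_RInt Hierarchy.R_NormedModule f a b v.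

Definition riemann_integrable (f : R -> R) (a b : R) : Prop :=
  @RInt.ex_RInt Hierarchy.R_NormedModule f a b.

Definition riemann (f : R -> R) (a b : R) : R :=
  @RInt.RInt Hierarchy.R_CompleteNormedModule f a b.

(* Independence of two sigma-algebras. *)
Definition indep_sigma d (Omega : measurableType d) (P : probability Omega R)
    (F G : set (set Omega)) : Prop :=
  forall A B, F A -> G B -> P (A `&` B) = (P A * P B)%E.

Definition sigma_rv d (Omega : measurableType d) (X : Omega -> R) :
    set (set Omega) :=
  preimage_set_system setT X measurable.

(* sigma(X_t : t in D) *)
Definition sigma_process d (Omega : measurableType d) (X : R -> Omega -> R)
    (D : set R) : set (set Omega) :=
  <<s \bigcup_(t in D) sigma_rv (X t) >>.

(* Processes are indexed by the whole of R, but only times t >= 0 are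
   meaningful. [normal_prob m s] has standard deviation s. *)
Record brownian_motion d (Omega : measurableType d) (P : probability Omega R)
    (B : R -> {RV P >-> R}) : Prop := BrownianMotion {
  brownian_start : {ae P, forall w, B 0 w = 0} ;
  brownian_continuous :
    {ae P, forall w, {within `[0, +oo[, continuous (fun t => B t w)}} ;
  brownian_normal : forall s t : R, 0 <= s -> s < t ->
    forall A : set R, measurable A ->
      P ((fun w => B t w - B s w) @^-1` A)
        = normal_prob 0 (Num.sqrt (t - s)) A ;
  brownian_indep : forall s t : R, 0 <= s -> s < t ->
    indep_sigma P (sigma_rv (fun w => B t w - B s w))
                  (sigma_process B `[0, s])
}.

(* A drift parameter theta = (mu^T, a)^T is the pair (mu, a). *)
Definition drift p (phi : R -> 'cV[R]_p) (th : 'cV[R]_p * R) (t x : R) : R :=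
  (th.1^T *m phi t) ord0 ord0 - th.2 * x.

(* The path x solves dx_t = (mu^T phi(t) - a x_t) dt + sigma db_t on the
   interval I: as the noise is additive, the equation is the pathwise identity
   x_t - x_s = int_s^t drift(u, x_u) du + sigma (b_t - b_s). *)
Definition solves_on p (phi : R -> 'cV[R]_p) (th : 'cV[R]_p * R) (sigma : R)
    (I : set R) (x b : R -> R) : Prop :=
  forall s t : R, I s -> I t -> s <= t ->
    is_riemann (fun u => drift phi th u (x u)) s t
      (x t - x s - sigma * (b t - b s)).

(* N = floor (T ^ delta); [Num.truncn] is the floor of a nonnegative real. *)
Definition nobs (delta T : R) : nat := Num.truncn (T `^ delta).

Definition mesh (delta T : R) : R := T / (nobs delta T)%:R.

Definition grid (delta T : R) (i : nat) : R := i%:R * mesh delta T.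

Definition assumption1 d (Omega : measurableType d) (P : probability Omega R)
    (X0 : {RV P >-> R}) (B : R -> {RV P >-> R}) : Prop :=
  indep_sigma P (sigma_rv X0) (sigma_process B `[0, +oo[) /\
  exists2 e : R, 2 <= e & ('E_P[fun w => (`|X0 w| `^ e)%R] < +oo)%E.

Record assumption2 p (phi : R -> 'cV[R]_p) : Prop := Assumption2 {
  phi_integrable : forall T : R, 0 < T ->
    forall i : 'I_p, riemann_integrable (fun t => phi t i ord0) 0 T ;
  phi_one : forall i : 'I_p, val i = 0%N ->
    forall t : R, 0 <= t -> phi t i ord0 = 1 ;
  phi_periodic : forall t : R, 0 <= t -> phi (t + 1) = phi t ;
  phi_orthonormal : forall i j : 'I_p,
    is_riemann (fun t => (phi t *m (phi t)^T) i j) 0 1 ((1%:M : 'M[R]_p) i j)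
}.

(* The upper bound 1 / gamma on delta is infinite when gamma = 0. *)
Record assumption3 (gamma delta : R) : Prop := Assumption3 {
  gamma_ge0 : 0 <= gamma ;
  gamma_lt : gamma < 1 / 2 ;
  delta_gt : 2 < delta ;
  delta_lt : 0 < gamma -> delta < 1 / gamma ;
  mesh_cvg0 : mesh delta T @[T --> +oo] --> 0
}.

(* C(Delta_N); `|v| is the maximum norm on matrices. *)
Definition phi_modulus p (phi : R -> 'cV[R]_p) (delta T : R) : \bar R :=
  ereal_sup [set ((mesh delta T)^-1 *
                  riemann (fun s => `|phi s - phi (grid delta T i.-1)|)
                    (grid delta T i.-1) (grid delta T i))%:E
            | i in [set i : nat | (1 <= i)%N]].

Definition assumption4 p (phi : R -> 'cV[R]_p) (delta : R) : Prop :=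
  exists C : R, \forall T \near +oo,
    (phi_modulus phi delta T <= (C * Num.sqrt (mesh delta T))%:E)%E.

(* Since N and Delta_N depend on the horizon T, so do the time of change
   t_{N + K_*} and hence the process: [X T t] is X_t for the horizon T. The
   initial value X0 and the Brownian motion B do not depend on T. The bound
   1 <= T ensures N >= 1. *)
Record alternative_H1 p d (Omega : measurableType d) (P : probability Omega R)
    (phi : R -> 'cV[R]_p) (delta sigma : R) (th0 th1 : 'cV[R]_p * R)
    (Kstar : R -> nat) (X0 : {RV P >-> R}) (B : R -> {RV P >-> R})
    (X : R -> R -> {RV P >-> R}) : Prop := AlternativeH1 {
  H1_change : th1 <> th0 ;
  H1_process : forall T : R, 1 <= T ->
    let tau := grid delta T (nobs delta T + Kstar T) in
    {ae P, forall w,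
      [/\ X T 0 w = X0 w,
          {within `[0, +oo[, continuous (fun t => X T t w)},
          solves_on phi th0 sigma `[0, tau]
            (fun t => X T t w) (fun t => B t w) &
          solves_on phi th1 sigma `[tau, +oo[
            (fun t => X T t w) (fun t => B t w)]}
}.

(* The statistics below are functionals of a path x of the process; the
   observations are indexed by i >= 1. *)
Definition Yobs (delta T : R) (x : R -> R) (i : nat) : R :=
  (x (grid delta T i) - x (grid delta T i.-1)) / Num.sqrt (mesh delta T).

Definition Zobs p (phi : R -> 'cV[R]_p) (delta T : R) (x : R -> R) (i : nat) :
    'cV[R]_(p + 1) :=
  Num.sqrt (mesh delta T) *:
    col_mx (phi (grid delta T i.-1)) (- x (grid delta T i.-1))%:M.

(* Rows Z_{N,1}^T, ..., Z_{N,N}^T. *)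
Definition Zmat p (phi : R -> 'cV[R]_p) (delta T : R) (x : R -> R) :
    'M[R]_(nobs delta T, p + 1) :=
  \matrix_(i, j) Zobs phi delta T x i.+1 j ord0.

(* Least-squares estimator from the first n observations. *)
Definition lse p (phi : R -> 'cV[R]_p) (delta T : R) (x : R -> R) (n : nat) :
    'cV[R]_(p + 1) :=
  invmx (\sum_(1 <= i < n.+1)
           Zobs phi delta T x i *m (Zobs phi delta T x i)^T) *m
  \sum_(1 <= i < n.+1) Yobs delta T x i *: Zobs phi delta T x i.

(* The symmetric positive semidefinite square root (0 if there is none). *)
Definition psd_sqrt n (M : 'M[R]_n) : 'M[R]_n :=
  xget 0 [set S : 'M[R]_n |
    [/\ S^T = S,
        (forall v : 'cV[R]_n, 0 <= (v^T *m S *m v) ord0 ord0) &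
        S *m S = M]].

Definition detector p (phi : R -> 'cV[R]_p) (delta T : R) (x : R -> R)
    (K : nat) : 'cV[R]_(p + 1) :=
  Num.sqrt T *:
    (psd_sqrt (T^-1 *: ((Zmat phi delta T x)^T *m Zmat phi delta T x)) *m
     (lse phi delta T x (nobs delta T + K) - lse phi delta T x (nobs delta T))).

Definition ell (gamma s : R) : R := (s / (1 + s)) `^ gamma.

Definition sup_statistic p (phi : R -> 'cV[R]_p) (gamma delta T : R)
    (x : R -> R) : \bar R :=
  ereal_sup [set (`|detector phi delta T x K| /
                  ell gamma (K%:R / (nobs delta T)%:R))%:E
            | K in [set K : nat | (1 <= K)%N]].

Definition stopping_time p (phi : R -> 'cV[R]_p) (gamma delta c T : R)
    (x : R -> R) : \bar R :=
  ereal_inf [set (K%:R)%:E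
            | K in [set K : nat | (1 <= K)%N /\
                     c * ell gamma (K%:R / (nobs delta T)%:R)
                       <= `|detector phi delta T x K|]].

(* Main.v *)
Require Import Defs.
From HB Require Import structures.
From Stdlib Require Import Reals.
From Coquelicot Require Hierarchy RInt RInt_analysis Derive.
From mathcomp Require Import all_boot all_order all_algebra.
From mathcomp Require Import all_classical all_reals all_analysis.
From mathcomp Require Import Rstruct Rstruct_topology.
From mathcomp Require Import measurable_realfun.
From mathcomp Require Import ring lra.

(** The supremum and the stopping time range over all K, so for each horizon T
  it suffices to exhibit one K >= 1, as large as desired and depending on T, for
  which the detector is large with high probability; the boundary [ell] is at
  most 1.

  The detector compares two least-squares estimates. The core of the proof,
  [phase_estimates], concerns one stretch of n observations with mesh D on
  which X solves a single equation. If n D is large, D small and the squared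
  initial value small with respect to n D, then with high probability the Gram
  matrix of the regressors (phi, -X) dominates c n D times the identity, and the
  score of the true parameter is at most eps n D, where c is independent of eps.
  Applied to the first N observations it puts the estimate from N observations
  close to theta_0. Applied to the n observations that follow the change, with n
  chosen after T, it puts the estimate from N + K of them close to theta_*: the
  first N + K_* observations contribute to the score a fixed random variable,
  which is tight, hence negligible against n D. As the detector multiplies the
  difference by a square root of the Gram matrix of size T, its norm is of order
  at least the square root of T ([detector_large], [change_detected]).

  The estimates of a stretch use no ergodic theorem. Variation of constants
  gives the exact recursion x_(i+1) = rho x_i + b_i + sigma e_i with
  rho = exp (- a D) ([ar_representation]), where e_i is a pathwise limit of
  combinations of Brownian increments with coefficients in [1 - a D, 1]. Upper
  bounds on the noise are second-moment bounds ([noise], [noise_transform]),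
  passed to the limit by Fatou's lemma. The only probabilistic lower bound, on the quadratic
  variation of B, comes from an exponential moment ([increments_exp]); the
  energy identity of the recursion turns it into a lower bound for the sum of
  the squares of the noise part of X ([noise_energy]), while the orthonormality of the periodic
  basis handles the other directions of the Gram matrix ([gram_riemann]).

  The two events must also be measurable, hence so must be the square root of a
  random matrix: the positive semidefinite root is unique and is a limit of
  polynomials in the matrix ([psd_sqrtE]). *)

Set Implicit Arguments.
Unset Strict Implicit.
Unset Printing Implicit Defensive.

Import Order.TTheory GRing.Theory Num.Theory.
Import numFieldNormedType.Exports.

Local Open Scope classical_set_scope.
Local Open Scope ring_scope.
Bind Scope ring_scope with Rdefinitions.R.

(** * Integration against independent and Gaussian variables *)

(** Independence identifies the law of the pair with the product of the laws;
  the equality is then Tonelli's theorem. *)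
Lemma integral_indep_pair d d1 d2 (Omega : measurableType d)
    (T1 : measurableType d1) (T2 : measurableType d2) (P : probability Omega R)
    (X : {mfun Omega >-> T1}) (Y : {mfun Omega >-> T2})
    (f : T1 * T2 -> \bar R) :
  (forall A B, measurable A -> measurable B ->
     P (X @^-1` A `&` Y @^-1` B) = (P (X @^-1` A) * P (Y @^-1` B))%E) ->
  measurable_fun [set: (T1 * T2)%type] f -> (forall x, (0 <= f x)%E) ->
  (\int[P]_w f (X w, Y w) = \int[P]_w \int[distribution P Y]_y f (X w, y))%E.
Proof.
move=> XY mf f0.
pose jt (w : Omega) : T1 * T2 := (X w, Y w).
have mjt : measurable_fun setT jt.
  by apply: measurable_fun_pair => //; exact: measurable_funPT.
pose mjt' := isMeasurableFun.Build _ _ _ _ jt mjt.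
pose jtm : {mfun Omega >-> (T1 * T2)%type} := HB.pack jt mjt'.
have E A : measurable A -> (distribution P X \x distribution P Y)%E A = distribution P jtm A.
  by apply: product_measure_unique => B C mB mC; exact: XY.
transitivity (\int[distribution P jtm]_x f x)%E.
  by rewrite ge0_integral_distribution.
transitivity (\int[(distribution P X \x distribution P Y)%E]_x f x)%E.
  by apply: eq_measure_integral => A mA _; exact/esym/E.
rewrite fubini_tonelli1//.
rewrite [LHS]ge0_integral_distribution//.
- exact: measurable_fun_fubini_tonelli_F.
- by move=> y; apply: integral_ge0.
Qed.

(** G is any generating family: measurability is with respect to the
  sigma-algebra that it generates. *)
Definition adapted (Omega : pointedType) (G : set (set Omega)) (f : Omega -> R) :=
  measurable_fun [set: g_sigma_algebraType G] (f : g_sigma_algebraType G -> R).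

(** The first member of the independent pair is the identity of Omega, seen as a
  random variable with values in Omega with the sigma-algebra generated by G. So f
  may depend jointly on beta and on everything known from G. *)
Lemma indep_tonelli d (Omega : measurableType d) (P : probability Omega R)
    (G : set (set Omega)) (beta : {RV P >-> R})
    (f : (g_sigma_algebraType G * R)%type -> \bar R) :
  <<s G >> `<=` measurable ->
  indep_sigma P (sigma_rv beta) <<s G >> ->
  measurable_fun [set: (g_sigma_algebraType G * R)%type] f ->
  (forall x, (0 <= f x)%E) ->
  (\int[P]_w f ((w : g_sigma_algebraType G), beta w) =
   \int[P]_w \int[distribution P beta]_y f ((w : g_sigma_algebraType G), y))%E.
Proof.
move=> Gm indep mf f0.
pose iG (w : Omega) : g_sigma_algebraType G := w.
have miG : measurable_fun setT iG by move=> _ A mA; rewrite setTI; exact: Gm.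
pose miG' := isMeasurableFun.Build _ _ _ _ iG miG.
pose idG : {mfun Omega >-> g_sigma_algebraType G} := HB.pack iG miG'.
apply: (@integral_indep_pair _ _ _ _ _ _ P idG beta f) => // A B mA mB.
have := indep (beta @^-1` B) (A : set Omega).
rewrite setIC muleC => E; apply: E; last exact: mA.
by exists B => //; rewrite setTI.
Qed.
Import HBNNSimple.
(** The measure nu is known on sets only, so the identity is proved for simple
  functions and extended by monotone convergence. *)
Lemma ge0_integral_density d (T : measurableType d) (K : realType)
    (mu nu : {measure set T -> \bar K}) (g : T -> K) (f : T -> \bar K) :
  measurable_fun [set: T] g -> (forall x, 0 <= g x) ->
  (forall A, measurable A -> nu A = (\int[mu]_(x in A) (g x)%:E)%E) ->
  measurable_fun [set: T] f -> (forall x, (0 <= f x)%E) ->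
  (\int[nu]_x f x = \int[mu]_x (f x * (g x)%:E))%E.
Proof.
move=> mg g0 nuE mf f0.
pose h := nnsfun_approx measurableT mf.
have hcvg x : (h n x)%:E @[n --> \oo] --> f x.
  by apply: cvg_nnsfun_approx.
have -> : (\int[nu]_x f x = limn (fun n => \int[nu]_x (h n x)%:E))%E.
  rewrite -monotone_convergence//.
  - by apply: eq_integral => x _; apply/esym/cvg_lim => //; exact: hcvg.
  - by move=> n; apply/measurable_EFinP.
  - by move=> n x _; rewrite lee_fin.
  - by move=> x _ a b ab; rewrite lee_fin; exact/lefP/nd_nnsfun_approx.
have mgE : measurable_fun [set: T] (fun x => (g x)%:E) by exact/measurable_EFinP.
have -> : (\int[mu]_x (f x * (g x)%:E) =
    limn (fun n => \int[mu]_x ((h n x)%:E * (g x)%:E)))%E.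
  rewrite -monotone_convergence//.
  - apply: eq_integral => x _; apply/esym/cvg_lim => //.
    by apply: cvgeZr => //; exact: hcvg.
  - by move=> n; apply: emeasurable_funM => //; apply/measurable_EFinP.
  - by move=> n x _; rewrite mule_ge0 ?lee_fin.
  - by move=> x _ a b ab; rewrite lee_wpmul2r ?lee_fin//; exact/lefP/nd_nnsfun_approx.
congr (limn _); apply/funext => n.
have hr0 r x : (0 <= (r * \1_(h n @^-1` [set r]) x)%:E)%E.
  rewrite lee_fin indicE; have [/set_mem /= <-|_] := boolP (x \in _).
    by rewrite mulr1.
  by rewrite mulr0.
under eq_integral do rewrite fimfunE -fsumEFin//.
rewrite ge0_integral_fsum//; last first.
  by move=> r; exact/measurable_EFinP/measurable_funM.
transitivity (\int[mu]_x (\sum_(y \in range (h n))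
    (y * \1_(h n @^-1` [set y]) x)%:E * (g x)%:E))%E; last first.
  apply: eq_integral => x _; rewrite -ge0_mule_fsuml => [|y]; last exact: hr0.
  by rewrite fsumEFin // -(fimfunE _ x).
rewrite ge0_integral_fsum//; last 2 first.
- by move=> r; apply: emeasurable_funM => //; exact/measurable_EFinP/measurable_funM.
- by move=> r x _; rewrite mule_ge0 ?lee_fin//; exact: hr0.
apply: eq_fsbigr => r /[!inE] -[x _ <-].
under eq_integral do rewrite EFinM.
under [RHS]eq_integral do rewrite EFinM -muleA.
rewrite ge0_integralZl//; last 2 first.
- exact/measurable_EFinP.
- by rewrite lee_fin.
rewrite ge0_integralZl//; last 3 first.
- by apply: emeasurable_funM => //; exact/measurable_EFinP.
- by move=> y _; rewrite mule_ge0 ?lee_fin.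
- by rewrite lee_fin.
rewrite integral_indic// setIT nuE//; congr *%E.
rewrite [LHS]integral_mkcond. apply: eq_integral => y _.
by rewrite patchE indicE; case: ifP; rewrite ?mul1e ?mul0e.
Qed.
Lemma lebesgue_measure_opp (K : realType) (A : set K) : measurable A ->
  lebesgue_measure (-%R @^-1` A) = lebesgue_measure A.
Proof.
move=> mA.
pose opp : measurableTypeR K -> measurableTypeR K := (-%R : K -> K).
have mo : measurable_fun setT opp by exact: oppr_measurable.
have H := @lebesgue_measure_unique K (pushforward lebesgue_measure opp).
suff H1 : forall X : set K, ocitv X -> lebesgue_measure X = pushforward lebesgue_measure opp X.
  have E := H mo H1 A mA; exact: (esym E).
move=> _ [[a b] _ <-] /=.
rewrite /pushforward /= /opp.
have -> : -%R @^-1` `]a, b] = `[-b, -a[%classic.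
  by apply/seteqP; split => x /=; rewrite !in_itv /= lerNl ltrNr andbC.
by rewrite !lebesgue_measure_itv /= !lte_fin ltrN2 -EFinB -EFinB opprK addrC.
Qed.

Section Normal.
Context (K : realType) (s : K) (s_gt0 : 0 < s).

Lemma ge0_integral_normal (f : K -> \bar K) :
  measurable_fun [set: K] f -> (forall x, (0 <= f x)%E) ->
  (\int[normal_prob 0 s]_x f x =
   \int[lebesgue_measure]_x (f x * (normal_pdf 0 s x)%:E))%E.
Proof.
move=> mf f0; apply: ge0_integral_density => //.
- exact: measurable_normal_pdf.
- by move=> x; exact: normal_pdf_ge0.
Qed.

(** The symmetry of the centred Gaussian law makes cross terms cancel among
  nonnegative integrals, without any first moment. *)
Lemma integral_normal_opp (f : K -> \bar K) :
  measurable_fun [set: K] f -> (forall x, (0 <= f x)%E) ->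
  (\int[normal_prob 0 s]_x f (- (x : K))%R = \int[normal_prob 0 s]_x f x)%E.
Proof.
move=> mf f0; have mo : measurable_fun [set: K] (-%R : K -> K) by exact: oppr_measurable.
rewrite !ge0_integral_normal//; last exact: measurableT_comp.
pose g x := (f x * (normal_pdf 0 s x)%:E)%E.
have mg : measurable_fun [set: K] g.
  by apply: emeasurable_funM => //; apply/measurable_EFinP; exact: measurable_normal_pdf.
have g0 x : (0 <= g x)%E by rewrite mule_ge0// lee_fin normal_pdf_ge0.
transitivity (\int[lebesgue_measure]_x (g \o (-%R : K -> K)) x)%E.
  apply: eq_integral => x _; rewrite /g /=; congr (_ * _%:E)%E.
  by rewrite !normal_pdfE ?gt_eqF// /normal_fun !subr0 sqrrN.
have := @ge0_integral_pushforward _ _ (measurableTypeR K) (measurableTypeR K) K _ mo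
  lebesgue_measure setT g measurableT mg (fun x _ => g0 x).
rewrite preimage_setT => <-.
by apply: eq_measure_integral => A mA _; exact: lebesgue_measure_opp.
Qed.

Let peak_half c : 0 < c -> normal_peak (c * s) = c^-1 * normal_peak s.
Proof.
move=> c0; rewrite /normal_peak exprMn -mulrA -mulrnAr sqrtrM ?sqr_ge0//.
by rewrite sqrtr_sqr gtr0_norm// invfM.
Qed.

(** This factor times the Gaussian density is half the Gaussian density with half
  the standard deviation. *)
Lemma normal_exp_moment :
  (\int[normal_prob 0 s]_x (expR (- (3 / 2 * ((x : K) / s) ^+ 2)))%:E = (2^-1)%:E)%E.
Proof.
rewrite ge0_integral_normal; last 2 first.
- apply/measurable_EFinP/measurableT_comp => //; apply: measurable_funN.
  apply: measurable_funM => //; apply: measurable_funX.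
  exact: measurable_funM.
- by move=> x; rewrite lee_fin expR_ge0.
transitivity (\int[lebesgue_measure]_x ((2^-1)%:E * (normal_pdf 0 (2^-1 * s) x)%:E))%E.
  apply: eq_integral => x _; rewrite -!EFinM; congr EFin.
  rewrite !normal_pdfE ?gt_eqF ?mulr_gt0// peak_half// invrK.
  have -> : normal_fun 0 (2^-1 * s) x =
      expR (- (3 / 2 * (x / s) ^+ 2)) * normal_fun 0 s x.
    rewrite /normal_fun -exp.expRD; congr expR; rewrite !subr0.
    have s0 : s != 0 by rewrite gt_eqF.
    by field.
  by field.
rewrite ge0_integralZl//.
- by rewrite integral_normal_pdf mule1.
- by apply/measurable_EFinP; exact: measurable_normal_pdf.
- by move=> x _; rewrite lee_fin normal_pdf_ge0.
Qed.

(** By 1 + z <= exp z, the integrand is dominated by 16 s^2 times the Gaussian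
  density with twice the standard deviation. *)
Lemma normal_second_moment :
  (\int[normal_prob 0 s]_x ((x : K) ^+ 2)%:E <= (16 * s ^+ 2)%:E)%E.
Proof.
rewrite ge0_integral_normal; last 2 first.
- by apply/measurable_EFinP; exact: measurable_funX.
- by move=> x; rewrite lee_fin sqr_ge0.
apply: (@le_trans _ _ (\int[lebesgue_measure]_x ((16 * s ^+ 2)%:E * (normal_pdf 0 (2 * s) x)%:E))%E).
  apply: ge0_le_integral => //.
  - by move=> x _; rewrite mule_ge0 ?lee_fin ?sqr_ge0 ?normal_pdf_ge0.
  - apply: emeasurable_funM; apply/measurable_EFinP; first exact: measurable_funX.
    exact: measurable_normal_pdf.
  - by apply: emeasurable_funM => //; apply/measurable_EFinP; exact: measurable_normal_pdf.
  - move=> x _; rewrite -!EFinM lee_fin.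
    rewrite !normal_pdfE ?gt_eqF ?mulr_gt0// peak_half//.
    rewrite mulrCA [X in _ <= X](_ : _ = normal_peak s *
      (8 * s ^+ 2 * normal_fun 0 (2 * s) x)); last by field.
    rewrite ler_wpM2l ?normal_peak_ge0// /normal_fun !subr0.
    have s0 : s != 0 by rewrite gt_eqF.
    pose w := x ^+ 2 / (8 * s ^+ 2).
    have -> : - x ^+ 2 / (s ^+ 2 *+ 2) = - w + - (3 * w).
      by rewrite /w; field.
    have -> : - x ^+ 2 / ((2 * s) ^+ 2 *+ 2) = - w.
      by rewrite /w; field.
    have -> : x ^+ 2 = 8 * s ^+ 2 * w by rewrite /w; field.
    rewrite exp.expRD -[X in X <= _](mulrA (8 * s ^+ 2)).
    have c0 : 0 <= 8 * s ^+ 2 by rewrite mulr_ge0// sqr_ge0.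
    rewrite ler_wpM2l// mulrCA.
    rewrite ger_pMr ?expR_gt0// expRN ler_pdivrMr ?expR_gt0// mul1r.
    have w0 : 0 <= w by rewrite divr_ge0// sqr_ge0.
    by have := expR_ge1Dx (3 * w); lra.
rewrite ge0_integralZl//.
- by rewrite integral_normal_pdf mule1.
- by apply/measurable_EFinP; exact: measurable_normal_pdf.
- by move=> x _; rewrite lee_fin normal_pdf_ge0.
- by rewrite lee_fin mulr_ge0// sqr_ge0.
Qed.
End Normal.

(** * Mean-square bounds for noise transforms *)

Section Noise.
Context d (Omega : measurableType d) (P : probability Omega R).
Implicit Types (G H : set (set Omega)) (f W V xi : Omega -> R).

Lemma adapted_cst G (c : R) : adapted G (fun _ : Omega => c).
Proof. exact: measurable_cst. Qed.

Lemma adaptedD G f g : adapted G f -> adapted G g ->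
  adapted G (fun w => f w + g w).
Proof. exact: measurable_funD. Qed.

Lemma adaptedM G f g : adapted G f -> adapted G g ->
  adapted G (fun w => f w * g w).
Proof. exact: measurable_funM. Qed.

Lemma adapted_sub G H f : G `<=` <<s H >> -> adapted G f -> adapted H f.
Proof.
move=> GH af _ A mA; rewrite setTI.
have := af measurableT A mA; rewrite setTI; apply.
by split => //; exact: smallest_sigma_algebra.
Qed.

Lemma adapted_measurable G f : G `<=` measurable -> adapted G f ->
  measurable_fun setT f.
Proof.
move=> GH af _ A mA; rewrite setTI.
have := af measurableT A mA; rewrite setTI; apply.
by split => //; exact: sigma_algebra_measurable.
Qed.

Definition sqmean f : \bar R := (\int[P]_w ((f w) ^+ 2)%:E)%E.

Lemma sqmean_ge0 f : (0 <= sqmean f)%E.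
Proof. by apply: integral_ge0 => w _; rewrite lee_fin sqr_ge0. Qed.

Lemma sqmeanZ (c : R) f : measurable_fun setT f ->
  sqmean (fun w => c * f w) = ((c ^+ 2)%:E * sqmean f)%E.
Proof.
move=> mf; rewrite /sqmean -ge0_integralZl//; first 1 last.
- by apply/measurable_EFinP; exact: measurable_funX.
- by move=> w _; rewrite lee_fin sqr_ge0.
- by rewrite lee_fin sqr_ge0.
by apply: eq_integral => w _; rewrite exprMn EFinM.
Qed.

Lemma sqmean_cst (c : R) : sqmean (fun=> c) = (c ^+ 2)%:E.
Proof. by rewrite /sqmean integral_cst//= (@probability_setT _ _ _ P) mule1. Qed.

(** A variable that is conditionally centred given G, with conditional variance at
  most v, has this property. Stated through second moments, it is stable under the
  operations below without any conditional expectation. *)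
Definition noise G (v : R) xi := forall W V, adapted G W -> adapted G V ->
  (sqmean (fun w => W w + V w * xi w)%R <= sqmean W + v%:E * sqmean V)%E.

(** The partial sums are adapted, so each of them can play the role of W for the
  next noise. *)
Lemma noise_transform (F : nat -> set (set Omega)) (v : nat -> R)
    (xi V : nat -> Omega -> R) W n :
  (forall i, F i `<=` <<s F i.+1 >>) ->
  (forall i, adapted (F i.+1) (xi i)) ->
  (forall i, noise (F i) (v i) (xi i)) ->
  (forall i, adapted (F i) (V i)) -> adapted (F 0%N) W ->
  (sqmean (fun w => W w + \sum_(i < n) V i w * xi i w)%R <=
   sqmean W + \sum_(i < n) (v i)%:E * sqmean (V i))%E.
Proof.
move=> FF axi nxi aV aW.
suff : adapted (F n) (fun w => W w + \sum_(i < n) V i w * xi i w) /\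
  (sqmean (fun w => W w + \sum_(i < n) V i w * xi i w)%R <=
   sqmean W + \sum_(i < n) (v i)%:E * sqmean (V i))%E by case.
elim: n => [|n [IHa IHs]].
  split; first by under eq_fun do rewrite big_ord0 addr0.
  by under eq_fun do rewrite big_ord0 addr0; rewrite big_ord0 adde0.
under eq_fun do rewrite big_ord_recr /= addrA.
split.
  apply: adaptedD; first exact: adapted_sub IHa.
  by apply: adaptedM; [exact: adapted_sub (aV n)|exact: axi].
rewrite big_ord_recr /= addeA.
apply: (le_trans (nxi n _ _ IHa (aV n))).
by rewrite leeD2r.
Qed.

(** A multiplier V known at time 0 is known at all later times, so
  V times the combination is again a noise transform. *)
Lemma noise_comb (F : nat -> set (set Omega)) (v : nat -> R)
    (xi : nat -> Omega -> R) (c : nat -> R) n :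
  (forall i, F i `<=` <<s F i.+1 >>) ->
  (forall i, F i `<=` measurable) ->
  (forall i, adapted (F i.+1) (xi i)) ->
  (forall i, 0 <= v i) ->
  (forall i, noise (F i) (v i) (xi i)) ->
  noise (F 0%N) (\sum_(i < n) c i ^+ 2 * v i) (fun w => \sum_(i < n) c i * xi i w).
Proof.
move=> FF Fm axi v0 nxi W V aW aV.
have aVi i : adapted (F i) V by elim: i => // i IH; exact: adapted_sub IH.
have := @noise_transform F v xi (fun i w => c i * V w) W n FF axi nxi _ aW.
move=> /(_ (fun i => adaptedM (@adapted_cst (F i) (c i)) (aVi i))).
under eq_fun do under eq_bigr do rewrite mulrAC -mulrC.
under eq_fun do rewrite -mulr_sumr.
move=> /le_trans; apply; rewrite leeD2l//.
have mV := adapted_measurable (Fm 0%N) aV.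
rewrite (eq_bigr (fun i : 'I_n => ((c i ^+ 2 * v i)%:E * sqmean V)%E)); last first.
  by move=> i _; rewrite sqmeanZ// muleA -EFinM mulrC.
by rewrite -ge0_sume_distrl ?sumEFin// => i _; rewrite lee_fin mulr_ge0 ?sqr_ge0.
Qed.
End Noise.

(** * Brownian increments *)

(** The integral is a supremum over simple functions below the integrand, so
  monotonicity holds without measurability. *)
Lemma ge0_le_integralT d (T : measurableType d) (K : realType)
    (mu : {measure set T -> \bar K}) (f g : T -> \bar K) :
  (forall x, (0 <= f x)%E) -> (forall x, (f x <= g x)%E) ->
  (\int[mu]_x f x <= \int[mu]_x g x)%E.
Proof.
move=> f0 fg.
have g0 x : (0 <= g x)%E by exact: le_trans (fg x).
rewrite !ge0_integralTE//.
apply: ge_ereal_sup => _ [h hf <-].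
apply: ereal_sup_ubound; exists h => // x.
exact: le_trans (hf x) (fg x).
Qed.

Lemma integral_prob_cst d (T : measurableType d) (K : realType)
    (mu : probability T K) (c : K) : (\int[mu]_x c%:E = c%:E)%E.
Proof.
rewrite integral_cst// -[RHS]mule1; congr (_ * _)%E.
exact: probability_setT.
Qed.

(** Averaging over the reflection y -> - y cancels the cross term 2 a b y. *)
Lemma normal_affine_sq (K : realType) (s a b : K) : 0 < s ->
  (\int[normal_prob 0 s]_y ((a + b * (y : K)) ^+ 2)%:E <=
   (a ^+ 2 + 16 * s ^+ 2 * b ^+ 2)%:E)%E.
Proof.
move=> s0; set I := (\int[_]_y _)%E.
have mI (c : K) : measurable_fun setT (fun y : K => ((a + c * y) ^+ 2)%:E).
  apply/measurable_EFinP; apply: measurable_funX; apply: measurable_funD => //.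
have mI2 : measurable_fun setT (fun y : K => (y ^+ 2)%:E).
  by apply/measurable_EFinP; apply: measurable_funX.
have I0 : (0 <= I)%E by apply: integral_ge0 => y _; rewrite lee_fin sqr_ge0.
have sym : (I = \int[normal_prob 0 s]_y ((a + (- b) * (y : K)) ^+ 2)%:E)%E.
  rewrite /I -(integral_normal_opp s0 (mI b)); last by move=> y; rewrite lee_fin sqr_ge0.
  by apply: eq_integral => y _; rewrite mulrN mulNr.
have E : (I + I = \int[normal_prob 0 s]_y ((2 * a ^+ 2)%:E + (2 * b ^+ 2)%:E * ((y : K) ^+ 2)%:E))%E.
  rewrite {2}sym -ge0_integralD//.
  - by apply: eq_integral => y _; rewrite -EFinM -!EFinD; congr EFin; ring.
  - by move=> y _; rewrite lee_fin sqr_ge0.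
  - exact: mI.
  - by move=> y _; rewrite lee_fin sqr_ge0.
  - exact: mI.
have b20 : (0 <= (2 * b ^+ 2)%:E)%E by rewrite lee_fin mulr_ge0// sqr_ge0.
have : (I + I <= (2 * a ^+ 2 + 2 * b ^+ 2 * (16 * s ^+ 2))%:E)%E.
  rewrite E ge0_integralD//; last 3 first.
  - by move=> y _; rewrite lee_fin mulr_ge0// sqr_ge0.
  - by move=> y _; rewrite mule_ge0// lee_fin sqr_ge0.
  - by apply: emeasurable_funM => //; exact: mI2.
  rewrite (integral_prob_cst (normal_prob 0 s)) EFinD leeD2l//.
  rewrite ge0_integralZl//; last by move=> y _; rewrite lee_fin sqr_ge0.
  by rewrite [leRHS]EFinM lee_wpmul2l//; exact: normal_second_moment.
move: I0; case: I {sym E} => [r| |]//= _.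
by rewrite -EFinD !lee_fin; lra.
Qed.

Lemma ge0_integral_normal_law (mu : {measure set R -> \bar R}) (s : R) (f : R -> \bar R) :
  (forall A, measurable A -> mu A = normal_prob 0 s A) ->
  measurable_fun [set: R] f -> (forall x, (0 <= f x)%E) ->
  (\int[mu]_x f x = \int[normal_prob 0 s]_x f x)%E.
Proof.
move=> muE mf f0.
(* the identity between the two copies of the Borel sigma-algebra on R *)
pose i : measurableTypeR R -> R := id.
have mi : measurable_fun setT i by move=> _ A mA; rewrite setTI.
have := @ge0_integral_pushforward _ _ _ _ _ i mi (normal_prob 0 s) setT f measurableT mf (fun x _ => f0 x).
rewrite preimage_setT => <-.
by apply: eq_measure_integral => A mA _; exact: muE.
Qed.

Section Increments.
Context d (Omega : measurableType d) (P : probability Omega R).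
Context (B : R -> {RV P >-> R}) (hB : brownian_motion B).

(** Generators of the sigma-algebra of the Brownian path up to time t. *)
Definition past (t : R) : set (set Omega) :=
  \bigcup_(u in `[0, t]) sigma_rv (B u).

Lemma past_measurable t : past t `<=` measurable.
Proof.
move=> _ [u _ [A mA <-]].
exact: measurable_funPT.
Qed.

Lemma past_sub s t : s <= t -> past s `<=` <<s past t >>.
Proof.
move=> st A [u /=]; rewrite in_itv/= => /andP[u0 us] BA.
by apply: sub_gen_smallest; exists u => //=; rewrite in_itv/= u0 (le_trans us).
Qed.

Lemma past_adapted u t : 0 <= u -> u <= t -> adapted (past t) (B u).
Proof.
move=> u0 ut _ A mA; rewrite setTI.
by apply: sub_gen_smallest; exists u; [rewrite /= in_itv/= u0|exists A => //; rewrite setTI].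
Qed.

Lemma increment_adapted s t u : 0 <= s -> s <= t -> t <= u ->
  adapted (past u) (fun w => B t w - B s w).
Proof.
move=> s0 st tu; apply: measurable_funB; apply: past_adapted => //.
  exact: le_trans st.
exact: le_trans tu.
Qed.

Lemma increment_tonelli s t (f : (g_sigma_algebraType (past s) * R)%type -> \bar R) :
  0 <= s -> s < t ->
  measurable_fun [set: (g_sigma_algebraType (past s) * R)%type] f ->
  (forall x, (0 <= f x)%E) ->
  (\int[P]_w f ((w : g_sigma_algebraType (past s)), (B t w - B s w)%R) =
   \int[P]_w \int[normal_prob 0 (Num.sqrt (t - s))]_y
     f ((w : g_sigma_algebraType (past s)), y))%E.
Proof.
move=> s0 st mf f0.
pose b (w : Omega) : R := B t w - B s w.
have mb : measurable_fun setT b by apply: measurable_funB; exact: measurable_funPT.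
pose mb' := isMeasurableFun.Build _ _ _ _ b mb.
pose beta : {RV P >-> R} := HB.pack b mb'.
have := @indep_tonelli _ _ P (past s) beta f _ _ mf f0.
rewrite /= => ->.
- apply: eq_integral => w _; apply: ge0_integral_normal_law => //.
    by move=> A mA; exact: (brownian_normal hB s0 st mA).
  exact: measurableT_comp mf (pair1_measurable _).
- apply: smallest_sub; first exact: sigma_algebra_measurable.
  exact: past_measurable.
- exact: (brownian_indep hB s0 st).
Qed.

Lemma noise_increment s t : 0 <= s -> s < t ->
  noise P (past s) (16 * (t - s)) (fun w => B t w - B s w).
Proof.
move=> s0 st W V aW aV.
have ts0 : 0 < t - s by rewrite subr_gt0.
have sq0 : 0 < Num.sqrt (t - s) by rewrite sqrtr_gt0.
pose f (x : (g_sigma_algebraType (past s) * R)%type) : \bar R :=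
  ((W x.1 + V x.1 * x.2) ^+ 2)%:E.
have mf : measurable_fun [set: (g_sigma_algebraType (past s) * R)%type] f.
  apply/measurable_EFinP; apply: measurable_funX; apply: measurable_funD.
    exact: (measurableT_comp aW measurable_fst).
  apply: measurable_funM; last exact: measurable_snd.
  exact: (measurableT_comp aV measurable_fst).
rewrite /sqmean (increment_tonelli s0 st mf) /f /=; last first.
  by move=> x; rewrite lee_fin sqr_ge0.
have mW := adapted_measurable (@past_measurable s) aW.
have mV := adapted_measurable (@past_measurable s) aV.
have q0 c : (0 <= (c ^+ 2)%:E :> \bar R)%E by rewrite lee_fin sqr_ge0.
have mq (g : Omega -> R) : measurable_fun setT g -> measurable_fun setT (fun w => (g w ^+ 2)%:E).
  by move=> mg; apply/measurable_EFinP; exact: measurable_funX.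
have c0 : 0 <= 16 * (t - s) by rewrite mulr_ge0// ltW.
have c0E : (0 <= (16 * (t - s))%:E)%E by rewrite lee_fin.
rewrite [leRHS](_ : _ =
    \int[P]_w ((W w ^+ 2)%:E + (16 * (t - s))%:E * (V w ^+ 2)%:E))%E; last first.
  rewrite ge0_integralD//; last 3 first.
  - exact: mq.
  - by move=> w _; rewrite mule_ge0.
  - by apply: emeasurable_funM => //; exact: mq.
  by rewrite ge0_integralZl//; exact: mq.
apply: ge0_le_integralT => [w|w]; first by apply: integral_ge0.
apply: le_trans (normal_affine_sq _ _ sq0) _.
by rewrite -EFinM -EFinD lee_fin sqr_sqrtr// ltW.
Qed.

(** Conditionally on the past, the exponential factor has mean one half. *)
Lemma increment_exp s t (F : Omega -> \bar R) : 0 <= s -> s < t ->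
  measurable_fun [set: g_sigma_algebraType (past s)] (F : g_sigma_algebraType (past s) -> _) ->
  (forall w, (0 <= F w)%E) ->
  (\int[P]_w (F w * (expR (- (3 / 2 * ((B t w - B s w) ^+ 2 / (t - s)))))%:E) =
   (2^-1)%:E * \int[P]_w F w)%E.
Proof.
move=> s0 st mF F0.
have ts0 : 0 < t - s by rewrite subr_gt0.
have sq0 : 0 < Num.sqrt (t - s) by rewrite sqrtr_gt0.
pose g (y : R) := expR (- (3 / 2 * (y / Num.sqrt (t - s)) ^+ 2)).
have mg : measurable_fun setT g.
  apply: measurableT_comp => //; apply: measurable_funN; apply: measurable_funM => //.
  by apply: measurable_funX; apply: measurable_funM.
pose f (x : (g_sigma_algebraType (past s) * R)%type) : \bar R := (F x.1 * (g x.2)%:E)%E.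
have g0 y : (0 <= (g y)%:E)%E by rewrite lee_fin expR_ge0.
have f0 x : (0 <= f x)%E by rewrite mule_ge0.
have mf : measurable_fun [set: (g_sigma_algebraType (past s) * R)%type] f.
  apply: emeasurable_funM; first exact: (measurableT_comp mF measurable_fst).
  by apply/measurable_EFinP; exact: (measurableT_comp mg measurable_snd).
have := increment_tonelli s0 st mf f0; rewrite /f /=.
rewrite (eq_integral (fun w => F w * (expR (- (3 / 2 * ((B t w - B s w) ^+ 2 / (t - s)))))%:E)%E); last first.
  by move=> w _; rewrite /g exprMn exprVn sqr_sqrtr// ltW.
move=> ->; rewrite muleC.
rewrite -ge0_integralZr//.
- apply: eq_integral => w _; rewrite ge0_integralZl//; last exact/measurable_EFinP.
  by rewrite normal_exp_moment.
- move=> _ A mA; rewrite setTI.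
  have := mF measurableT A mA; rewrite setTI; apply.
  by split => //; [exact: sigma_algebra_measurable|exact: past_measurable].
Qed.

(** The factors are peeled off from the last one. Since the mean of the exponential
  is 2^-n, a quadratic variation much below its expectation is exponentially rare. *)
Lemma increments_exp (t : nat -> R) n : 0 <= t 0%N -> (forall i, t i < t i.+1) ->
  (\int[P]_w (expR (- (3 / 2 * \sum_(i < n)
     ((B (t i.+1) w - B (t i) w) ^+ 2 / (t i.+1 - t i)))))%:E = (2^-1 ^+ n)%:E)%E.
Proof.
move=> t0 tt; have ti0 i : 0 <= t i by elim: i => // i IH; apply: (le_trans IH); exact: ltW.
have tmono i j : (i <= j)%N -> t i <= t j.
  by move=> ij; apply: (homo_leq _ (@le_trans _ _)) ij => // k; exact: ltW.
elim: n => [|n IH].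
  under eq_integral do rewrite big_ord0 mulr0 oppr0 exp.expR0.
  by rewrite (integral_prob_cst P).
pose S w := \sum_(i < n) ((B (t i.+1) w - B (t i) w) ^+ 2 / (t i.+1 - t i)).
transitivity (\int[P]_w ((expR (- (3 / 2 * S w)))%:E *
    (expR (- (3 / 2 * ((B (t n.+1) w - B (t n) w) ^+ 2 / (t n.+1 - t n)))))%:E))%E.
  apply: eq_integral => w _; rewrite big_ord_recr /= -EFinM -exp.expRD.
  by congr (expR _)%:E; rewrite -/(S w); ring.
rewrite increment_exp//.
  by rewrite IH -EFinM exprS.
apply/measurable_EFinP; apply: measurableT_comp => //; apply: measurable_funN.
apply: measurable_funM => //; apply: measurable_sum => i.
apply: measurable_funM => //; apply: measurable_funX.
apply: increment_adapted => //; first exact: ltW.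
exact: tmono.
Qed.
End Increments.

(** * Riemann integrals and Riemann sums *)

Section RiemannWrappers.
Implicit Types (f g : R -> R) (a b c : R).

Lemma riemann_is f a b : riemann_integrable f a b -> is_riemann f a b (riemann f a b).
Proof. exact: (@RInt.RInt_correct Hierarchy.R_CompleteNormedModule). Qed.

Lemma is_riemannE f a b v : is_riemann f a b v -> riemann f a b = v.
Proof. exact: (@RInt.is_RInt_unique Hierarchy.R_CompleteNormedModule). Qed.

Lemma is_riemann_ex f a b v : is_riemann f a b v -> riemann_integrable f a b.
Proof. by exists v. Qed.

Lemma riemann_cat f a b c :
  riemann_integrable f a b -> riemann_integrable f b c ->
  riemann f a b + riemann f b c = riemann f a c.
Proof. exact: (@RInt.RInt_Chasles Hierarchy.R_CompleteNormedModule). Qed.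

Lemma riemann_integrable_sub f a b c d : a <= c -> c <= d -> d <= b ->
  riemann_integrable f a b -> riemann_integrable f c d.
Proof.
move=> ac cd db fi.
apply: (@RInt.ex_RInt_Chasles_2 Hierarchy.R_CompleteNormedModule f a).
  by split; apply/RleP; [exact: ac|exact: cd].
apply: (@RInt.ex_RInt_Chasles_1 Hierarchy.R_CompleteNormedModule f a d b) => //.
by split; apply/RleP => //; exact: le_trans cd.
Qed.

Lemma is_riemannD f g a b u v : is_riemann f a b u -> is_riemann g a b v ->
  is_riemann (fun x => f x + g x) a b (u + v).
Proof. exact: (@RInt.is_RInt_plus Hierarchy.R_NormedModule). Qed.

Lemma is_riemannZ f a b c u : is_riemann f a b u ->
  is_riemann (fun x => c * f x) a b (c * u).
Proof. exact: (@RInt.is_RInt_scal Hierarchy.R_NormedModule). Qed.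

Lemma is_riemannB f g a b u v : is_riemann f a b u -> is_riemann g a b v ->
  is_riemann (fun x => f x - g x) a b (u - v).
Proof. exact: (@RInt.is_RInt_minus Hierarchy.R_NormedModule). Qed.

Lemma is_riemann_cst a b c : is_riemann (fun=> c) a b ((b - a) * c).
Proof. exact: (@RInt.is_RInt_const Hierarchy.R_NormedModule). Qed.

Lemma is_riemann_ext f g a b v : (forall x : R, a < x < b -> f x = g x) -> a <= b ->
  is_riemann f a b v -> is_riemann g a b v.
Proof.
move=> fg ab; apply: (@RInt.is_RInt_ext Hierarchy.R_NormedModule) => x.
rewrite Rmin_left; last exact/RleP.
rewrite Rmax_right; last exact/RleP.
by case=> /RltP ax /RltP xb; apply: fg; rewrite ax.
Qed.

Lemma riemann_integrable_ext f g a b : (forall x : R, a < x < b -> f x = g x) -> a <= b ->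
  riemann_integrable f a b -> riemann_integrable g a b.
Proof. by move=> fg ab [v fv]; exists v; exact: is_riemann_ext fv. Qed.

Lemma is_riemann_le f g a b u v : a <= b -> is_riemann f a b u -> is_riemann g a b v ->
  (forall x : R, a < x < b -> f x <= g x) -> u <= v.
Proof.
move=> ab fu gv fg; apply/RleP.
rewrite -(is_riemannE fu) -(is_riemannE gv).
apply: RInt.RInt_le; [exact/RleP|by exists u|by exists v|].
by move=> x [/RltP ax /RltP xb]; apply/RleP/fg; rewrite ax.
Qed.

Lemma is_riemann_norm_le f a b (u M : R) : a <= b -> is_riemann f a b u ->
  (forall x : R, a < x < b -> `|f x| <= M) -> `|u| <= (b - a) * M.
Proof.
move=> ab fu fM; rewrite ler_norml -mulrN.
rewrite (is_riemann_le ab (@is_riemann_cst a b (- M)) fu); last first.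
  by move=> x /fM; rewrite ler_norml => /andP[].
rewrite (is_riemann_le ab fu (@is_riemann_cst a b M))//.
by move=> x /fM; rewrite ler_norml => /andP[].
Qed.

Lemma riemann_integrable_norm f a b : riemann_integrable f a b ->
  riemann_integrable (fun x => `|f x|) a b.
Proof.
move=> /RInt.ex_RInt_norm; apply: (@RInt.ex_RInt_ext Hierarchy.R_NormedModule) => x _.
exact: RabsE.
Qed.

Lemma continuous_riemann_integrable f a b :
  (forall x, continuity_pt f x) -> riemann_integrable f a b.
Proof.
move=> fc; apply: (@RInt.ex_RInt_continuous Hierarchy.R_CompleteNormedModule) => z _.
exact/Hierarchy.continuity_pt_filterlim.
Qed.

Lemma riemann_point f a : is_riemann f a a 0.
Proof. exact: (@RInt.is_RInt_point Hierarchy.R_NormedModule). Qed.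
End RiemannWrappers.
Arguments is_riemannZ [f a b] c [u].

Definition left_sum (g : R -> R) (t D : R) (n : nat) : R :=
  D / n%:R * \sum_(k < n) g (t + k%:R * (D / n%:R)).

(** By uniform continuity, each of the n steps of length D / n contributes an
  error of at most e / n. *)
Lemma left_riemann_sum_cvg (g : R -> R) (t D : R) :
  (forall x, continuity_pt g x) -> 0 < D ->
  left_sum g t D n @[n --> \oo] --> riemann g t (t + D).
Proof.
move=> gc D0.
have gi a b : riemann_integrable g a b by exact: continuous_riemann_integrable.
have /= unif := Rtopology.Heine g _ (Rtopology.compact_P3 t (t + D)) (fun x _ => gc x).
apply/(@cvgrPdist_le _ R^o) => /= e e0.
have eD0 : 0 < e / D by rewrite divr_gt0.
have /RltP eD0R := eD0.
have [[dl dl0] dlP] := unif (RIneq.mkposreal _ eD0R).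
near=> n.
have n0 : 0 < n%:R :> R by near: n; exact: nbhs_infty_gtr.
set h := D / n%:R.
have h0 : 0 < h by rewrite divr_gt0.
have hdl : h < dl.
  rewrite /h ltr_pdivrMr// mulrC -ltr_pdivrMr; last exact/RltP.
  by near: n; exact: nbhs_infty_gtr.
have step m : (m <= n)%N ->
    `|riemann g t (t + m%:R * h) - h * \sum_(k < m) g (t + k%:R * h)| <=
    m%:R * (h * (e / D)).
  elim: m => [_|m IH mn].
    by rewrite big_ord0 mulr0 mul0r mul0r addr0 (is_riemannE (@riemann_point g t)) subrr normr0.
  rewrite -(@riemann_cat _ _ (t + m%:R * h))// big_ord_recr/= mulrDr.
  rewrite opprD addrACA -[in X in _ <= X]natr1 mulrDl mul1r.
  apply: (le_trans (ler_normD _ _)); apply: lerD; first exact/IH/ltnW.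
  have E : t + m.+1%:R * h - (t + m%:R * h) = h by rewrite -natr1; ring.
  have mh : t + m%:R * h <= t + m.+1%:R * h by rewrite -subr_ge0 E ltW.
  rewrite -[X in X * (e / D)]E.
  have -> : h * g (t + m%:R * h) = (t + m.+1%:R * h - (t + m%:R * h)) * g (t + m%:R * h).
    by rewrite E.
  apply: (is_riemann_norm_le mh).
    exact: is_riemannB (riemann_is (gi _ _)) (@is_riemann_cst _ _ _).
  move=> x /andP[ax xb]; rewrite -RabsE; apply/RleP/Rlt_le.
  have mh0 : 0 <= m%:R * h by rewrite mulr_ge0// ltW.
  have mhD : t + m.+1%:R * h <= t + D.
    by rewrite lerD2l /h mulrA ler_pdivrMr// mulrC ler_wpM2l ?ler_nat// ltW.
  apply: dlP => /=.
  - by split; apply/RleP; lra.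
  - by split; apply/RleP; lra.
  - by rewrite RabsE RminusE; apply/RltP; rewrite ger0_norm; lra.
have := step n (leqnn n).
have -> : n%:R * h = D by rewrite /h mulrC divfK// gt_eqF.
rewrite mulrA /left_sum -/h.
have -> : n%:R * h * (e / D) = e.
  by rewrite /h; field; rewrite !gt_eqF.
by [].
Unshelve. all: by end_near. Qed.

(** * The exact autoregressive step of an Ornstein-Uhlenbeck equation *)

Lemma is_derive_exp_shift (a c u : R) :
  @Derive.is_derive Hierarchy.R_AbsRing Hierarchy.R_NormedModule
    (fun u => expR (- (a * (c - u)))) u (a * expR (- (a * (c - u)))).
Proof.
pose g := Ranalysis1.minus_fct (Ranalysis1.mult_real_fct a Ranalysis1.id)
  (Ranalysis1.fct_cte (a * c)).
apply: (@Derive.is_derive_ext Hierarchy.R_AbsRing Hierarchy.R_NormedModule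
  (Ranalysis1.comp Rtrigo_def.exp g)) => [v|].
  by rewrite /Ranalysis1.comp RexpE; congr expR; rewrite /g /Ranalysis1.mult_real_fct /Ranalysis1.minus_fct
    /Ranalysis1.fct_cte /Ranalysis1.id !RealsE; ring.
have -> : a * expR (- (a * (c - u))) =
    Rmult (Rtrigo_def.exp (g u)) (Rminus (Rmult a (IZR 1)) (IZR 0)).
  rewrite RexpE /g /Ranalysis1.mult_real_fct /Ranalysis1.minus_fct
    /Ranalysis1.fct_cte /Ranalysis1.id !RealsE.
  by rewrite (_ : a * u - a * c = - (a * (c - u))); ring.
apply/Derive.is_derive_Reals/Ranalysis1.derivable_pt_lim_comp.
  apply: Ranalysis1.derivable_pt_lim_minus; last exact: Ranalysis1.derivable_pt_lim_const.
  exact/Ranalysis1.derivable_pt_lim_scal/Ranalysis1.derivable_pt_lim_id.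
exact: derivable_pt_lim_exp.
Qed.

Section ArStep.
Variables (a t D : R).
Hypothesis D0 : 0 < D.

Definition decay (u : R) : R := expR (- (a * (t + D - u))).

(** The integral of [decay] times f over [t, t + D], integrated by parts. *)
Definition ar_mean (f : R -> R) : R :=
  riemann f t (t + D) - a * riemann (fun u => decay u * riemann f t u) t (t + D).

(** Riemann approximation of the stochastic integral of [decay] against b over
  [t, t + D], integrated by parts so that it makes sense for each path. *)
Definition ar_noise (b : R -> R) (n : nat) : R :=
  b (t + D) - b t - a * left_sum (fun u => decay u * (b u - b t)) t D n.

Lemma continuous_decay u : continuity_pt decay u.
Proof.
apply/continuity_pt_cvg => /=; rewrite /decay.
apply: continuous_comp; last exact: continuous_expR.
apply: (@continuousN _ R^o); apply: (@continuousM R); first exact: cst_continuous.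
by apply: (@continuousB _ R^o); [exact: cst_continuous|].
Qed.

Lemma is_riemann_decay : is_riemann (fun u => a * decay u) t (t + D) (1 - expR (- (a * D))).
Proof.
have -> : 1 - expR (- (a * D)) = decay (t + D) - decay t.
  by rewrite /decay subrr mulr0 oppr0 exp.expR0; congr (_ - expR (- (a * _))); ring.
apply: (@RInt_analysis.is_RInt_derive Hierarchy.R_CompleteNormedModule) => u _.
  exact: is_derive_exp_shift.
apply/Hierarchy.continuity_pt_filterlim.
apply: continuity_pt_mult; last exact: continuous_decay.
exact: continuity_pt_const.
Qed.

Lemma decay_tD : decay (t + D) = 1.
Proof. by rewrite /decay subrr mulr0 oppr0 exp.expR0. Qed.

Lemma primitive_derive (x : R -> R) u : (forall s, continuity_pt x s) ->
  @Derive.is_derive Hierarchy.R_AbsRing Hierarchy.R_NormedModule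
    (fun v => riemann x t v) u (x u).
Proof.
move=> xc; apply: RInt_analysis.is_derive_RInt.
  by apply: Hierarchy.filter_forall => v; apply: riemann_is; exact: continuous_riemann_integrable.
by apply/Hierarchy.continuity_pt_filterlim; exact: xc.
Qed.

Lemma primitive_continuous (x : R -> R) u : (forall s, continuity_pt x s) ->
  continuity_pt (fun v => riemann x t v) u.
Proof.
move=> xc; apply/Hierarchy.continuity_pt_filterlim.
apply: (@Derive.ex_derive_continuous Hierarchy.R_AbsRing Hierarchy.R_NormedModule).
by exists (x u); exact: primitive_derive.
Qed.

Lemma continuous_decayM (x : R -> R) u : continuity_pt x u ->
  continuity_pt (fun v => decay v * x v) u.
Proof. by move=> xc; apply: continuity_pt_mult => //; exact: continuous_decay. Qed.

(** The integrand is the derivative of [decay] times the primitive of x. *)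
Lemma is_riemann_decay_primitive (x : R -> R) : (forall s, continuity_pt x s) ->
  is_riemann (fun u => decay u * (x u + a * riemann x t u)) t (t + D) (riemann x t (t + D)).
Proof.
move=> xc.
have -> : riemann x t (t + D) =
    decay (t + D) * riemann x t (t + D) - decay t * riemann x t t.
  by rewrite decay_tD (is_riemannE (@riemann_point x t)) mulr0 subr0 mul1r.
apply: (@RInt_analysis.is_RInt_derive Hierarchy.R_CompleteNormedModule
  (fun u => decay u * riemann x t u)) => u _.
  have -> : decay u * (x u + a * riemann x t u) =
      Rplus (Rmult (a * decay u) (riemann x t u)) (Rmult (decay u) (x u)).
    by rewrite !RealsE; ring.
  apply: (@Derive.is_derive_mult decay _ u (a * decay u) (x u)); last exact: primitive_derive.
  exact: is_derive_exp_shift.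
apply/Hierarchy.continuity_pt_filterlim.
apply: continuous_decayM; apply: continuity_pt_plus; first exact: xc.
apply: continuity_pt_scal; exact: primitive_continuous.
Qed.

(** Variation of constants, path by path: the integral form of the equation is
  multiplied by [decay] and integrated by parts. As a limit of approximants that
  involve finitely many values of b, the noise inherits their moment bounds. *)
Lemma ar_representation (f x b : R -> R) (sg : R) :
  sg != 0 -> (forall s, continuity_pt x s) ->
  (forall s, continuity_pt b s) ->
  (forall u : R, t <= u <= t + D ->
    is_riemann (fun v => f v - a * x v) t u (x u - x t - sg * (b u - b t))) ->
  ar_noise b n @[n --> \oo] -->
    (x (t + D) - expR (- (a * D)) * x t - ar_mean f) / sg.
Proof.
move=> sg0 xc bc sol.
have ttD : t <= t + D by rewrite lerDl ltW.
pose I u := riemann x t u.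
have xI u : is_riemann x t u (I u) by apply: riemann_is; exact: continuous_riemann_integrable.
have fE u : t <= u <= t + D -> riemann f t u = x u - x t + a * I u - sg * (b u - b t).
  move=> /[dup] /andP[tu _] /sol /is_riemannD /(_ (is_riemannZ a (xI u))) H.
  rewrite (is_riemannE (is_riemann_ext _ tu H)); first by rewrite /I; ring.
  by move=> v _; rewrite subrK.
have bdc : forall s, continuity_pt (fun u => b u - b t) s.
  by move=> s; apply: continuity_pt_minus; [exact: bc|exact: continuity_pt_const].
pose g u := decay u * (b u - b t).
have gc s : continuity_pt g s by exact/continuous_decayM/bdc.
have gi : is_riemann g t (t + D) (riemann g t (t + D)).
  by apply: riemann_is; exact: continuous_riemann_integrable.
have H1 := is_riemann_decay_primitive xc.
have H2 := is_riemannZ (x t) is_riemann_decay.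
have H3 := is_riemannZ (a * sg) gi.
have H4 := is_riemannB (is_riemannB (is_riemannZ a H1) H2) H3.
have H5 : is_riemann (fun u => a * (decay u * riemann f t u)) t (t + D)
    (a * riemann x t (t + D) - x t * (1 - expR (- (a * D))) - a * sg * riemann g t (t + D)).
  apply: is_riemann_ext ttD H4 => u /andP[tu utD].
  by rewrite fE ?(ltW tu) ?(ltW utD)// /g /I; ring.
have aE : a * riemann (fun u => decay u * riemann f t u) t (t + D) =
    a * riemann x t (t + D) - x t * (1 - expR (- (a * D))) - a * sg * riemann g t (t + D).
  have [a0|a0] := eqVneq a 0.
    by rewrite a0 !mul0r oppr0 exp.expR0 subrr; ring.
  have H6 := is_riemannZ a^-1 H5.
  rewrite (is_riemannE (is_riemann_ext (g := fun u => decay u * riemann f t u) _ ttD H6)).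
    by rewrite mulVKf.
  by move=> u _; rewrite mulKf.
have -> : (x (t + D) - expR (- (a * D)) * x t - ar_mean f) / sg =
    b (t + D) - b t - a * riemann g t (t + D).
  by rewrite /ar_mean aE fE ?lexx ?andbT// /I; field.
apply: (@cvgB _ R^o); first exact: cvg_cst.
apply: cvgM; first exact: cvg_cst.
exact: left_riemann_sum_cvg.
Qed.

(** The equation expresses the primitive of f by continuous functions. *)
Lemma decay_primitive_integrable (f x b : R -> R) (sg : R) :
  a != 0 -> (forall s, continuity_pt x s) ->
  (forall s, continuity_pt b s) ->
  (forall u : R, t <= u <= t + D ->
    is_riemann (fun v => f v - a * x v) t u (x u - x t - sg * (b u - b t))) ->
  riemann_integrable (fun u => decay u * riemann f t u) t (t + D).
Proof.
move=> a0 xc bc sol.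
have ttD : t <= t + D by rewrite lerDl ltW.
have xI u : is_riemann x t u (riemann x t u).
  by apply: riemann_is; exact: continuous_riemann_integrable.
apply: (riemann_integrable_ext (f := fun u =>
    decay u * (x u - x t + a * riemann x t u - sg * (b u - b t))) _ ttD).
  move=> u /andP[/ltW tu /ltW utD]; congr (_ * _).
  have tuD : t <= u <= t + D by rewrite tu.
  have H := is_riemannD (sol u tuD) (is_riemannZ a (xI u)).
  rewrite (is_riemannE (is_riemann_ext (g := f) _ tu H)); first by ring.
  by move=> v _; rewrite subrK.
apply: continuous_riemann_integrable => s; apply: continuous_decayM.
apply: continuity_pt_minus; last first.
  apply: continuity_pt_scal; apply: continuity_pt_minus; first exact: bc.
  exact: continuity_pt_const.
apply: continuity_pt_plus; last first.
  by apply: continuity_pt_scal; exact: primitive_continuous.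
apply: continuity_pt_minus; first exact: xc.
exact: continuity_pt_const.
Qed.

Lemma is_riemann_norm (f : R -> R) (u v l : R) : u <= v -> is_riemann f u v l ->
  `|l| <= riemann (fun s => `|f s|) u v.
Proof.
move=> uv fl.
have ni := riemann_is (riemann_integrable_norm (is_riemann_ex fl)).
rewrite ler_norml; apply/andP; split; last first.
  by apply: (is_riemann_le uv fl ni) => s _; exact: ler_norm.
rewrite -mulN1r; apply: (is_riemann_le uv (is_riemannZ (-1) ni) fl) => s _.
by rewrite mulN1r lerNl -normrN; exact: ler_norm.
Qed.

Lemma ar_mean_bound (f : R -> R) (M : R) :
  0 < a -> riemann_integrable f t (t + D) ->
  riemann_integrable (fun u => decay u * riemann f t u) t (t + D) ->
  (forall u : R, t <= u <= t + D -> `|f u| <= M) ->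
  `|ar_mean f - D * f t| <= riemann (fun u => `|f u - f t|) t (t + D) + a * D ^+ 2 * M.
Proof.
move=> a0 fi di fM.
have ttD : t <= t + D by rewrite lerDl ltW.
have DE : t + D - t = D by ring.
rewrite /ar_mean -addrA (addrC (- (a * _))) addrA -mulrN -mulrA.
apply: (le_trans (ler_normD _ _)); apply: lerD.
  have := is_riemannB (riemann_is fi) (@is_riemann_cst t (t + D) (f t)).
  by rewrite DE mulrN => /(is_riemann_norm ttD).
rewrite normrN normrM gtr0_norm// -mulrA; apply: ler_wpM2l; first exact: ltW.
rewrite -[X in X * (D * M)]DE.
have M0 : 0 <= M by apply: le_trans (fM t _) => //; rewrite lexx ttD.
apply: (is_riemann_norm_le ttD (riemann_is di)) => u /andP[tu utD].
rewrite normrM -[leRHS]mul1r ler_pM//.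
  rewrite ger0_norm ?expR_ge0// -(exp.expR0) ler_expR oppr_le0.
  by rewrite mulr_ge0 ?subr_ge0 ?ltW.
have fui : riemann_integrable f t u by apply: riemann_integrable_sub fi => //; exact: ltW.
apply: (le_trans (is_riemann_norm_le (ltW tu) (riemann_is fui) (M := M) _)).
  by move=> v /andP[tv vu]; apply: fM; rewrite (ltW tv) (le_trans (ltW vu))// ltW.
by rewrite ler_wpM2r//; lra.
Qed.
End ArStep.

(** * Events of high probability *)

Section Whp.
Context d (Omega : measurableType d) (P : probability Omega R).

(** Q holds with probability at least 1 - eta. The exceptional set A is explicit
  because Q itself may fail to be measurable. *)
Definition whp (eta : R) (Q : Omega -> Prop) :=
  exists A, [/\ measurable A, (P A <= eta%:E)%E & forall w, ~ A w -> Q w].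

Lemma whp_and e1 e2 Q1 Q2 : whp e1 Q1 -> whp e2 Q2 ->
  whp (e1 + e2) (fun w => Q1 w /\ Q2 w).
Proof.
move=> [A1 [mA1 PA1 QA1]] [A2 [mA2 PA2 QA2]]; exists (A1 `|` A2); split.
- exact: measurableU.
- rewrite EFinD; apply: le_trans (leeD PA1 PA2); exact: measureU2.
- by move=> w /not_orP[/QA1 ? /QA2].
Qed.

Lemma whp_imp e e' (Q Q' : Omega -> Prop) : e <= e' -> (forall w, Q w -> Q' w) ->
  whp e Q -> whp e' Q'.
Proof.
move=> ee QQ [A [mA PA QA]]; exists A; split => //.
  by apply: le_trans PA _; rewrite lee_fin.
by move=> w /QA /QQ.
Qed.

Lemma whp_ae (Q : Omega -> Prop) : {ae P, forall w, Q w} -> whp 0 Q.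
Proof.
move=> [A [mA PA QA]]; exists A; split => //; first by rewrite PA.
by move=> w Aw; apply: contrapT => nQ; apply: Aw; exact: QA.
Qed.

Lemma whp_all (m : nat) e (Q : nat -> Omega -> Prop) :
  (forall i, (i < m)%N -> whp e (Q i)) ->
  whp (m%:R * e) (fun w => forall i, (i < m)%N -> Q i w).
Proof.
elim: m => [_|m IH QQ].
  by exists set0; split => //; rewrite mul0r measure0.
have H := whp_and (IH (fun i im => QQ i (ltnW im))) (QQ m (leqnn _)).
apply: whp_imp H; first by rewrite -natr1 mulrDl mul1r.
move=> w [H1 H2] i; rewrite ltnS leq_eqVlt => /orP[/eqP->//|]; exact: H1.
Qed.

Lemma measurable_gt (f : Omega -> R) (c : R) :
  measurable_fun setT f -> measurable [set w | c < f w].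
Proof.
move=> mf; have := measurable_fun_ltr (measurable_cst c) mf measurableT (Y := [set true]).
by rewrite setTI; apply.
Qed.

Lemma whp_markov (f : Omega -> R) (C c : R) : measurable_fun setT f ->
  (forall w, 0 <= f w) -> (\int[P]_w (f w)%:E <= C%:E)%E -> 0 < c ->
  whp (C / c) (fun w => f w <= c).
Proof.
move=> mf f0 fC c0; exists [set w | c < f w].
have mA := measurable_gt c mf.
split => //; last by move=> w /= /negP; rewrite -leNgt.
rewrite EFinM -lee_pdivrMr// ?lte_fin ?invr_gt0// -?EFinV ?gt_eqF// ?invrK.
apply: le_trans fC.
have <- : (\int[P]_w (c * \1_[set w | (c < f w)%R] w)%:E = P [set w | (c < f w)%R] * c%:E)%E.
  under eq_integral do rewrite EFinM.
  rewrite ge0_integralZl//; last 2 first.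
  - exact/measurable_EFinP.
  - by rewrite lee_fin ltW.
  by rewrite integral_indic// setIT muleC.
apply: ge0_le_integralT => w.
  by rewrite lee_fin mulr_ge0// ltW.
rewrite lee_fin indicE; have [/set_mem /= cf|_] := boolP (w \in _).
  by rewrite mulr1 ltW.
by rewrite mulr0.
Qed.

Lemma whp_prob eta (E : set Omega) : measurable E -> whp eta E -> ((1 - eta)%:E <= P E)%E.
Proof.
move=> mE [A [mA PA AE]].
rewrite -(setCK E) probability_setC; last exact: measurableC.
rewrite EFinB; apply: leeB => //.
apply: le_trans PA; apply: le_measure; rewrite ?inE//; first exact: measurableC.
by move=> w Ew; apply: contrapT => /AE.
Qed.

Lemma whp_exists eta Q : eta < 1 -> whp eta Q -> exists w, Q w.
Proof.
move=> e1 [A [mA PA AQ]]; apply: contrapT => nQ.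
have AT : A = setT.
  by apply/seteqP; split => // w _; apply: contrapT => /AQ Qw; apply: nQ; exists w.
by move: PA; rewrite AT probability_setT lee_fin leNgt e1.
Qed.

(** Multiplying by the indicator of the complement of a null set makes the
  convergence hold everywhere, so that Fatou's lemma applies. *)
Lemma fatou_bound (f : nat -> Omega -> R) (g : Omega -> R) (C : R) :
  (forall q, measurable_fun setT (f q)) -> measurable_fun setT g ->
  (forall q w, 0 <= f q w) -> (forall w, 0 <= g w) ->
  (forall q, \int[P]_w (f q w)%:E <= C%:E)%E ->
  {ae P, forall w, f q w @[q --> \oo] --> g w} ->
  (\int[P]_w (g w)%:E <= C%:E)%E.
Proof.
move=> mf mg f0 g0 fC fg.
have [A [mA PA AP]] := fg.
pose h (w : Omega) : R := \1_(~` A) w.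
have mh : measurable_fun setT h by apply: measurable_indic; exact: measurableC.
have h0 w : 0 <= h w by rewrite /h indicE.
have fh w : (f q w * h w) @[q --> \oo] --> g w * h w.
  rewrite /h indicE; have [wA|wA] := boolP (w \in ~` A); last first.
    by rewrite mulr0; under eq_fun do rewrite mulr0; exact: cvg_cst.
  rewrite mulr1; under eq_fun do rewrite mulr1.
  have nA : ~ A w by exact: set_mem wA.
  by apply: contrapT => nfg; apply: nA; exact: AP.
have gE : (\int[P]_w (g w)%:E = \int[P]_w (g w * h w)%:E)%E.
  apply: ge0_ae_eq_integral => //.
  - exact/measurable_EFinP.
  - by apply/measurable_EFinP; exact: measurable_funM.
  - by move=> w _; rewrite lee_fin.
  - by move=> w _; rewrite lee_fin mulr_ge0.
  exists A; split => // w /=; move=> nE; apply: contrapT => nA; apply: nE => _.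
  by rewrite /h indicE mem_set ?mulr1.
rewrite gE.
have -> : (\int[P]_w (g w * h w)%:E = \int[P]_w limn_einf (fun q => (f q w * h w)%:E))%E.
  apply: eq_integral => w _; apply/esym.
  apply: (cvg_limn_einf_sup _).1.
  by apply/fine_cvgP; split; [exact: nearW|exact: fh].
apply: (@le_trans _ _ (limn_einf (fun q => \int[P]_w (f q w * h w)%:E)%E)).
  apply: fatou => //.
  - by move=> q; apply/measurable_EFinP; exact: (measurable_funM (mf q) mh).
  - by move=> q w _; rewrite lee_fin mulr_ge0.
rewrite limn_einf_lim; apply: lime_le; first exact: is_cvg_einfs.
near=> q; apply: (@le_trans _ _ (\int[P]_w (f q w * h w)%:E)%E).
  by apply: ereal_inf_lbound; exists q => //=.
apply: le_trans (fC q); apply: ge0_le_integralT => w.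
  by rewrite lee_fin mulr_ge0.
rewrite lee_fin ler_piMr// /h indicE.
by case: (_ \in _).
Unshelve. all: by end_near. Qed.
End Whp.

(** * Autoregressions driven by noise *)

Lemma ler_of_eq (u v : R) : u = v -> u <= v.
Proof. by move->. Qed.

Lemma sqr_le_norm (u c : R) : `|u| <= c -> u ^+ 2 <= c ^+ 2.
Proof. by move=> uc; rewrite -real_normK ?num_real// ler_pXn2r ?nnegrE// (le_trans _ uc). Qed.

Fixpoint ar (rho : R) (e : nat -> R) (n : nat) : R :=
  if n is m.+1 then rho * ar rho e m + e m else 0.

(** The recursion dual to [ar], run backwards for k steps from time n. *)
Fixpoint adjoint (rho : R) (h : nat -> R) (n k : nat) : R :=
  if k is m.+1 then h (n - k)%N + rho * adjoint rho h n m else 0.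

(** Summation by parts: a weighted sum of the autoregression is a weighted sum of
  its innovations, with weights known in advance. *)
Lemma sum_ar_adjoint (rho : R) (h e : nat -> R) n :
  \sum_(i < n) h i * ar rho e i = \sum_(i < n) adjoint rho h n (n - i.+1) * e i.
Proof.
suff H m : (m <= n)%N -> \sum_(i < m) h i * ar rho e i + adjoint rho h n (n - m) * ar rho e m =
    \sum_(i < m) adjoint rho h n (n - i.+1) * e i.
  by have := H n (leqnn n); rewrite subnn /= mul0r addr0.
elim: m => [_|m IH mn]; first by rewrite !big_ord0 mulr0 addr0.
rewrite !big_ord_recr /= -(IH (ltnW mn)).
have -> : (n - m)%N = (n - m.+1).+1 by rewrite subnSK.
have E : (n - (n - m.+1).+1)%N = m by rewrite subnSK// subKn// ltnW.
by rewrite [adjoint _ _ _ (_.+1)]/= E; ring.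
Qed.

Lemma adjoint_bound (rho : R) (h : nat -> R) n (Ch : R) k : 0 <= rho -> rho < 1 -> (forall i, `|h i| <= Ch) ->
  `|adjoint rho h n k| <= Ch / (1 - rho).
Proof.
move=> r0 r1 hC; have C0 : 0 <= Ch by apply: le_trans (hC 0%N).
have r10 : 0 < 1 - rho by rewrite subr_gt0.
elim: k => [|k IH] /=; first by rewrite normr0 divr_ge0// ltW.
apply: le_trans (ler_normD _ _) _; rewrite normrM (ger0_norm r0).
apply: le_trans (lerD (hC _) (ler_wpM2l r0 IH)) _.
apply: ler_of_eq; field; rewrite gt_eqF//.
Qed.

Section NoiseSystem.
Context d (Omega : measurableType d) (P : probability Omega R).
Context (F : nat -> set (set Omega)) (v : R) (xi : nat -> Omega -> R).
Hypothesis FF : forall i, F i `<=` <<s F i.+1 >>.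
Hypothesis Fm : forall i, F i `<=` measurable.
Hypothesis v0 : 0 <= v.
Hypothesis axi : forall i, adapted (F i.+1) (xi i).
Hypothesis nxi : forall i, noise P (F i) v (xi i).

Lemma adapted_ar (rho : R) n : adapted (F n) (fun w => ar rho (xi^~ w) n).
Proof.
elim: n => [|n IH]; first exact: adapted_cst.
apply: adaptedD; last exact: axi.
by apply: adaptedM; [exact: adapted_cst|exact: adapted_sub IH].
Qed.

Lemma sqmean_transform (V : nat -> Omega -> R) (L : nat -> R) n :
  (forall i, adapted (F i) (V i)) -> (forall i, (i < n)%N -> (sqmean P (V i) <= (L i)%:E)%E) ->
  (sqmean P (fun w => \sum_(i < n) V i w * xi i w)%R <= (v * \sum_(i < n) L i)%:E)%E.
Proof.
move=> aV VL.
have := @noise_transform _ _ P F (fun=> v) xi V (fun=> 0) n (@FF) (@axi) (@nxi) aV (@adapted_cst _ _ (F 0%N) 0).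
under eq_fun do rewrite add0r.
move=> /le_trans; apply.
rewrite sqmean_cst expr0n/= add0e mulr_sumr -sumEFin; apply: lee_sum => i _.
by rewrite EFinM lee_wpmul2l ?lee_fin//; exact: VL.
Qed.

Lemma sqmean_wsum (h : nat -> R) n :
  (sqmean P (fun w => \sum_(i < n) h i * xi i w)%R <= (v * \sum_(i < n) h i ^+ 2)%:E)%E.
Proof.
apply: (@sqmean_transform (fun i _ => h i) (fun i => h i ^+ 2)).
  by move=> i; exact: adapted_cst.
by move=> i _; rewrite sqmean_cst.
Qed.

Context (rho : R) (rho0 : 0 <= rho) (rho1 : rho < 1).

(** The stationary variance v / (1 - rho^2) is invariant under the recursion. *)
Lemma sqmean_ar n : (sqmean P (fun w => ar rho (xi^~ w) n) <= (v / (1 - rho ^+ 2))%:E)%E.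
Proof.
have r2 : 0 < 1 - rho ^+ 2 by rewrite subr_gt0 expr_lt1.
elim: n => [|n IH]; first by rewrite sqmean_cst expr0n lee_fin divr_ge0// ltW.
have aW : adapted (F n) (fun w => rho * ar rho (xi^~ w) n).
  by apply: adaptedM; [exact: adapted_cst|exact: adapted_ar].
have := @nxi n _ _ aW (@adapted_cst _ _ (F n) 1).
under eq_fun do rewrite mul1r.
move=> /le_trans; apply.
rewrite sqmean_cst expr1n mule1 sqmeanZ; last exact: (adapted_measurable (@Fm n) (@adapted_ar rho n)).
apply: (@le_trans _ _ ((rho ^+ 2)%:E * (v / (1 - rho ^+ 2))%:E + v%:E)%E).
  by rewrite leeD2r// lee_wpmul2l// lee_fin sqr_ge0.
by rewrite -EFinM -EFinD lee_fin; apply: ler_of_eq; field; rewrite gt_eqF.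
Qed.

Lemma sqmean_ar_noise n :
  (sqmean P (fun w => \sum_(i < n) ar rho (xi^~ w) i * xi i w)%R <=
   (v * (n%:R * (v / (1 - rho ^+ 2))))%:E)%E.
Proof.
have -> : n%:R * (v / (1 - rho ^+ 2)) = \sum_(i < n) (v / (1 - rho ^+ 2)).
  by rewrite sumr_const card_ord -[RHS]mulr_natl.
apply: (@sqmean_transform (fun i w => ar rho (xi^~ w) i) (fun=> v / (1 - rho ^+ 2))) => [i|i _].
  exact: adapted_ar.
exact: sqmean_ar.
Qed.

Lemma sqmean_wsum_ar (h : nat -> R) (Ch : R) n : (forall i, `|h i| <= Ch) ->
  (sqmean P (fun w => \sum_(i < n) h i * ar rho (xi^~ w) i)%R <=
   (v * (n%:R * (Ch / (1 - rho)) ^+ 2))%:E)%E.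
Proof.
move=> hC; under eq_fun do rewrite sum_ar_adjoint.
apply: le_trans (sqmean_wsum (fun i => adjoint rho h n (n - i.+1)) n) _.
rewrite lee_fin ler_wpM2l//.
have -> : n%:R * (Ch / (1 - rho)) ^+ 2 = \sum_(i < n) (Ch / (1 - rho)) ^+ 2.
  by rewrite sumr_const card_ord -[RHS]mulr_natl.
apply: ler_sum => i _; apply: sqr_le_norm; exact: adjoint_bound.
Qed.
End NoiseSystem.

Section Approximants.
Context d (Omega : measurableType d) (P : probability Omega R).
Context (B : R -> {RV P >-> R}) (hB : brownian_motion B).
Context (a t D : R).
Hypotheses (a0 : 0 <= a) (t0 : 0 <= t) (D0 : 0 < D) (aD : a * D <= 1).

Let s (q j : nat) : R := t + j%:R * (D / q.+1%:R).
Let c (q j : nat) : R := 1 - a * (D / q.+1%:R * \sum_(k < q.+1 | (j < k)%N) decay a t D (s q k)).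

(** Each b(u) - b(t) is a sum of increments; exchanging the sums weights the j-th
  increment by the decays at all later nodes. *)
Lemma ar_noise_sum q (b : R -> R) : ar_noise a t D b q.+1 =
  \sum_(j < q.+1) c q j * (b (s q j.+1) - b (s q j)).
Proof.
have tel m : b (s q m) - b t = \sum_(j < m) (b (s q j.+1) - b (s q j)).
  rewrite -(big_mkord xpredT (fun j => b (s q j.+1) - b (s q j))) telescope_sumr//.
  by rewrite /s mul0r addr0.
have sD : s q q.+1 = t + D by rewrite /s mulrC divfK.
rewrite /ar_noise /left_sum -/(s q _) -sD tel.
have -> : \sum_(j < q.+1) c q j * (b (s q j.+1) - b (s q j)) =
  \sum_(j < q.+1) (b (s q j.+1) - b (s q j)) - a * (D / q.+1%:R * \sum_(j < q.+1)
    (\sum_(k < q.+1 | (j < k)%N) decay a t D (s q k)) * (b (s q j.+1) - b (s q j))).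
  rewrite !mulr_sumr -sumrB; apply: eq_bigr => j _.
  by rewrite /c mulrBl mul1r !mulrA.
congr (_ - a * (_ * _)).
under eq_bigr => k _ do rewrite -/(s q k) tel mulr_sumr.
under [RHS]eq_bigr => j _ do rewrite mulr_suml.
rewrite (exchange_big_dep xpredT)//=; apply: eq_bigr => k _.
rewrite -(big_mkord (fun j => (j < k)%N) (fun j => decay a t D (s q k) * (b (s q j.+1) - b (s q j)))).
rewrite -(big_mkord xpredT (fun j => decay a t D (s q k) * (b (s q j.+1) - b (s q j)))).
by rewrite (big_nat_widen _ _ q.+1) ?(ltnW (ltn_ord k)).
Qed.

Lemma decay_le1 u : u <= t + D -> 0 <= decay a t D u <= 1.
Proof.
move=> u1; rewrite /decay expR_ge0/= -exp.expR0 ler_expR oppr_le0.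
by rewrite mulr_ge0// subr_ge0.
Qed.

Lemma coef_bound q (j : 'I_q.+1) : 0 <= 1 - c q j <= a * D.
Proof.
rewrite /c opprB addrC subrK.
have h0 : 0 <= D / q.+1%:R by rewrite divr_ge0// ltW.
have dec (k : 'I_q.+1) : 0 <= decay a t D (s q k) <= 1.
  apply: decay_le1; rewrite lerD2l mulrA ler_pdivrMr// mulrC ler_wpM2l ?ler_nat//.
  - exact: ltW.
  - exact: ltnW.
rewrite !mulr_ge0//=; last by apply: sumr_ge0 => k _; have /andP[] := dec k.
apply: ler_wpM2l => //.
apply: (@le_trans _ _ (D / q.+1%:R * \sum_(k < q.+1) 1)); last first.
  by rewrite sumr_const card_ord divfK.
apply: ler_wpM2l => //.
rewrite [leRHS](bigID (fun k : 'I_q.+1 => (j < k)%N)) /= -[leLHS]addr0.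
apply: lerD; last exact: sumr_ge0.
by apply: ler_sum => k _; have /andP[] := dec k.
exact: ltW.
Qed.

Let s_ge0 q j : 0 <= s q j.
Proof. by rewrite /s addr_ge0// mulr_ge0// divr_ge0// ltW. Qed.

Let s_step q j : s q j.+1 - s q j = D / q.+1%:R.
Proof. by rewrite /s -natr1; ring. Qed.

Let s_lt q j : s q j < s q j.+1.
Proof. by rewrite -subr_gt0 s_step divr_gt0. Qed.

Let s_le q j : (j <= q.+1)%N -> s q j <= t + D.
Proof. by move=> jq; rewrite lerD2l mulrA ler_pdivrMr// mulrC ler_wpM2l ?ler_nat ?ltW. Qed.

Lemma ar_noise_adapted q : adapted (past B (t + D)) (fun w => ar_noise a t D (B ^~ w) q.+1).
Proof.
under eq_fun do rewrite ar_noise_sum.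
apply: measurable_sum => j; apply: measurable_funM => //.
by apply: increment_adapted => //; [exact: ltW|exact: s_le].
Qed.

Lemma noise_le G (v v' : R) xi : v <= v' -> noise P G v xi -> noise P G v' xi.
Proof.
move=> vv nxi W V aW aV; apply: le_trans (nxi W V aW aV) _.
by rewrite leeD2l// lee_wpmul2r ?lee_fin// sqmean_ge0.
Qed.

Lemma increments_noise q (e : nat -> R) (K : R) : (forall j : 'I_q.+1, `|e j| <= K) ->
  noise P (past B t) (16 * K ^+ 2 * D)
    (fun w => \sum_(j < q.+1) e j * (B (s q j.+1) w - B (s q j) w)).
Proof.
move=> eK.
have s0 : s q 0 = t by rewrite /s mul0r addr0.
have := @noise_comb _ _ P (fun j => past B (s q j)) (fun j => 16 * (s q j.+1 - s q j))
  (fun j w => B (s q j.+1) w - B (s q j) w) e q.+1.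
rewrite s0 => H; apply: noise_le (H _ _ _ _ _).
- have -> : 16 * K ^+ 2 * D = \sum_(j < q.+1) K ^+ 2 * (16 * (D / q.+1%:R)).
    by rewrite sumr_const card_ord -[RHS]mulr_natl; field.
  apply: ler_sum => j _; rewrite s_step ler_wpM2r//.
    by rewrite mulr_ge0// divr_ge0// ltW.
  exact: sqr_le_norm.
- by move=> j; apply: past_sub; exact: ltW.
- by move=> j; exact: past_measurable.
- by move=> j; apply: increment_adapted => //; exact: ltW.
- by move=> j; rewrite mulr_ge0// subr_ge0 ltW.
- by move=> j; exact: noise_increment.
Qed.

Lemma ar_noise_noise q : noise P (past B t) (16 * D) (fun w => ar_noise a t D (B ^~ w) q.+1).
Proof.
have -> : 16 * D = 16 * 1 ^+ 2 * D by rewrite expr1n mulr1.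
under eq_fun do rewrite ar_noise_sum.
apply: (@increments_noise q (c q) 1) => j; have := coef_bound j.
move: (c q j) (a * D) aD => x y y1 /andP[x0 xy].
by rewrite ler_norml; apply/andP; split; lra.
Qed.

(** The differences of the coefficients c - 1 are at most a D in absolute value. *)
Lemma ar_noise_close q : noise P (past B t) (16 * (a * D) ^+ 2 * D)
  (fun w => ar_noise a t D (B ^~ w) q.+1 - (B (t + D) w - B t w)).
Proof.
have -> : (fun w => ar_noise a t D (B ^~ w) q.+1 - (B (t + D) w - B t w)) =
    fun w => \sum_(j < q.+1) (c q j - 1) * (B (s q j.+1) w - B (s q j) w).
  apply/funext => w; rewrite ar_noise_sum.
  have -> : B (t + D) w - B t w = \sum_(j < q.+1) (B (s q j.+1) w - B (s q j) w).
    rewrite -(big_mkord xpredT (fun j => B (s q j.+1) w - B (s q j) w)).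
    rewrite (telescope_sumr (fun j => B (s q j) w))//.
    have -> : s q q.+1 = t + D by rewrite /s mulrC divfK.
    by have -> : s q 0 = t by rewrite /s mul0r addr0.
  by rewrite -sumrB; apply: eq_bigr => j _; ring.
apply: (@increments_noise q (fun j => c q j - 1)) => j; have := coef_bound j.
move: (c q j) (a * D) aD => x y y1 /andP[x0 xy].
by rewrite ler_norml; apply/andP; split; lra.
Qed.
End Approximants.

(** * Second moments along a stretch of observations *)

Lemma decay_rate (z : R) : 0 <= z -> z <= 1 -> z / 2 <= 1 - expR (- z).
Proof.
move=> z0 z1; have z10 : 0 < 1 + z by lra.
have : expR (- z) <= (1 + z)^-1.
  by rewrite expRN lef_pV2 ?posrE ?expR_gt0// expR_ge1Dx.
have : (1 + z)^-1 <= 1 - z / 2.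
  by rewrite -[leLHS]mul1r ler_pdivrMr//; nra.
lra.
Qed.

Lemma cvg_fin_sum (u : nat -> nat -> R) (l : nat -> R) m :
  (forall i, (i < m)%N -> u i q @[q --> \oo] --> l i) ->
  \sum_(i < m) u i q @[q --> \oo] --> \sum_(i < m) l i.
Proof.
elim: m => [_|m IH ul].
  by rewrite big_ord0; under eq_fun do rewrite big_ord0; exact: cvg_cst.
rewrite big_ord_recr; under eq_fun do rewrite big_ord_recr.
by apply: (@cvgD _ R^o); [apply: IH => i im; exact/ul/ltnW|exact: ul].
Qed.

Section PhaseMoments.
Context d (Omega : measurableType d) (P : probability Omega R).
Context (B : R -> {RV P >-> R}) (hB : brownian_motion B).
Context (a s0 D : R) (n : nat).
Hypotheses (a0 : 0 < a) (s00 : 0 <= s0) (D0 : 0 < D) (aD : a * D <= 1).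

Definition tick (i : nat) : R := s0 + i%:R * D.

Context (xi : nat -> Omega -> R).
Hypothesis mxi : forall i, measurable_fun setT (xi i).
Hypothesis xi_cvg : {ae P, forall w, forall i, (i < n)%N ->
  ar_noise a (tick i) D (B ^~ w) q @[q --> \oo] --> xi i w}.

Let rho := expR (- (a * D)).
Let xiq q i w := ar_noise a (tick i) D (B ^~ w) q.+1.
Let F i := past B (tick i).

Let tickS i : tick i.+1 = tick i + D.
Proof. by rewrite /tick -natr1; ring. Qed.

Let tick_ge0 i : 0 <= tick i.
Proof. by rewrite /tick addr_ge0// mulr_ge0// ltW. Qed.

Let FF i : F i `<=` <<s F i.+1 >>.
Proof. by apply: past_sub; rewrite tickS lerDl ltW. Qed.

Let Fm i : F i `<=` measurable.
Proof. exact: past_measurable. Qed.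

Let axi q i : adapted (F i.+1) (xiq q i).
Proof. by rewrite /F tickS; exact: ar_noise_adapted. Qed.

Let nxi q i : noise P (F i) (16 * D) (xiq q i).
Proof. by apply: ar_noise_noise => //; exact: ltW. Qed.

Let v0 : 0 <= 16 * D.
Proof. by rewrite mulr_ge0// ltW. Qed.

Let rho0 : 0 <= rho. Proof. exact: expR_ge0. Qed.

Let rho_gap : a * D / 2 <= 1 - rho.
Proof. by apply: decay_rate => //; rewrite mulr_ge0 ?ltW. Qed.

Let aD2 : 0 < a * D / 2.
Proof. by rewrite divr_gt0// mulr_gt0. Qed.

Let rho1 : rho < 1.
Proof. by have := lt_le_trans aD2 rho_gap; lra. Qed.

Let xiq_cvg : {ae P, forall w, forall i, (i < n)%N -> xiq q i w @[q --> \oo] --> xi i w}.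
Proof.
by apply: filterS xi_cvg => w H i /H; rewrite -(cvg_shiftS (fun q => ar_noise a (tick i) D (B ^~ w) q)).
Qed.

Let cvg_wsum (e : nat -> nat -> R) (l : nat -> R) (h : nat -> R) m :
  (forall i, (i < m)%N -> e q i @[q --> \oo] --> l i) ->
  \sum_(i < m) h i * e q i @[q --> \oo] --> \sum_(i < m) h i * l i.
Proof.
move=> el; apply: (@cvg_fin_sum (fun i q => h i * e q i) (fun i => h i * l i)) => i im.
by apply: cvgM; [exact: cvg_cst|exact: el].
Qed.

Let cvg_ar (e : nat -> nat -> R) (l : nat -> R) m :
  (forall i, (i < m)%N -> e q i @[q --> \oo] --> l i) ->
  ar rho (e q) m @[q --> \oo] --> ar rho l m.
Proof.
elim: m => [_|m IH el] /=; first exact: cvg_cst.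
apply: (@cvgD _ R^o); last exact: el.
by apply: cvgM; [exact: cvg_cst|apply: IH => i im; exact/el/ltnW].
Qed.

Let measurable_ar (e : nat -> Omega -> R) m : (forall i, measurable_fun setT (e i)) ->
  measurable_fun setT (fun w => ar rho (e^~ w) m).
Proof.
move=> me; elim: m => [|m IH] /=; first exact: measurable_cst.
by apply: measurable_funD => //; apply: measurable_funM.
Qed.

Let mxiq q i : measurable_fun setT (xiq q i).
Proof. exact: (adapted_measurable (@Fm i.+1) (@axi q i)). Qed.

(** Second-moment bounds on the approximants pass to the limit, by Fatou's lemma. *)
Let sqmean_limit (f : nat -> Omega -> R) (g : Omega -> R) (C : R) :
  (forall q, measurable_fun setT (f q)) -> measurable_fun setT g ->
  (forall w, (forall i, (i < n)%N -> xiq q i w @[q --> \oo] --> xi i w) ->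
     f q w @[q --> \oo] --> g w) ->
  (forall q, sqmean P (f q) <= C%:E)%E -> (sqmean P g <= C%:E)%E.
Proof.
move=> mf mg fg fC; apply: (@fatou_bound _ _ P (fun q w => f q w ^+ 2)) => //.
- by move=> q; exact: measurable_funX (mf q).
- exact: measurable_funX mg.
- by move=> q w; exact: sqr_ge0.
- by move=> w; exact: sqr_ge0.
apply: filterS xiq_cvg => w /fg H.
by rewrite expr2; under eq_fun do rewrite expr2; exact: cvgM.
Qed.

Let ar_variance : 16 * D / (1 - rho ^+ 2) <= 32 / a.
Proof.
have r2 : a * D / 2 <= 1 - rho ^+ 2.
  by apply: le_trans rho_gap _; rewrite lerD2l lerN2 expr2 ler_piMr// ltW.
rewrite ler_pdivrMr; last exact: lt_le_trans r2.
apply: (@le_trans _ _ (32 / a * (a * D / 2))).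
  by apply: ler_of_eq; field; rewrite gt_eqF.
by apply: ler_wpM2l => //; rewrite divr_ge0// ltW.
Qed.

Lemma phase_wsum (h : nat -> R) :
  (sqmean P (fun w => \sum_(i < n) h i * xi i w)%R <= (16 * D * \sum_(i < n) h i ^+ 2)%:E)%E.
Proof.
apply: (@sqmean_limit (fun q w => \sum_(i < n) h i * xiq q i w)).
- by move=> q; apply: measurable_sum => i; apply: measurable_funM.
- by apply: measurable_sum => i; apply: measurable_funM.
- by move=> w H; exact: (@cvg_wsum (fun q i => xiq q i w) (fun i => xi i w)).
- by move=> q; exact: (sqmean_wsum FF v0 (@axi q) (@nxi q)).
Qed.

Lemma phase_ar m : (m <= n)%N -> (sqmean P (fun w => ar rho (xi^~ w) m) <= (32 / a)%:E)%E.
Proof.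
move=> mn; apply: (@sqmean_limit (fun q w => ar rho (xiq q ^~ w) m)).
- by move=> q; exact: measurable_ar.
- exact: measurable_ar.
- by move=> w H; apply: (@cvg_ar (fun q i => xiq q i w) (fun i => xi i w)) => i im; apply: H; exact: leq_trans mn.
move=> q; apply: le_trans (sqmean_ar FF Fm v0 (@axi q) (@nxi q) rho0 rho1 m) _.
by rewrite lee_fin ar_variance.
Qed.

Lemma phase_ar_noise :
  (sqmean P (fun w => \sum_(i < n) ar rho (xi^~ w) i * xi i w)%R <= (512 / a * (n%:R * D))%:E)%E.
Proof.
apply: (@sqmean_limit (fun q w => \sum_(i < n) ar rho (xiq q ^~ w) i * xiq q i w)).
- by move=> q; apply: measurable_sum => i; apply: measurable_funM => //; exact: measurable_ar.
- by apply: measurable_sum => i; apply: measurable_funM => //; exact: measurable_ar.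
- move=> w H; apply: (@cvg_fin_sum (fun i q => ar rho (xiq q ^~ w) i * xiq q i w)
    (fun i => ar rho (xi^~ w) i * xi i w)) => i im; apply: cvgM; last exact: H.
  by apply: (@cvg_ar (fun q i => xiq q i w) (fun i => xi i w)) => j ji; apply: H; exact: ltn_trans im.
move=> q; apply: le_trans (sqmean_ar_noise FF Fm v0 (@axi q) (@nxi q) rho0 rho1 n) _.
rewrite lee_fin; apply: (@le_trans _ _ (16 * D * (n%:R * (32 / a)))).
  by do 2 apply: ler_wpM2l => //.
by apply: ler_of_eq; field; rewrite gt_eqF.
Qed.

Lemma phase_wsum_ar (h : nat -> R) (Ch : R) : (forall i, `|h i| <= Ch) ->
  (sqmean P (fun w => D * \sum_(i < n) h i * ar rho (xi^~ w) i)%R <=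
   (64 * Ch ^+ 2 / a ^+ 2 * (n%:R * D))%:E)%E.
Proof.
move=> hC; apply: (@sqmean_limit (fun q w => D * \sum_(i < n) h i * ar rho (xiq q ^~ w) i)).
- by move=> q; apply: measurable_funM => //; apply: measurable_sum => i; apply: measurable_funM => //; exact: measurable_ar.
- by apply: measurable_funM => //; apply: measurable_sum => i; apply: measurable_funM => //; exact: measurable_ar.
- move=> w H; apply: cvgM; first exact: cvg_cst.
  apply: (@cvg_wsum (fun q i => ar rho (xiq q ^~ w) i) (ar rho (xi^~ w))) => i im.
  by apply: (@cvg_ar (fun q i => xiq q i w) (fun i => xi i w)) => j ji; apply: H; exact: ltn_trans im.
move=> q; rewrite sqmeanZ; last first.
  by apply: measurable_sum => i; apply: measurable_funM => //; exact: measurable_ar.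
apply: le_trans (lee_wpmul2l _ (sqmean_wsum_ar FF v0 (@axi q) (@nxi q) rho0 rho1 n hC)) _.
  by rewrite lee_fin sqr_ge0.
rewrite -EFinM lee_fin.
have C0 : 0 <= Ch by apply: le_trans (hC 0%N).
have : (Ch / (1 - rho)) ^+ 2 <= (Ch / (a * D / 2)) ^+ 2.
  have g0 : 0 < 1 - rho by rewrite subr_gt0.
  rewrite ler_sqr; [|by rewrite nnegrE divr_ge0// ltW..].
  by apply: ler_wpM2l => //; rewrite lef_pV2 ?posrE.
move=> H; apply: (@le_trans _ _ (D ^+ 2 * (16 * D * (n%:R * (Ch / (a * D / 2)) ^+ 2)))).
  by apply: ler_wpM2l; [exact: sqr_ge0|do 2 apply: ler_wpM2l => //].
by apply: ler_of_eq; field; rewrite !gt_eqF.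
Qed.

Let integral_sum_sq (f : nat -> Omega -> R) (C : R) m : (forall i, measurable_fun setT (f i)) ->
  (forall i, (i < m)%N -> (sqmean P (f i) <= C%:E)%E) ->
  (\int[P]_w (\sum_(i < m) f i w ^+ 2)%:E <= (m%:R * C)%:E)%E.
Proof.
move=> mf fC; under eq_integral do rewrite -sumEFin.
rewrite ge0_integral_sum//; last 2 first.
- by move=> i; apply/measurable_EFinP; exact: (measurable_funX _ (mf i)).
- by move=> i w _; rewrite lee_fin sqr_ge0.
apply: (@le_trans _ _ (\sum_(i < m) C%:E)%E).
  by apply: lee_sum => i _; exact: fC.
by rewrite sumEFin lee_fin sumr_const card_ord -[leLHS]mulr_natl.
Qed.

Lemma phase_close :
  (\int[P]_w (\sum_(i < n) (xi i w - (B (tick i.+1) w - B (tick i) w)) ^+ 2)%:E <=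
   (16 * a ^+ 2 * D ^+ 2 * (n%:R * D))%:E)%E.
Proof.
have -> : 16 * a ^+ 2 * D ^+ 2 * (n%:R * D) = n%:R * (16 * (a * D) ^+ 2 * D) by ring.
apply: (@integral_sum_sq (fun i w => xi i w - (B (tick i.+1) w - B (tick i) w))) => [i|i im].
  by apply: measurable_funB => //; apply: measurable_funB; exact: measurable_funPT.
apply: (@sqmean_limit (fun q w => xiq q i w - (B (tick i.+1) w - B (tick i) w))).
- by move=> q; apply: measurable_funB => //; apply: measurable_funB; exact: measurable_funPT.
- by apply: measurable_funB => //; apply: measurable_funB; exact: measurable_funPT.
- by move=> w H; apply: (@cvgB _ R^o); [exact: H|exact: cvg_cst].
move=> q.
have := @ar_noise_close _ _ P B hB a (tick i) D (ltW a0) (tick_ge0 i) D0 aD q (fun=> 0) (fun=> 1)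
  (@adapted_cst _ _ _ 0) (@adapted_cst _ _ _ 1).
rewrite !sqmean_cst expr0n expr1n add0e mule1 tickS.
by under eq_fun do rewrite add0r mul1r.
Qed.

Lemma phase_ar_sum :
  (\int[P]_w (\sum_(i < n) ar rho (xi^~ w) i ^+ 2)%:E <= (n%:R * (32 / a))%:E)%E.
Proof.
apply: (@integral_sum_sq (fun i w => ar rho (xi^~ w) i)) => [i|i im].
  exact: measurable_ar.
exact/phase_ar/ltnW.
Qed.

Lemma phase_quadratic_variation :
  (\int[P]_w (expR (- (3 / 2 * \sum_(i < n) ((B (tick i.+1) w - B (tick i) w) ^+ 2 / D))))%:E
   = (2^-1 ^+ n)%:E)%E.
Proof.
have tD i : tick i.+1 - tick i = D by rewrite tickS; ring.
have tlt i : tick i < tick i.+1 by rewrite tickS ltrDl.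
apply: etrans (increments_exp hB n (tick_ge0 0) tlt).
by apply: eq_integral => w _; under [in RHS]eq_bigr do rewrite tD.
Qed.
End PhaseMoments.

(** * The noise of a stretch behaves as expected *)

Section PhaseWhp.
Context d (Omega : measurableType d) (P : probability Omega R).

Lemma whp_sqmean (f : Omega -> R) (C c : R) : measurable_fun setT f ->
  (sqmean P f <= C%:E)%E -> 0 < c -> whp P (C / c ^+ 2) (fun w => `|f w| <= c).
Proof.
move=> mf fC c0.
have H := @whp_markov _ _ P (fun w => f w ^+ 2) C (c ^+ 2) (measurable_funX _ mf)
  (fun w => sqr_ge0 _) fC (exprn_gt0 2 c0).
apply: whp_imp H => // w; rewrite -ler_sqrt ?sqr_ge0// sqrtr_sqr sqrtr_sqr (gtr0_norm c0).
by [].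
Qed.

(** The noise e and the Brownian increments b over a horizon S: kap S is the size
  below which an error is negligible, and S / 6 is a fraction of the expected
  quadratic variation. The energy of the autoregression is itself of order S, so it
  comes with a factor sqrt D. *)
Record good_noise (rho D S kap : R) (n m : nat) (h : nat -> nat -> R) (e b : nat -> R) : Prop :=
  GoodNoise {
    good_wsum : forall l, (l < m)%N -> `|\sum_(i < n) h l i * e i| <= kap * S ;
    good_cross : `|\sum_(i < n) ar rho e i * e i| <= kap * S ;
    good_wsum_ar : forall l, (l < m)%N -> `|D * \sum_(i < n) h l i * ar rho e i| <= kap * S ;
    good_last : ar rho e n ^+ 2 <= kap * S ;
    good_init : (\sum_(i < n) rho ^+ i * e i) ^+ 2 <= kap * S ;
    good_close : \sum_(i < n) (e i - b i) ^+ 2 <= kap * S ;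
    good_variation : S / 6 <= \sum_(i < n) b i ^+ 2 ;
    good_energy : Num.sqrt D * (D * \sum_(i < n) ar rho e i ^+ 2) <= kap * S }.

Context (B : R -> {RV P >-> R}) (hB : brownian_motion B).

(** With threshold n / 4 in the exponent, the exponential Markov bound is
  (exp (1/4) / 2)^n, and this keeps it below (2/3)^n. *)
Lemma exp_variation_ratio : expR (4^-1) <= (4 / 3 : R).
Proof.
have : 3 / 4 <= expR (- 4^-1) :> R by apply: le_trans (expR_ge1Dx _); lra.
have E0 : 0 < expR 4^-1 :> R by exact: expR_gt0.
by rewrite expRN -[X in _ <= X]div1r ler_pdivlMr//; lra.
Qed.

(** Markov's inequality for each error term, then a union bound. *)
Lemma phase_whp_total (a s0 D : R) (n m : nat) (Ch kap : R) (h : nat -> nat -> R)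
    (xi : nat -> Omega -> R) :
  0 < a -> 0 <= s0 -> 0 < D -> a * D <= 1 -> D <= 1 -> (0 < n)%N -> 0 < kap ->
  (forall l i, `|h l i| <= Ch) ->
  (forall i, measurable_fun setT (xi i)) ->
  {ae P, forall w, forall i, (i < n)%N ->
    ar_noise a (tick s0 D i) D (B ^~ w) q @[q --> \oo] --> xi i w} ->
  let S := n%:R * D in
  whp P ((m%:R * (16 * Ch ^+ 2) / kap ^+ 2 + 512 / a / kap ^+ 2 +
         m%:R * (64 * Ch ^+ 2 / a ^+ 2) / kap ^+ 2 + 64 / a / kap + 2) / S +
         (16 * a ^+ 2 / kap + 32 / a / kap) * Num.sqrt D)
    (fun w => good_noise (expR (- (a * D))) D S kap n m h (xi^~ w)
       (fun i => B (tick s0 D i.+1) w - B (tick s0 D i) w)).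
Proof.
move=> a0 s00 D0 aD D1 n0 kap0 hC mxi xcvg S.
have nR : 0 < n%:R :> R by rewrite ltr0n.
have S0 : 0 < S by rewrite mulr_gt0.
have kS0 : 0 < kap * S by rewrite mulr_gt0.
set rho := expR (- (a * D)).
have r0 : 0 < Num.sqrt D by rewrite sqrtr_gt0.
have r1 : Num.sqrt D <= 1 by rewrite -(sqrtr1 R) ler_sqrt.
have rD : D = Num.sqrt D ^+ 2 by rewrite sqr_sqrtr// ltW.
have mar i : measurable_fun setT (fun w => ar rho (xi^~ w) i).
  elim: i => [|i IH] /=; first exact: measurable_cst.
  by apply: measurable_funD => //; apply: measurable_funM.
have msum (f : nat -> Omega -> R) : (forall i, measurable_fun setT (f i)) ->
    measurable_fun setT (fun w => \sum_(i < n) f i w).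
  by move=> mf; apply: measurable_sum.
have H1 l : (l < m)%N -> whp P (16 * Ch ^+ 2 * S / (kap * S) ^+ 2)
    (fun w => `|\sum_(i < n) h l i * xi i w| <= kap * S).
  move=> _; apply: whp_sqmean => //; first by apply: (msum (fun i w => h l i * xi i w)) => i; apply: measurable_funM.
  apply: le_trans (phase_wsum hB a0 s00 D0 aD mxi xcvg (h l)) _.
  rewrite lee_fin /S.
  have -> : 16 * Ch ^+ 2 * (n%:R * D) = 16 * D * \sum_(i < n) Ch ^+ 2.
    by rewrite sumr_const card_ord -[in RHS]mulr_natl; ring.
  apply: ler_wpM2l; first by rewrite mulr_ge0// ltW.
  apply: ler_sum => i _; exact: sqr_le_norm.
have H2 := whp_sqmean (msum (fun i w => ar rho (xi^~ w) i * xi i w)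
  (fun i => measurable_funM (mar i) (mxi i))) (phase_ar_noise hB a0 s00 D0 aD mxi xcvg) kS0.
have H3 l : (l < m)%N -> whp P (64 * Ch ^+ 2 / a ^+ 2 * S / (kap * S) ^+ 2)
    (fun w => `|D * \sum_(i < n) h l i * ar rho (xi^~ w) i| <= kap * S).
  move=> _; apply: whp_sqmean => //.
    by apply: measurable_funM => //; apply: (msum (fun i w => h l i * ar rho (xi^~ w) i)) => i; apply: measurable_funM.
  exact: (phase_wsum_ar hB a0 s00 D0 aD mxi xcvg (hC l)).
have H4 := @whp_markov _ _ P (fun w => ar rho (xi^~ w) n ^+ 2) (32 / a) (kap * S)
  (measurable_funX _ (mar n)) (fun w => sqr_ge0 _) (phase_ar hB a0 s00 D0 aD mxi xcvg (leqnn n)) kS0.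
have H5 : whp P (32 / a / (kap * S)) (fun w => (\sum_(i < n) rho ^+ i * xi i w) ^+ 2 <= kap * S).
  have mf : measurable_fun setT (fun w => \sum_(i < n) rho ^+ i * xi i w).
    by apply: (msum (fun i w => rho ^+ i * xi i w)) => i; apply: measurable_funM.
  apply: (whp_markov (measurable_funX _ mf)) => //; first by move=> w; exact: sqr_ge0.
  apply: le_trans (phase_wsum hB a0 s00 D0 aD mxi xcvg (fun i => rho ^+ i)) _.
  rewrite lee_fin; have gap : a * D / 2 <= 1 - rho.
    by apply: decay_rate => //; rewrite mulr_ge0 ?ltW.
  have aD2 : 0 < a * D / 2 by rewrite divr_gt0// mulr_gt0.
  have rho0 : 0 <= rho by exact: expR_ge0.
  have geo : \sum_(i < n) (rho ^+ i) ^+ 2 <= (a * D / 2)^-1.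
    apply: (@le_trans _ _ (\sum_(i < n) rho ^+ i)).
      apply: ler_sum => i _; rewrite expr2 ler_piMr ?exprn_ge0// exprn_ile1//.
      by lra.
    rewrite -[leRHS]mul1r ler_pdivlMr// mulrC.
    apply: (@le_trans _ _ ((1 - rho) * \sum_(i < n) rho ^+ i)).
      by apply: ler_wpM2r gap; apply: sumr_ge0 => i _; exact: exprn_ge0.
    have -> : (1 - rho) * \sum_(i < n) rho ^+ i = 1 - rho ^+ n.
      by rewrite -opprB mulNr -subrX1 opprB.
    by rewrite lerBlDr lerDl exprn_ge0.
  apply: le_trans (ler_wpM2l _ geo) _; first by rewrite mulr_ge0// ltW.
  by apply: ler_of_eq; field; rewrite !gt_eqF.
have mdif i : measurable_fun setT
    (fun w => (xi i w - (B (tick s0 D i.+1) w - B (tick s0 D i) w)) ^+ 2).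
  apply: measurable_funX; apply: measurable_funB => //.
  by apply: measurable_funB; exact: measurable_funPT.
have H6 := @whp_markov _ _ P (fun w => \sum_(i < n) (xi i w - (B (tick s0 D i.+1) w - B (tick s0 D i) w)) ^+ 2)
  (16 * a ^+ 2 * D ^+ 2 * S) (kap * S)
  (msum (fun i w => (xi i w - (B (tick s0 D i.+1) w - B (tick s0 D i) w)) ^+ 2) mdif)
  (fun w => sumr_ge0 _ (fun i _ => sqr_ge0 _)) (phase_close hB a0 s00 D0 aD mxi xcvg) kS0.
have H8 := @whp_markov _ _ P (fun w => \sum_(i < n) ar rho (xi^~ w) i ^+ 2)
  (n%:R * (32 / a)) (kap * S / (Num.sqrt D * D))
  (msum (fun i w => ar rho (xi^~ w) i ^+ 2) (fun i => measurable_funX 2 (mar i)))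
  (fun w => sumr_ge0 _ (fun i _ => sqr_ge0 _)) (phase_ar_sum hB a0 s00 D0 aD mxi xcvg) (divr_gt0 kS0 (mulr_gt0 r0 D0)).
have H7 : whp P (2 / S) (fun w => S / 6 <= \sum_(i < n) (B (tick s0 D i.+1) w - B (tick s0 D i) w) ^+ 2).
  pose f w := expR (- (3 / 2 * \sum_(i < n) ((B (tick s0 D i.+1) w - B (tick s0 D i) w) ^+ 2 / D))).
  have mf : measurable_fun setT f.
    apply: measurableT_comp => //; apply: measurable_funN; apply: measurable_funM => //.
    apply: (msum (fun i w => (B (tick s0 D i.+1) w - B (tick s0 D i) w) ^+ 2 / D)) => i.
    by apply: measurable_funM => //; apply: measurable_funX; apply: measurable_funB; exact: measurable_funPT.
  have fE : (\int[P]_w (f w)%:E <= (2^-1 ^+ n)%:E)%E.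
    by rewrite /f phase_quadratic_variation.
  apply: whp_imp (whp_markov mf (fun w => expR_ge0 _) fE (expR_gt0 (- (n%:R * 4^-1)))).
    rewrite expRN invrK.
    have -> : expR (n%:R * 4^-1) = expR 4^-1 ^+ n :> R by rewrite expRM_natl.
    rewrite -exprMn; apply: (@le_trans _ _ ((2 / 3) ^+ n)).
      rewrite ler_pXn2r// ?nnegrE ?mulr_ge0 ?expR_ge0//.
      by have := exp_variation_ratio; lra.
    have bern k : 1 + k%:R / 2 <= (3 / 2) ^+ k :> R.
      elim: k => [|k IH]; first by rewrite mul0r addr0 expr0.
      rewrite exprS; apply: (@le_trans _ _ (3 / 2 * (1 + k%:R / 2))).
        by have : 0 <= k%:R :> R by []; rewrite -natr1; lra.
      by apply: ler_wpM2l IH; lra.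
    have -> : (2 / 3) ^+ n = ((3 / 2) ^+ n)^-1 :> R by rewrite -exprVn invf_div.
    rewrite -[2 / S]invf_div lef_pV2 ?posrE ?divr_gt0 ?exprn_gt0//.
    apply: le_trans (bern n); rewrite /S.
    have : n%:R * D <= n%:R by rewrite ler_piMr// ltW.
    by lra.
  move=> w; rewrite /f ler_expR lerN2 -mulr_suml => H.
  move: H; set Q := \sum_(_ < _) _ => H; rewrite /S.
  have -> : Q = (Q / D) * D by rewrite divfK// gt_eqF.
  have -> : n%:R * D / 6 = (n%:R / 6) * D by ring.
  by apply: ler_wpM2r; [exact: ltW|lra].
apply: whp_imp (whp_and (whp_and (whp_all H1) (whp_and H2 (whp_all H3)))
  (whp_and (whp_and H4 H5) (whp_and H6 (whp_and H7 H8)))).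
  set lhs := (X in X <= _).
  have -> : lhs = (m%:R * (16 * Ch ^+ 2) / kap ^+ 2 + 512 / a / kap ^+ 2 +
         m%:R * (64 * Ch ^+ 2 / a ^+ 2) / kap ^+ 2 + 64 / a / kap + 2) / S +
         (16 * a ^+ 2 / kap * D ^+ 2 + 32 / a / kap * Num.sqrt D).
    by rewrite /lhs /S; field; rewrite !gt_eqF.
  rewrite lerD2l [leRHS]mulrDl; apply: lerD => //; apply: ler_wpM2l.
    by rewrite divr_ge0 ?mulr_ge0 ?sqr_ge0// ltW.
  apply: (@le_trans _ _ D); first by rewrite expr2 ler_piMr// ltW.
  by rewrite {1}rD expr2 ler_piMr// ltW.
move=> w [[G1 [G2 G3]] [[G4 G5] [G6 [G7 G8]]]]; split => //.
move: G8; rewrite ler_pdivlMr ?mulr_gt0// => G8; apply: le_trans G8.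
by apply: ler_of_eq; ring.
Qed.

(** The failure probability of [phase_whp_total] is C1 / S + C2 sqrt D. *)
Lemma phase_whp (a Ch kap eta : R) (m : nat) : 0 < a -> 0 < kap -> 0 < eta ->
  exists S0 D0 : R, [/\ 0 < S0, 0 < D0 &
  forall (s0 D : R) (n : nat) (h : nat -> nat -> R) (xi : nat -> Omega -> R),
    0 <= s0 -> 0 < D -> D <= D0 -> S0 <= n%:R * D ->
    (forall l i, `|h l i| <= Ch) ->
    (forall i, measurable_fun setT (xi i)) ->
    {ae P, forall w, forall i, (i < n)%N ->
      ar_noise a (tick s0 D i) D (B ^~ w) q @[q --> \oo] --> xi i w} ->
    whp P eta (fun w => good_noise (expR (- (a * D))) D (n%:R * D) kap n m h (xi^~ w)
       (fun i => B (tick s0 D i.+1) w - B (tick s0 D i) w))].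
Proof.
move=> a0 kap0 eta0.
set C1 := m%:R * (16 * Ch ^+ 2) / kap ^+ 2 + 512 / a / kap ^+ 2 +
         m%:R * (64 * Ch ^+ 2 / a ^+ 2) / kap ^+ 2 + 64 / a / kap + 2.
set C2 := 16 * a ^+ 2 / kap + 32 / a / kap.
have C1_gt0 : 0 < C1.
  have k0 := ltW kap0; have a0' := ltW a0.
  have c0 := sqr_ge0 Ch; have k2 := sqr_ge0 kap; have a2 := sqr_ge0 a.
  have p1 : 0 <= m%:R * (16 * Ch ^+ 2) / kap ^+ 2.
    exact: (divr_ge0 (mulr_ge0 (ler0n _ m) (mulr_ge0 (ler0n _ 16) c0)) k2).
  have p2 : 0 <= 512 / a / kap ^+ 2 by exact: (divr_ge0 (divr_ge0 (ler0n _ 512) a0') k2).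
  have p3 : 0 <= m%:R * (64 * Ch ^+ 2 / a ^+ 2) / kap ^+ 2.
    exact: (divr_ge0 (mulr_ge0 (ler0n _ m) (divr_ge0 (mulr_ge0 (ler0n _ 64) c0) a2)) k2).
  have p4 : 0 <= 64 / a / kap by exact: (divr_ge0 (divr_ge0 (ler0n _ 64) a0') k0).
  by rewrite /C1 (ltr_wpDl (addr_ge0 (addr_ge0 (addr_ge0 p1 p2) p3) p4)).
have C2_gt0 : 0 < C2.
  by rewrite addr_gt0 ?divr_gt0 ?mulr_gt0 ?exprn_gt0.
exists (2 * C1 / eta), (Num.min (Num.min 1 a^-1) ((eta / (2 * C2)) ^+ 2)).
have E2 : 0 < 2 * C1 / eta by rewrite divr_gt0// mulr_gt0.
split => //.
  by rewrite !lt_min ltr01 invr_gt0 a0 exprn_gt0// divr_gt0// mulr_gt0.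
move=> s0 D n h xi s00 D0; rewrite !le_min => /andP[/andP[D1 Da] De] nS hC mxi xcvg.
have n0 : (0 < n)%N.
  by case: n nS {xcvg} => // /(lt_le_trans E2); rewrite mul0r ltxx.
have aD : a * D <= 1 by rewrite mulrC -ler_pdivlMr// div1r.
have H := @phase_whp_total a s0 D n m Ch kap h xi a0 s00 D0 aD D1 n0 kap0 hC mxi xcvg.
refine (whp_imp _ (fun _ Q => Q) H).
rewrite -/C1 -/C2 [leRHS](splitr eta); apply: lerD.
  rewrite ler_pdivrMr ?(lt_le_trans E2)// mulrC -ler_pdivrMr ?divr_gt0//.
  by apply: le_trans nS; rewrite invf_div mulrA (mulrC C1).
have Dr : Num.sqrt D <= eta / (2 * C2).
  rewrite -[leRHS]gtr0_norm ?divr_gt0 ?mulr_gt0// -sqrtr_sqr ler_sqrt//.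
  exact: sqr_ge0.
by rewrite mulrC -ler_pdivlMr// -mulrA -invfM.
Qed.
End PhaseWhp.

(** * Pathwise bounds for the Gram matrix and the scores *)

Section PathEstimates.
Variables (a sg D kap rho : R) (n p : nat) (f : nat -> 'cV[R]_p) (x bt e b : nat -> R).
Variables (mu : 'cV[R]_p) (Cf Cb : R).
Hypotheses (a0 : 0 < a) (sg0 : 0 < sg) (D0 : 0 < D) (aD : a * D <= 1) (D1 : D <= 1).
Hypotheses (n0 : (0 < n)%N) (kap0 : 0 < kap) (Cf1 : 0 <= Cf) (Cb0 : 0 <= Cb).

Hypothesis rhoE : rho = expR (- (a * D)).
Local Notation S := (n%:R * D).
Local Notation g := (ar rho bt).
Local Notation u := (ar rho e).
Local Notation dot := (fun i => (mu^T *m f i) ord0 ord0).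

Hypothesis x_rec : forall i, (i < n)%N -> x i.+1 = rho * x i + bt i + sg * e i.
Hypothesis f_le : forall i (l : 'I_p), `|f i l ord0| <= Cf.
Hypothesis bt_le : forall i, `|bt i| <= Cb * D.
Hypothesis bt_close : forall i, (i < n)%N -> `|bt i - D * dot i| <= Cb * D * Num.sqrt D.
Hypothesis x_init : x 0%N ^+ 2 <= kap * S.

(** The good event is used with p + 1 weights: the components of the basis and,
  as the last one, the deterministic mean of the path. *)
Definition weights (l : nat) (i : nat) : R :=
  oapp (fun j : 'I_p => f i j ord0) (ar rho bt i) (insub l).

Lemma weights_f (l : 'I_p) i : weights l i = f i l ord0.
Proof. by rewrite /weights valK. Qed.

Lemma weights_g i : weights p i = ar rho bt i.
Proof. by rewrite /weights insubF// ltnn. Qed.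

Let rho0 : 0 < rho. Proof. by rewrite rhoE expR_gt0. Qed.

Let rho_lo : 1 - a * D <= rho.
Proof. by rewrite rhoE; exact: expR_ge1Dx. Qed.

Let aD0 : 0 < a * D. Proof. exact: mulr_gt0. Qed.

Let rho_gap : a * D / 2 <= 1 - rho.
Proof. by rewrite rhoE; apply: decay_rate => //; exact: ltW. Qed.

Let rho_hi : rho <= 1 - a * D + (a * D) ^+ 2.
Proof.
have z1 : 0 < 1 + a * D by have := aD0; lra.
have : rho <= (1 + a * D)^-1.
  by rewrite rhoE expRN lef_pV2 ?posrE ?expR_gt0// expR_ge1Dx.
move=> /le_trans; apply; rewrite -[leLHS]mul1r ler_pdivrMr//.
have := ltW aD0; move: (a * D) => z z0; nra.
Qed.

Let S0 : 0 < S. Proof. by rewrite mulr_gt0// ltr0n. Qed.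

Lemma ar_bound (v : nat -> R) (c : R) i : (forall i, `|v i| <= c * D) ->
  `|ar rho v i| <= 2 * c / a.
Proof.
move=> vc; have c0 : 0 <= c * D by apply: le_trans (vc 0%N).
have {}c0 : 0 <= c by rewrite -(pmulr_lge0 _ D0).
elim: i => [|i IH] /=; first by rewrite normr0 divr_ge0 ?mulr_ge0// ltW.
apply: le_trans (ler_normD _ _) _; rewrite normrM (gtr0_norm rho0).
apply: le_trans (lerD (ler_wpM2l (ltW rho0) IH) (vc i)) _.
have : 2 * c / a * (a * D / 2) <= 2 * c / a * (1 - rho).
  by apply: ler_wpM2l rho_gap; rewrite divr_ge0 ?mulr_ge0// ltW.
have -> : 2 * c / a * (a * D / 2) = c * D by field; rewrite gt_eqF.
by rewrite mulrBr mulr1; lra.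
Qed.

(** The path is a transient, a deterministic mean and an autoregressive noise. *)
Lemma x_decomp i : (i <= n)%N -> x i = rho ^+ i * x 0%N + g i + sg * u i.
Proof.
elim: i => [_|i IH ni]; first by rewrite /= expr0; ring.
by rewrite (x_rec ni) (IH (ltnW ni)) /= exprS; ring.
Qed.

Local Notation Cg := (2 * Cb / a).
Local Notation r := (Num.sqrt D).

Let r0 : 0 < r. Proof. by rewrite sqrtr_gt0. Qed.
Let rr : r ^+ 2 = D. Proof. by rewrite sqr_sqrtr// ltW. Qed.
Let r1 : r <= 1. Proof. by rewrite -(sqrtr1 R) ler_sqrt. Qed.
Let Dr : D <= r. Proof. by rewrite -[leLHS]rr expr2 ler_piMr// ltW. Qed.

Hypothesis good : good_noise rho D S kap n p.+1 weights e b.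

Lemma geometric_sum : D * \sum_(i < n) (rho ^+ i) ^+ 2 <= 2 / a.
Proof.
have rho1 : rho <= 1 by have := rho_gap; have := aD0; lra.
apply: (@le_trans _ _ (D * \sum_(i < n) rho ^+ i)).
  apply: ler_wpM2l; first exact: ltW.
  by apply: ler_sum => i _; rewrite expr2 ler_piMr ?exprn_ge0 ?exprn_ile1// ltW.
have E : (1 - rho) * \sum_(i < n) rho ^+ i = 1 - rho ^+ n.
  by rewrite -opprB mulNr -subrX1 opprB.
have H : (a * D / 2) * \sum_(i < n) rho ^+ i <= 1.
  apply: (@le_trans _ _ ((1 - rho) * \sum_(i < n) rho ^+ i)).
    by apply: ler_wpM2r rho_gap; apply: sumr_ge0 => i _; rewrite exprn_ge0 ?ltW.
  by rewrite E lerBlDr lerDl exprn_ge0// ltW.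
by rewrite ler_pdivlMr//; move: H; move: (\sum_(i < n) _) => Q; lra.
Qed.

Lemma init_energy : D * \sum_(i < n) (rho ^+ i * x 0%N) ^+ 2 <= 2 / a * (kap * S).
Proof.
have -> : D * \sum_(i < n) (rho ^+ i * x 0%N) ^+ 2 =
    (D * \sum_(i < n) (rho ^+ i) ^+ 2) * x 0%N ^+ 2.
  by rewrite -mulrA mulr_suml; congr (_ * _); apply: eq_bigr => i _; rewrite exprMn.
apply: ler_pM; [|exact: sqr_ge0|exact: geometric_sum|exact: x_init].
by rewrite mulr_ge0 ?(ltW D0)//; apply: sumr_ge0 => i _; exact: sqr_ge0.
Qed.

(** Squaring the recursion u_(i+1) = rho u_i + e_i and summing relates the sum of
  the u_i^2, times 1 - rho^2 which is about 2 a D, to the sum of the e_i^2, up to the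
  negligible cross term and last value. The e_i^2 sum up to a fraction of S because
  e is close to the Brownian increments. *)
Lemma noise_energy : kap <= 96^-1 -> S / (48 * a) <= D * \sum_(i < n) u i ^+ 2.
Proof.
move=> k96.
have E m : u m ^+ 2 + (1 - rho ^+ 2) * \sum_(i < m) u i ^+ 2 =
    2 * rho * (\sum_(i < m) u i * e i) + \sum_(i < m) e i ^+ 2.
  elim: m => [|m IH]; first by rewrite !big_ord0 /= expr0n /=; ring.
  rewrite !big_ord_recr /=.
  move: IH; set A := \sum_(_ < _) _; set A2 := \sum_(_ < _) _.
  set A3 := \sum_(_ < _) _ => IH.
  have -> : 2 * rho * (A2 + u m * e m) + (A3 + e m ^+ 2) =
    (2 * rho * A2 + A3) + 2 * rho * u m * e m + e m ^+ 2 by ring.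
  by rewrite -IH; ring.
have le1 : S / 6 <= 2 * (\sum_(i < n) e i ^+ 2) + 2 * (kap * S).
  apply: le_trans (good_variation good) _.
  apply: (@le_trans _ _ (2 * (\sum_(i < n) e i ^+ 2) + 2 * \sum_(i < n) (e i - b i) ^+ 2)).
    rewrite !mulr_sumr -big_split /=; apply: ler_sum => i _.
    rewrite -subr_ge0.
    have -> : 2 * e i ^+ 2 + 2 * (e i - b i) ^+ 2 - b i ^+ 2 = (2 * e i - b i) ^+ 2 by ring.
    exact: sqr_ge0.
  by rewrite lerD2l; apply: ler_wpM2l => //; exact: good_close good.
have rho1 : rho <= 1 by have := rho_gap; have := aD0; lra.
have := E n; have := good_last good; have := good_cross good; rewrite ler_norml => /andP[].
move: le1.
set A := \sum_(i < n) u i * e i; set A2 := \sum_(i < n) e i ^+ 2.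
set A3 := \sum_(i < n) u i ^+ 2 => H1 H2 H3 H4 H5.
have A0 : 0 <= A3 by apply: sumr_ge0 => i _; exact: sqr_ge0.
have ga : (1 - rho ^+ 2) * A3 <= 2 * (a * D) * A3.
  apply: ler_wpM2r => //; have -> : 1 - rho ^+ 2 = (1 - rho) * (1 + rho) by ring.
  rewrite mulrC; apply: ler_pM; [|by have := rho_gap; have := aD0; lra|lra|by have := rho_lo; lra].
  by have := rho0; lra.
have rA : - (kap * S) <= rho * A.
  have kS : 0 <= kap * S by rewrite mulr_ge0// ltW.
  have : rho * (- (kap * S)) <= rho * A by apply: ler_wpM2l => //; exact: ltW.
  have : - (kap * S) <= rho * (- (kap * S)) by rewrite mulrN lerN2 ler_piMl.
  lra.
have kS : kap * S <= S / 96 by rewrite [leRHS]mulrC; apply: ler_wpM2r => //; exact: ltW.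
rewrite ler_pdivrMr ?mulr_gt0//.
have -> : D * A3 * (48 * a) = 24 * (2 * (a * D) * A3) by ring.
lra.
Qed.

Let g_le i : `|g i| <= Cg.
Proof. exact: ar_bound. Qed.

Let cross_le (w z W : R) : `|W| <= kap * S -> 2 * w * z * W <= (w ^+ 2 + z ^+ 2) * (kap * S).
Proof.
move=> Wk; have kS : 0 <= kap * S by apply: le_trans Wk.
apply: (@le_trans _ _ (`|2 * w * z| * `|W|)); first by rewrite -normrM ler_norm.
apply: ler_pM => //; rewrite ler_norml; apply/andP; split.
  have := sqr_ge0 (w + z); have -> : (w + z) ^+ 2 = w ^+ 2 + 2 * w * z + z ^+ 2 by ring.
  by lra.
have := sqr_ge0 (w - z); have -> : (w - z) ^+ 2 = w ^+ 2 - 2 * w * z + z ^+ 2 by ring.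
by lra.
Qed.

(** Up to the transient, the regressor is a mean part y - be g, a noise part
  be sg u, and negligible cross terms. The noise part controls be^2 by
  [noise_energy]. The mean part controls al up to an error of order be^2; weighted by
  the small factor k0, it leaves the control of be^2 intact. *)
Lemma gram_lower (al : 'I_p -> R) (be : R) :
  let y i := \sum_j al j * f i j ord0 in
  let s1 := sg ^+ 2 / (48 * a) in
  let k0 := Num.min 1 (s1 / (2 * (Cg ^+ 2 + 1))) in
  S / 2 * \sum_j al j ^+ 2 <= D * \sum_(i < n) y i ^+ 2 ->
  kap <= 96^-1 -> sg * kap <= k0 / 8 ->
  sg * kap * (p%:R + 2) / 2 + 2 / a * kap <= s1 / 8 ->
  Num.min (k0 / 16) (s1 / 8) * S * (\sum_j al j ^+ 2 + be ^+ 2) <=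
  D * \sum_(i < n) (y i - be * x i) ^+ 2.
Proof.
move=> y s1 k0 gram k96 k1 k2.
set A2 := \sum_j al j ^+ 2.
have A20 : 0 <= A2 by apply: sumr_ge0 => j _; exact: sqr_ge0.
have s10 : 0 < s1 by rewrite divr_gt0 ?exprn_gt0 ?mulr_gt0.
have Cg1 : 0 < 2 * (Cg ^+ 2 + 1) by rewrite mulr_gt0// ltr_wpDl// sqr_ge0.
have k00 : 0 < k0 by rewrite lt_min ltr01 divr_gt0.
have k01 : k0 <= 1 by rewrite ge_min lexx.
have k0C : k0 * Cg ^+ 2 <= s1 / 2.
  have : k0 * (2 * (Cg ^+ 2 + 1)) <= s1 by rewrite -ler_pdivlMr// ge_min lexx orbT.
  by have := sqr_ge0 Cg; have := ltW k00; nra.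
(* the transient is split off through (u - w)^2 = u^2 / 2 - w^2 + (u - 2 w)^2 / 2 *)
have split1 : 2^-1 * (D * \sum_(i < n) (y i - be * g i - be * sg * u i) ^+ 2) -
    be ^+ 2 * (D * \sum_(i < n) (rho ^+ i * x 0%N) ^+ 2) <=
    D * \sum_(i < n) (y i - be * x i) ^+ 2.
  rewrite !mulr_sumr -sumrB; apply: ler_sum => i _.
  rewrite (x_decomp (ltnW (ltn_ord i))) -subr_ge0.
  rewrite [X in 0 <= X](_ : _ = D * (2^-1 *
    (y i - be * g i - be * sg * u i - 2 * (be * (rho ^+ i * x 0%N))) ^+ 2)); last by field.
  by rewrite mulr_ge0 ?(ltW D0)// mulr_ge0// sqr_ge0.
have expand : D * \sum_(i < n) (y i - be * g i - be * sg * u i) ^+ 2 =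
    D * \sum_(i < n) (y i - be * g i) ^+ 2 + be ^+ 2 * sg ^+ 2 * (D * \sum_(i < n) u i ^+ 2)
    - sg * (\sum_j 2 * be * al j * (D * \sum_(i < n) f i j ord0 * u i))
    + sg * (2 * be * be * (D * \sum_(i < n) g i * u i)).
  have -> : \sum_j 2 * be * al j * (D * \sum_(i < n) f i j ord0 * u i) =
      D * \sum_(i < n) 2 * be * y i * u i.
    under eq_bigr do rewrite mulrCA mulr_sumr.
    rewrite -mulr_sumr exchange_big /=; congr (_ * _); apply: eq_bigr => i _.
    by rewrite /y mulr_sumr mulr_suml; apply: eq_bigr => j _; ring.
  rewrite !mulr_sumr -sumrN -!big_split /=; apply: eq_bigr => i _; ring.
have main : k0 * (S / 4 * A2 - be ^+ 2 * Cg ^+ 2 * S) <= D * \sum_(i < n) (y i - be * g i) ^+ 2.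
  apply: (@le_trans _ _ (k0 * (D * \sum_(i < n) (y i - be * g i) ^+ 2))); last first.
    apply: ler_piMl => //; rewrite mulr_ge0 ?(ltW D0)//.
    by apply: sumr_ge0 => i _; exact: sqr_ge0.
  apply: ler_wpM2l; first exact: ltW.
  apply: (@le_trans _ _ (2^-1 * (D * \sum_(i < n) y i ^+ 2) - be ^+ 2 * (D * \sum_(i < n) g i ^+ 2))).
    apply: lerB; first by move: gram; rewrite -/A2; lra.
    rewrite -mulrA; apply: ler_wpM2l; first exact: sqr_ge0.
    have -> : Cg ^+ 2 * S = D * \sum_(i < n) Cg ^+ 2.
      by rewrite sumr_const card_ord -[in RHS]mulr_natl; ring.
    apply: ler_wpM2l; first exact: ltW.
    apply: ler_sum => i _; exact: sqr_le_norm.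
  rewrite !mulr_sumr -sumrB; apply: ler_sum => i _; rewrite -subr_ge0.
  rewrite [X in 0 <= X](_ : _ = D * (2^-1 * (y i - 2 * (be * g i)) ^+ 2)); last by field.
  by rewrite mulr_ge0 ?(ltW D0)// mulr_ge0// sqr_ge0.
have kS0 : 0 <= kap * S by rewrite mulr_ge0// ltW.
have cross1 : \sum_j 2 * be * al j * (D * \sum_(i < n) f i j ord0 * u i) <=
    (p%:R * be ^+ 2 + A2) * (kap * S).
  have -> : p%:R * be ^+ 2 + A2 = \sum_j (be ^+ 2 + al j ^+ 2).
    by rewrite big_split /= sumr_const card_ord -[in RHS]mulr_natl.
  rewrite mulr_suml; apply: ler_sum => j _; apply: cross_le => //.
  have := @good_wsum_ar _ _ _ _ _ _ _ _ _ good j (ltnW (ltn_ord j)).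
  by under eq_bigr do rewrite weights_f.
have cross2 : - (2 * be * be * (D * \sum_(i < n) g i * u i)) <= (be ^+ 2 + be ^+ 2) * (kap * S).
  rewrite -mulrN; apply: cross_le => //; rewrite normrN.
  have := @good_wsum_ar _ _ _ _ _ _ _ _ _ good p (ltnSn p).
  by under eq_bigr do rewrite weights_g.
have en : be ^+ 2 * sg ^+ 2 * (S / (48 * a)) <= be ^+ 2 * sg ^+ 2 * (D * \sum_(i < n) u i ^+ 2).
  by apply: ler_wpM2l (noise_energy k96); rewrite mulr_ge0 ?sqr_ge0.
have ini := ler_wpM2l (sqr_ge0 be) init_energy.
have sE : be ^+ 2 * sg ^+ 2 * (S / (48 * a)) = be ^+ 2 * s1 * S.
  by rewrite /s1; field; rewrite gt_eqF.
apply: le_trans split1; rewrite expand.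
set U1 := \sum_j _ in cross1 *; set U2 := 2 * be * be * _ in cross2 *.
have c1 := ler_wpM2l (ltW sg0) cross1.
have c2 := ler_wpM2l (ltW sg0) cross2.
have t1 : Num.min (k0 / 16) (s1 / 8) * (S * A2) <= k0 / 16 * (S * A2).
  by apply: ler_wpM2r; [rewrite mulr_ge0// ltW|rewrite ge_min lexx].
have b20 := sqr_ge0 be.
have t2 : Num.min (k0 / 16) (s1 / 8) * (S * be ^+ 2) <= s1 / 8 * (S * be ^+ 2).
  by apply: ler_wpM2r; [rewrite mulr_ge0// ltW|rewrite ge_min lexx orbT].
have SA : 0 <= S * A2 by rewrite mulr_ge0// ltW.
have Sb : 0 <= S * be ^+ 2 by rewrite mulr_ge0// ltW.
have t3 := ler_wpM2r SA k1.
have t4 := ler_wpM2r Sb k2.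
have t5 := ler_wpM2r Sb k0C.
move: ini main en c1 c2 sE; move: (D * _) => I; move: (D * _) => Mn; move: (D * _) => En.
lra.
Qed.

Local Notation K1 := (3 * (2 / a + Cg ^+ 2 + sg ^+ 2)).
Local Notation q := ((kap + r) * S).

(** The error of the one-step Euler prediction with parameter (mu, a). *)
Definition residual (i : nat) : R := x i.+1 - x i - D * (dot i - a * x i).

Let K10 : 0 <= K1.
Proof. by rewrite mulr_ge0// !addr_ge0 ?sqr_ge0// divr_ge0// ltW. Qed.

Let kq : kap * S <= q.
Proof. by apply: ler_wpM2r; [exact: ltW|rewrite lerDl ltW]. Qed.

Let rq : r * S <= q.
Proof. by apply: ler_wpM2r; [exact: ltW|rewrite lerDr ltW]. Qed.

Let q0 : 0 <= q.
Proof. by apply: le_trans kq; rewrite mulr_ge0// ltW. Qed.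

Lemma path_energy : r * (D * \sum_(i < n) x i ^+ 2) <= K1 * q.
Proof.
have H : D * \sum_(i < n) x i ^+ 2 <= 3 * (D * \sum_(i < n) (rho ^+ i * x 0%N) ^+ 2) +
    3 * (Cg ^+ 2 * S) + 3 * sg ^+ 2 * (D * \sum_(i < n) u i ^+ 2).
  have -> : Cg ^+ 2 * S = D * \sum_(i < n) Cg ^+ 2.
    by rewrite sumr_const card_ord -[in RHS]mulr_natl; ring.
  rewrite !mulr_sumr -!big_split /=; apply: ler_sum => i _.
  have gC : g i ^+ 2 <= Cg ^+ 2 by exact: sqr_le_norm.
  rewrite (x_decomp (ltnW (ltn_ord i))); move: gC.
  move: (rho ^+ i * x 0%N) (g i) (u i) => X G U gC.
  have h1 := sqr_ge0 (X - G); have h2 := sqr_ge0 (X - sg * U); have h3 := sqr_ge0 (G - sg * U).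
  have -> : 3 * (D * X ^+ 2) + 3 * (D * Cg ^+ 2) + 3 * sg ^+ 2 * (D * U ^+ 2) =
    D * (3 * X ^+ 2 + 3 * Cg ^+ 2 + 3 * (sg * U) ^+ 2) by ring.
  apply: ler_wpM2l; first exact: ltW.
  apply: (@le_trans _ _ (3 * X ^+ 2 + 3 * G ^+ 2 + 3 * (sg * U) ^+ 2)); last by lra.
  have -> : 3 * X ^+ 2 + 3 * G ^+ 2 + 3 * (sg * U) ^+ 2 = (X + G + sg * U) ^+ 2 +
    ((X - G) ^+ 2 + (X - sg * U) ^+ 2 + (G - sg * U) ^+ 2) by ring.
  by rewrite lerDl !addr_ge0.
apply: le_trans (ler_wpM2l (ltW r0) H) _.
have -> : K1 * q = 3 * (2 / a) * q + 3 * Cg ^+ 2 * q + 3 * sg ^+ 2 * q by ring.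
rewrite [leLHS]mulrDr [X in X + _]mulrDr.
have I0 : 0 <= D * \sum_(i < n) (rho ^+ i * x 0%N) ^+ 2.
  by rewrite mulr_ge0 ?(ltW D0)//; apply: sumr_ge0 => i _; exact: sqr_ge0.
apply: lerD; first apply: lerD.
- rewrite [leLHS]mulrCA -[leRHS](mulrA 3); apply: ler_wpM2l => //.
  apply: (@le_trans _ _ (D * \sum_(i < n) (rho ^+ i * x 0%N) ^+ 2)); first exact: ler_piMl.
  apply: le_trans init_energy _; apply: ler_wpM2l kq.
  by rewrite divr_ge0// ltW.
- rewrite [leLHS]mulrCA -[leRHS](mulrA 3); apply: ler_wpM2l => //.
  by rewrite [leLHS]mulrCA; apply: ler_wpM2l rq; exact: sqr_ge0.
- rewrite [leLHS]mulrCA; apply: ler_wpM2l; first by rewrite mulr_ge0// sqr_ge0.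
  exact: le_trans (good_energy good) kq.
Qed.

Lemma path_mean : r * (D * \sum_(i < n) `|x i|) <= (1 + K1) * q.
Proof.
have H : r * (D * \sum_(i < n) `|x i|) <= r * S + r * (D * \sum_(i < n) x i ^+ 2).
  have -> : n%:R * D = D * \sum_(i < n) 1 by rewrite sumr_const card_ord mulrC.
  rewrite -!mulrDr -big_split /=; do 2 (apply: ler_wpM2l; first exact: ltW).
  apply: ler_sum => i _; rewrite -(real_normK (num_real (x i))).
  move: (normr_ge0 (x i)); move: `|x i| => X X0.
  by have := sqr_ge0 (X - 1); have := sqr_ge0 X; have -> : (X - 1) ^+ 2 = X ^+ 2 - 2 * X + 1 by [ring|]; lra.
by apply: le_trans H _; rewrite mulrDl mul1r; apply: lerD rq path_energy.
Qed.

Lemma residualE i : (i < n)%N ->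
  residual i = sg * e i + (rho - 1 + a * D) * x i + (bt i - D * dot i).
Proof. by move=> ni; rewrite /residual (x_rec ni); ring. Qed.

Let rho_err : `|rho - 1 + a * D| <= a ^+ 2 * D ^+ 2.
Proof. by rewrite -exprMn ler_norml; have := rho_lo; have := rho_hi; have := sqr_ge0 (a * D); lra. Qed.

(** The residual is the noise plus two discretization errors: rho against 1 - a D,
  of order D^2, and the mean over the step against its value at the left end. *)
Lemma residual_sum (k : nat -> R) :
  `|\sum_(i < n) k i * residual i| <= sg * `|\sum_(i < n) k i * e i| +
    a ^+ 2 * D ^+ 2 * (\sum_(i < n) `|k i| * `|x i|) + Cb * (r * (D * \sum_(i < n) `|k i|)).
Proof.
have -> : \sum_(i < n) k i * residual i = sg * \sum_(i < n) k i * e i +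
    \sum_(i < n) k i * ((rho - 1 + a * D) * x i) + \sum_(i < n) k i * (bt i - D * dot i).
  by rewrite mulr_sumr -!big_split /=; apply: eq_bigr => i _; rewrite residualE//; ring.
apply: le_trans (ler_normD _ _) _; apply: lerD; first apply: le_trans (ler_normD _ _) _; first apply: lerD.
- by rewrite normrM (gtr0_norm sg0).
- rewrite mulr_sumr; apply: le_trans (ler_norm_sum _ _ _) _; apply: ler_sum => i _.
  rewrite !normrM mulrCA; apply: ler_wpM2r rho_err.
  by rewrite mulr_ge0.
- rewrite mulrA mulrA mulr_sumr; apply: le_trans (ler_norm_sum _ _ _) _; apply: ler_sum => i _.
  rewrite normrM mulrC; apply: ler_wpM2r => //.
  by apply: le_trans (bt_close (ltn_ord i)) _; rewrite mulrAC.
Qed.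

Definition score_const : R := sg * (3 + sg) + (Cf + 1) * (a ^+ 2 + Cb) * (1 + K1).

Let mean_sq : D ^+ 2 * (\sum_(i < n) `|x i|) <= (1 + K1) * q.
Proof.
apply: le_trans path_mean; rewrite expr2 -mulrA; apply: ler_wpM2r => //.
by rewrite mulr_ge0 ?(ltW D0)//; apply: sumr_ge0.
Qed.

Let big0 : 0 <= (1 + K1) * q.
Proof. by apply: mulr_ge0 q0; rewrite addr_ge0. Qed.

Lemma score_f (l : 'I_p) : `|\sum_(i < n) f i l ord0 * residual i| <= score_const * q.
Proof.
apply: le_trans (residual_sum (fun i => f i l ord0)) _.
have h1 : `|\sum_(i < n) f i l ord0 * e i| <= q.
  apply: le_trans kq; have := @good_wsum _ _ _ _ _ _ _ _ _ good l (ltnW (ltn_ord l)).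
  by under eq_bigr do rewrite weights_f.
have h2 : D ^+ 2 * (\sum_(i < n) `|f i l ord0| * `|x i|) <= Cf * ((1 + K1) * q).
  apply: le_trans (ler_wpM2l Cf1 mean_sq); rewrite mulrCA.
  apply: ler_wpM2l; first exact: sqr_ge0.
  by rewrite mulr_sumr; apply: ler_sum => i _; exact: ler_wpM2r.
have h3 : r * (D * \sum_(i < n) `|f i l ord0|) <= Cf * ((1 + K1) * q).
  apply: (@le_trans _ _ (Cf * (r * S))).
    have -> : Cf * (r * S) = r * (D * \sum_(i < n) Cf).
      by rewrite sumr_const card_ord -[in RHS]mulr_natl; ring.
    do 2 (apply: ler_wpM2l; first exact: ltW).
    by apply: ler_sum => i _; exact: f_le.
  apply: ler_wpM2l => //; apply: le_trans rq _.
  by rewrite -[leLHS]mul1r; apply: ler_wpM2r => //; rewrite lerDl.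
have a2 := sqr_ge0 a.
have := ler_wpM2l (ltW sg0) h1; have := ler_wpM2l a2 h2; have := ler_wpM2l Cb0 h3.
have := mulr_ge0 (ltW sg0) q0; have := mulr_ge0 (mulr_ge0 (ltW sg0) (ltW sg0)) q0.
have := mulr_ge0 a2 big0; have := mulr_ge0 Cb0 big0.
rewrite /score_const; move: big0.
move: q0; move: q => Q Q0; move: (1 + K1) => K2 *; lra.
Qed.

Lemma score_x : `|\sum_(i < n) x i * residual i| <= score_const * q.
Proof.
apply: le_trans (residual_sum x) _.
have h1 : `|\sum_(i < n) x i * e i| <= (2 + sg) * q.
  have -> : \sum_(i < n) x i * e i = x 0%N * (\sum_(i < n) rho ^+ i * e i) +
      \sum_(i < n) g i * e i + sg * (\sum_(i < n) u i * e i).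
    rewrite !mulr_sumr -!big_split /=; apply: eq_bigr => i _.
    by rewrite (x_decomp (ltnW (ltn_ord i))); ring.
  apply: le_trans (ler_normD _ _) _; rewrite mulrDl; apply: lerD; last first.
    rewrite normrM (gtr0_norm sg0); apply: ler_wpM2l; first exact: ltW.
    exact: le_trans (good_cross good) kq.
  apply: le_trans (ler_normD _ _) _; rewrite mulrDl mul1r; apply: lerD; last first.
    apply: le_trans kq; have := @good_wsum _ _ _ _ _ _ _ _ _ good p (ltnSn p).
    by under eq_bigr do rewrite weights_g.
  apply: le_trans kq; have := good_init good; have := x_init.
  move: (x 0%N) (\sum_(i < n) _) (kap * S) => X Y Z XZ YZ.
  have hm := sqr_ge0 (X - Y); have hp := sqr_ge0 (X + Y).
  have e1 : (X - Y) ^+ 2 = X ^+ 2 + Y ^+ 2 - 2 * (X * Y) by ring.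
  have e2 : (X + Y) ^+ 2 = X ^+ 2 + Y ^+ 2 + 2 * (X * Y) by ring.
  rewrite e1 in hm; rewrite e2 in hp; rewrite ler_norml; apply/andP; split; lra.
have h2 : D ^+ 2 * (\sum_(i < n) `|x i| * `|x i|) <= (1 + K1) * q.
  under eq_bigr => i _ do rewrite -normrM -expr2 ger0_norm ?sqr_ge0//.
  apply: (@le_trans _ _ (r * (D * \sum_(i < n) x i ^+ 2))).
    rewrite expr2 -mulrA; apply: ler_wpM2r => //.
    by rewrite mulr_ge0 ?(ltW D0)//; apply: sumr_ge0 => i _; exact: sqr_ge0.
  by apply: le_trans path_energy _; apply: ler_wpM2r => //; rewrite lerDr.
have h3 := path_mean.
have a2 := sqr_ge0 a.
have := ler_wpM2l (ltW sg0) h1; have := ler_wpM2l a2 h2; have := ler_wpM2l Cb0 h3.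
have := mulr_ge0 (ltW sg0) q0.
have := mulr_ge0 Cf1 (mulr_ge0 a2 big0); have := mulr_ge0 Cf1 (mulr_ge0 Cb0 big0).
rewrite /score_const; move: big0.
move: q0; move: q => Q Q0; move: (1 + K1) => K2 *; lra.
Qed.
End PathEstimates.

(** * Riemann integrals of periodic functions *)

Lemma is_riemann_sum (I : Type) (s : seq I) (f : I -> R -> R) (v : I -> R) (a b : R) :
  (forall i, is_riemann (f i) a b (v i)) ->
  is_riemann (fun x => \sum_(i <- s) f i x) a b (\sum_(i <- s) v i).
Proof.
move=> fv; elim: s => [|i s IH].
  under eq_fun do rewrite big_nil; rewrite big_nil.
  by have := @is_riemann_cst a b 0; rewrite mulr0.
by rewrite big_cons; under eq_fun do rewrite big_cons; exact: is_riemannD.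
Qed.

Lemma riemann_integrable_max (f g : R -> R) (a b : R) :
  riemann_integrable f a b -> riemann_integrable g a b ->
  riemann_integrable (fun x => Num.max (f x) (g x)) a b.
Proof.
move=> fi gi.
have -> : (fun x => Num.max (f x) (g x)) = (fun x => 2^-1 * (f x + g x + `|f x - g x|)).
  by apply/funext => x; rewrite maxr_absE mulrC.
eexists; apply: is_riemannZ; apply: is_riemannD; first apply: is_riemannD.
- exact: riemann_is fi.
- exact: riemann_is gi.
- apply: riemann_is; apply: riemann_integrable_norm.
  exact: is_riemann_ex (is_riemannB (riemann_is fi) (riemann_is gi)).
Qed.

Lemma riemann_integrable_bigmax (I : Type) (s : seq I) (f : I -> R -> R) (a b : R) :
  (forall i, riemann_integrable (f i) a b) ->
  riemann_integrable (fun x => \big[Num.max/0]_(i <- s) f i x) a b.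
Proof.
move=> fi; elim: s => [|i s IH].
  under eq_fun do rewrite big_nil; exists ((b - a) * 0); exact: (@is_riemann_cst a b 0).
by under eq_fun do rewrite big_cons; exact: riemann_integrable_max.
Qed.

Lemma is_riemann_shift (F : R -> R) (a b v : R) : 0 <= a -> a <= b ->
  (forall t : R, 0 <= t -> F (t + 1) = F t) -> is_riemann F a b v ->
  is_riemann F (a + 1) (b + 1) v.
Proof.
move=> a0 ab per Fv.
have H : is_riemann (fun y => 1 * F (1 * y + -1)) (a + 1) (b + 1) v.
  apply: (@RInt.is_RInt_comp_lin Hierarchy.R_NormedModule F 1 (-1) (a + 1) (b + 1) v).
  rewrite !RealsE.
  have -> : 1 * (a + 1) + -1 = a by ring.
  by have -> : 1 * (b + 1) + -1 = b by ring.
apply: is_riemann_ext H; last by rewrite lerD2r.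
move=> x /andP[ax _]; rewrite !mul1r -per ?subrK//.
by have := a0; lra.
Qed.

(** An interval of length S contains at least S - 2 whole periods that start at an
  integer, and the rest of the integral is nonnegative. *)
Lemma periodic_integral_lower (F : R -> R) (v c S : R) :
  (forall t : R, 0 <= t -> F (t + 1) = F t) -> (forall t, 0 <= F t) ->
  is_riemann F 0 1 v -> 0 <= c -> 2 <= S ->
  riemann_integrable F c (c + S) /\ (S - 2) * v <= riemann F c (c + S).
Proof.
move=> per F0 Fv c0 S2.
have one (k : nat) : is_riemann F k%:R (k%:R + 1) v.
  elim: k => [|k IH]; first by rewrite add0r.
  by rewrite -natr1; apply: is_riemann_shift => //; rewrite lerDl.
have block (k m : nat) : is_riemann F k%:R (k%:R + m%:R) (m%:R * v).
  elim: m => [|m IH]; first by rewrite addr0 mul0r; exact: riemann_point.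
  rewrite -natr1 addrA mulrDl mul1r.
  have H := one (k + m)%N; rewrite natrD in H.
  exact: (@RInt.is_RInt_Chasles Hierarchy.R_NormedModule F _ _ _ _ _ IH H).
have v0 : 0 <= v.
  have := is_riemann_le ler01 (@is_riemann_cst 0 1 0) Fv (fun x _ => F0 x).
  by rewrite mulr0.
pose k0 := (Num.truncn c).+1; pose k1 := Num.truncn (c + S).
have cS0 : 0 <= c + S by lra.
have /andP[h1 h2] := truncn_itv c0; have /andP[h3 h4] := truncn_itv cS0.
have k01 : (k0 <= k1)%N.
  by rewrite -ltnS -(ltr_nat R); apply: le_lt_trans h4; rewrite /k0 -natr1; lra.
have big : riemann_integrable F c (c + S).
  apply: (@riemann_integrable_sub F 0 (0 + k1.+1%:R)) => //; [by lra|by rewrite add0r ltW|].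
  by have := block 0%N k1.+1 => H; exists (k1.+1%:R * v).
split=> //.
have i1 : riemann_integrable F c k0%:R.
  by apply: riemann_integrable_sub big => //; [exact: ltW|apply: le_trans h3; rewrite ler_nat].
have i2 : riemann_integrable F k0%:R (c + S).
  by apply: riemann_integrable_sub big => //; [exact: ltW|apply: le_trans h3; rewrite ler_nat].
have i3 : riemann_integrable F k1%:R (c + S).
  by apply: riemann_integrable_sub i2 => //; rewrite ler_nat.
have bl := block k0 (k1 - k0)%N; rewrite -natrD subnKC// in bl.
rewrite -(riemann_cat i1 i2) -(riemann_cat (is_riemann_ex bl) i3) (is_riemannE bl).
have pos a b : a <= b -> riemann_integrable F a b -> 0 <= riemann F a b.
  move=> ab /riemann_is Fi.
  by have := is_riemann_le ab (@is_riemann_cst a b 0) Fi (fun x _ => F0 x); rewrite mulr0.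
have p1 := pos _ _ (ltW h2) i1; have p3 := pos _ _ h3 i3.
have : (S - 2) * v <= (k1 - k0)%:R * v.
  apply: ler_wpM2r => //; rewrite natrB//; move: h4; rewrite -natr1 -/k1 /k0 -[(_.+1)%:R]natr1.
  by lra.
by rewrite -/k0; lra.
Qed.

(** * Linear combinations of the basis functions *)

Section Basis.
Variables (p : nat) (phi : R -> 'cV[R]_p).
Hypothesis A2 : assumption2 phi.

Lemma phi_component_integrable (l : 'I_p) (a b : R) : 0 <= a -> a <= b ->
  riemann_integrable (fun t => phi t l ord0) a b.
Proof.
move=> a0 ab; apply: (@riemann_integrable_sub _ 0 (b + 1)) => //; first by lra.
by apply: (phi_integrable A2); lra.
Qed.

(** A Riemann-integrable function is bounded on a period, hence by periodicity. *)
Lemma phi_bounded : exists2 Cf : R, 0 <= Cf &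
  forall (t : R) (l : 'I_p), 0 <= t -> `|phi t l ord0| <= Cf.
Proof.
have H (l : 'I_p) : exists M : R, forall t : R, 0 <= t <= 1 -> `|phi t l ord0| <= M.
  have [M HM] := RInt.ex_RInt_ub _ _ _ (phi_component_integrable l (lexx 0) ler01).
  exists M => t /andP[t0 t1]; rewrite -RabsE; apply/RleP; apply: HM.
  rewrite Rmin_left; last exact/RleP.
  rewrite Rmax_right; last exact/RleP.
  by split; exact/RleP.
have [M HM] := choice H.
exists (\sum_l `|M l|) => [|t l t0]; first exact: sumr_ge0.
have red (k : nat) (s : R) : 0 <= s -> phi (s + k%:R) = phi s.
  elim: k s => [|k IH] s s0; first by rewrite addr0.
  by rewrite -natr1 addrA (phi_periodic A2) ?IH// addr_ge0.
have /andP[h1 h2] := truncn_itv t0.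
have -> : t = (t - (Num.truncn t)%:R) + (Num.truncn t)%:R by rewrite subrK.
rewrite red ?subr_ge0//.
apply: (@le_trans _ _ (M l)).
  apply: HM; apply/andP; split; first by rewrite subr_ge0.
  by rewrite lerBlDr; move: h2; rewrite -natr1; lra.
rewrite (bigD1 l)//=; apply: le_trans (ler_norm _) _.
by rewrite lerDl sumr_ge0.
Qed.

Lemma phi_norm_integrable (c : 'cV[R]_p) (a b : R) : 0 <= a -> a <= b ->
  riemann_integrable (fun s => `|phi s - c|) a b.
Proof.
move=> a0 ab.
have -> : (fun s => `|phi s - c|) =
    fun s => \big[Num.max/0]_(ij : 'I_p * 'I_1) `|phi s ij.1 ord0 - c ij.1 ord0|.
  apply/funext => s; rewrite [LHS](mx_normrE (phi s - c)); apply: eq_bigr => -[i j] _.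
  by rewrite !mxE (ord1 j).
apply: riemann_integrable_bigmax => ij; apply: riemann_integrable_norm.
exact: is_riemann_ex (is_riemannB (riemann_is (phi_component_integrable ij.1 a0 ab)) (@is_riemann_cst _ _ _)).
Qed.

Lemma component_le_norm (v : 'cV[R]_p) (l : 'I_p) : `|v l ord0| <= `|v|.
Proof.
rewrite [leRHS](mx_normrE v).
exact: (le_bigmax _ (fun ij : 'I_p * 'I_1 => `|v ij.1 ij.2|) (l, ord0)).
Qed.

Lemma lincomb_modulus (al : 'I_p -> R) (c t D : R) :
  0 <= t -> 0 <= D ->
  let y s := \sum_j al j * phi s j ord0 in
  riemann (fun s => `|phi s - phi t|) t (t + D) <= c ->
  riemann_integrable y t (t + D) /\
  riemann (fun s => `|y s - y t|) t (t + D) <= (\sum_j `|al j|) * c.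
Proof.
move=> t0 D0 y Hc.
have tD : t <= t + D by rewrite lerDl.
have yi : is_riemann y t (t + D) (\sum_j al j * riemann (fun s => phi s j ord0) t (t + D)).
  apply: is_riemann_sum => j; apply: is_riemannZ; apply: riemann_is.
  exact: phi_component_integrable.
split; first by exists (\sum_j al j * riemann (fun s => phi s j ord0) t (t + D)).
have A0 : 0 <= \sum_j `|al j| by exact: sumr_ge0.
apply: le_trans (ler_wpM2l A0 Hc).
have i1 := riemann_is (riemann_integrable_norm
  (is_riemann_ex (is_riemannB yi (@is_riemann_cst t (t + D) (y t))))).
have i2 := is_riemannZ (\sum_j `|al j|) (riemann_is (phi_norm_integrable (phi t) t0 tD)).
apply: (is_riemann_le tD i1 i2) => s _.
rewrite /y -sumrB mulr_suml; apply: le_trans (ler_norm_sum _ _ _) _.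
apply: ler_sum => j _; rewrite -mulrBr normrM; apply: ler_wpM2l => //.
by have := component_le_norm (phi s - phi t) j; rewrite !mxE.
Qed.

Lemma lincomb_bound (Cf : R) (al : 'I_p -> R) (s : R) :
  (forall (t : R) (l : 'I_p), 0 <= t -> `|phi t l ord0| <= Cf) -> 0 <= s ->
  `|\sum_j al j * phi s j ord0| <= Cf * \sum_j `|al j|.
Proof.
move=> fC s0; apply: le_trans (ler_norm_sum _ _ _) _; rewrite mulr_sumr.
by apply: ler_sum => j _; rewrite normrM mulrC; apply: ler_wpM2r => //; exact: fC.
Qed.

Lemma lincomb_sq_integral (al : 'I_p -> R) :
  is_riemann (fun s => (\sum_j al j * phi s j ord0) ^+ 2) 0 1 (\sum_j al j ^+ 2).
Proof.
have H : is_riemann (fun s => \sum_j \sum_k al j * al k * (phi s *m (phi s)^T) j k) 0 1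
    (\sum_j \sum_k al j * al k * (1%:M : 'M[R]_p) j k).
  apply: is_riemann_sum => j; apply: is_riemann_sum => k; apply: is_riemannZ.
  exact: (phi_orthonormal A2).
have -> : \sum_j al j ^+ 2 = \sum_j \sum_k al j * al k * (1%:M : 'M[R]_p) j k.
  apply: eq_bigr => j _; rewrite (bigD1 j)//= big1 => [|k kj].
    by rewrite mxE eqxx mulr1 addr0 expr2.
  by rewrite mxE eq_sym (negbTE kj) mulr0.
apply: is_riemann_ext H => // s _.
rewrite expr2 mulr_suml; apply: eq_bigr => j _; rewrite mulr_sumr; apply: eq_bigr => k _.
by rewrite mxE big_ord1 mxE; ring.
Qed.

(** Orthonormality gives (S - 2) |al|^2 for the integral of the square over
  S = n D. Replacing the integral by the sum costs a term of order sqrt D S |al|^2, by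
  the modulus bound. With 8 <= S, half of S is left. *)
Lemma gram_riemann (Cf CM : R) (al : 'I_p -> R) (s0 D : R) (n : nat) :
  0 <= Cf -> 0 <= CM -> (forall (t : R) (l : 'I_p), 0 <= t -> `|phi t l ord0| <= Cf) ->
  0 <= s0 -> 0 < D ->
  (forall i, riemann (fun s => `|phi s - phi (s0 + i%:R * D)|) (s0 + i%:R * D)
     (s0 + i%:R * D + D) <= CM * D * Num.sqrt D) ->
  8 <= n%:R * D -> 2 * Cf * CM * p%:R * Num.sqrt D <= 4^-1 ->
  n%:R * D / 2 * \sum_j al j ^+ 2 <=
  D * \sum_(i < n) (\sum_j al j * phi (s0 + i%:R * D) j ord0) ^+ 2.
Proof.
move=> Cf0 CM0 fC s00 D0 md S8 small.
set y := fun s => \sum_j al j * phi s j ord0.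
set A := \sum_j al j ^+ 2; set A1 := \sum_j `|al j|.
have A10 : 0 <= A1 by exact: sumr_ge0.
have A1A : A1 ^+ 2 <= p%:R * A.
  have : 0 <= \sum_(i < p) \sum_(j < p) (`|al i| - `|al j|) ^+ 2.
    by apply: sumr_ge0 => i _; apply: sumr_ge0 => j _; exact: sqr_ge0.
  have -> : \sum_(i < p) \sum_(j < p) (`|al i| - `|al j|) ^+ 2 =
      2 * (p%:R * A) - 2 * A1 ^+ 2.
    transitivity (\sum_(i < p) (p%:R * al i ^+ 2 + A - 2 * `|al i| * A1)).
      apply: eq_bigr => i _.
      have -> : p%:R * al i ^+ 2 = \sum_(j < p) al i ^+ 2.
        by rewrite sumr_const card_ord -[RHS]mulr_natl.
      rewrite /A /A1 mulr_sumr -big_split -sumrB /=; apply: eq_bigr => j _.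
      by rewrite -(real_normK (num_real (al i))) -(real_normK (num_real (al j))); ring.
    rewrite sumrB big_split /= -mulr_sumr -/A sumr_const card_ord -[A *+ p]mulr_natl.
    by rewrite -mulr_suml -mulr_sumr -/A1; ring.
  by lra.
have per (t : R) : 0 <= t -> y (t + 1) ^+ 2 = y t ^+ 2.
  by move=> t0; rewrite /y; congr (_ ^+ 2); apply: eq_bigr => j _; rewrite (phi_periodic A2).
have sqi (c d : R) : 0 <= c -> c <= d -> riemann_integrable (fun s => y s ^+ 2) c d.
  move=> c0 cd; have d2 : 2 <= d + 2 by lra.
  have [H _] := periodic_integral_lower per (fun _ => sqr_ge0 _) (@lincomb_sq_integral al) (lexx 0) d2.
  by apply: riemann_integrable_sub H => //; lra.
have t0 (i : nat) : 0 <= s0 + i%:R * D by rewrite addr_ge0// mulr_ge0// ltW.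
have sqr_int (i : nat) : riemann (fun s => y s ^+ 2) s0 (s0 + i%:R * D) <=
    D * \sum_(k < i) y (s0 + k%:R * D) ^+ 2 + i%:R * D * (2 * Cf * CM * Num.sqrt D * A1 ^+ 2).
  elim: i => [|i IH].
    by rewrite mul0r addr0 (is_riemannE (@riemann_point _ _)) big_ord0 !mul0r mulr0 addr0.
  have tE : s0 + i.+1%:R * D = s0 + i%:R * D + D by rewrite -natr1; ring.
  have le1 : s0 <= s0 + i%:R * D by rewrite lerDl mulr_ge0// ltW.
  have le2 : s0 + i%:R * D <= s0 + i%:R * D + D by rewrite lerDl ltW.
  rewrite tE -(riemann_cat (sqi _ _ s00 le1) (sqi _ _ (t0 i) le2)) big_ord_recr /=.
  set t := s0 + i%:R * D in le1 le2 tE *.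
  have [yi ym] := lincomb_modulus al (t0 i) (ltW D0) (md i).
  have ni := riemann_is (riemann_integrable_norm
    (is_riemann_ex (is_riemannB (riemann_is yi) (@is_riemann_cst t (t + D) (y t))))).
  have step : riemann (fun s => y s ^+ 2) t (t + D) <=
      D * y t ^+ 2 + 2 * Cf * A1 * riemann (fun s => `|y s - y t|) t (t + D).
    have -> : D * y t ^+ 2 = (t + D - t) * y t ^+ 2 by congr (_ * _); ring.
    apply: (is_riemann_le le2 (riemann_is (sqi _ _ (t0 i) le2))
      (is_riemannD (@is_riemann_cst _ _ _) (is_riemannZ (2 * Cf * A1) ni))) => s /andP[ts _].
    have b1 := lincomb_bound al fC (t0 i); have b2 := lincomb_bound al fC (le_trans (t0 i) (ltW ts)).
    rewrite -/t -/(y t) -/A1 in b1; rewrite -/(y s) -/A1 in b2.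
    rewrite -lerBlDl subr_sqr mulrC.
    apply: (@le_trans _ _ (`|y s + y t| * `|y s - y t|)); first by rewrite -normrM ler_norm.
    apply: ler_wpM2r => //; apply: le_trans (ler_normD _ _) _; lra.
  have c0 : 0 <= 2 * Cf * A1 by rewrite !mulr_ge0.
  have := ler_wpM2l c0 ym; rewrite -/A1 -[i.+1%:R]natr1 => h.
  have -> : (i%:R + 1) * D * (2 * Cf * CM * Num.sqrt D * A1 ^+ 2) =
    i%:R * D * (2 * Cf * CM * Num.sqrt D * A1 ^+ 2) + 2 * Cf * A1 * (A1 * (CM * D * Num.sqrt D)).
    by ring.
  by rewrite -/t in IH; rewrite mulrDr; lra.
have S2 : 2 <= n%:R * D by lra.
have [_ L] := periodic_integral_lower per (fun _ => sqr_ge0 _) (@lincomb_sq_integral al) s00 S2.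
have A0 : 0 <= A by apply: sumr_ge0 => j _; exact: sqr_ge0.
have H := sqr_int n.
have c0 : 0 <= 2 * Cf * CM * Num.sqrt D by rewrite !mulr_ge0// sqrtr_ge0.
have S0 : 0 <= n%:R * D by lra.
have e1 := ler_wpM2l S0 (ler_wpM2l c0 A1A).
have e2 := ler_wpM2r (mulr_ge0 S0 A0) small.
have e3 := ler_wpM2r A0 S8.
have E : n%:R * D * (2 * Cf * CM * Num.sqrt D * (p%:R * A)) =
  2 * Cf * CM * p%:R * Num.sqrt D * (n%:R * D * A) by ring.
rewrite E in e1; rewrite -/A in L.
move: L H e1 e2 e3; set I := riemann _ _ _; set Q := D * \sum_(k < n) _.
move: (n%:R * D) (2 * Cf * CM * p%:R * Num.sqrt D * _) => Sn Z.
by rewrite -/A1; move: (Sn * _) => Z1; lra.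
Qed.
End Basis.

(** * Solutions of the equation *)

(** Extending a path by its value at 0 makes it continuous on the whole line, where
  the results on primitives are stated. *)
Lemma continuous_clamp (f : R -> R) : {within `[0, +oo[, continuous f} ->
  forall s, continuity_pt (fun u => f (Num.max 0 u)) s.
Proof.
move=> /subspace_continuousP fc s; apply/continuity_pt_cvg => /=.
have ms : `[0, +oo[%classic (Num.max 0 s) by rewrite /= in_itv/= andbT le_max lexx.
have H := fc _ ms.
apply: (@cvg_comp _ _ _ (fun u => Num.max 0 u) f _ _ _ _ H).
move=> U /= [e /= e0 eU]; exists e => //= u su.
apply: eU; last by rewrite /= in_itv/= andbT le_max lexx.
rewrite /ball /= in su *; apply: le_lt_trans su.
case: (leP 0 s) => hs; case: (leP 0 u) => hu //.
- rewrite subr0 (ger0_norm hs); apply: le_trans (ler_norm _); lra.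
- rewrite sub0r normrN (ger0_norm hu) distrC; apply: le_trans (ler_norm _); lra.
- by rewrite subrr normr0.
Qed.

Section Path.
Variables (p : nat) (phi : R -> 'cV[R]_p) (th : 'cV[R]_p * R) (sg : R).
Definition mean_drift (s : R) : R := (th.1^T *m phi s) ord0 ord0.

Variables (I : set R) (x b : R -> R) (t D : R).
Hypotheses (sg0 : sg != 0) (a0 : th.2 != 0) (t0 : 0 <= t) (D0 : 0 < D).
Hypothesis II : forall u, t <= u <= t + D -> I u.
Hypothesis xc : {within `[0, +oo[, continuous x}.
Hypothesis bc : {within `[0, +oo[, continuous b}.
Hypothesis sol : solves_on phi th sg I x b.

Let clamp (f : R -> R) (u : R) := f (Num.max 0 u).

Let clampE (f : R -> R) u : 0 <= u -> clamp f u = f u.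
Proof. by move=> u0; rewrite /clamp max_r. Qed.

Let sol_clamp (u : R) : t <= u <= t + D ->
  is_riemann (fun v => mean_drift v - th.2 * clamp x v) t u
    (clamp x u - clamp x t - sg * (clamp b u - clamp b t)).
Proof.
move=> tu; have /andP[tu1 tu2] := tu.
have u0 : 0 <= u by exact: le_trans tu1.
rewrite !clampE//.
have It : I t by apply: II; rewrite lexx lerDl ltW.
apply: is_riemann_ext (sol It (II tu) tu1) => // v /andP[tv _].
by rewrite clampE// (le_trans t0)// ltW.
Qed.

Lemma path_ar_noise : ar_noise th.2 t D b q @[q --> \oo] -->
  (x (t + D) - expR (- (th.2 * D)) * x t - ar_mean th.2 t D mean_drift) / sg.
Proof.
have tD0 : 0 <= t + D by rewrite addr_ge0// ltW.
have E : (fun q => ar_noise th.2 t D b q) = (fun q => ar_noise th.2 t D (clamp b) q).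
  apply/funext => q; rewrite /ar_noise /left_sum !clampE//; congr (_ - _ * (_ * _)).
  apply: eq_bigr => k _.
  by rewrite clampE// addr_ge0// mulr_ge0// divr_ge0// ltW.
have := @ar_representation th.2 t D D0 mean_drift (clamp x) (clamp b) sg sg0
  (continuous_clamp xc) (continuous_clamp bc) sol_clamp.
by rewrite E !clampE.
Qed.

Lemma path_decay_integrable :
  riemann_integrable (fun u => decay th.2 t D u * riemann mean_drift t u) t (t + D).
Proof.
exact: (decay_primitive_integrable D0 a0 (continuous_clamp xc) (continuous_clamp bc) sol_clamp).
Qed.
End Path.

(** * Gram matrix and scores of a stretch, with high probability *)

(** Together, coercivity of the Gram matrix of the regressors (f i, - x i) and a
  small score at (mu, a) place the least-squares estimate near (mu, a). *)
Record phase_good (c eps D a : R) (n p : nat) (mu : 'cV[R]_p) (f : nat -> 'cV[R]_p)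
    (x : nat -> R) : Prop := PhaseGood {
  phase_gram : forall (al : 'I_p -> R) (be : R),
    c * (n%:R * D) * (\sum_j al j ^+ 2 + be ^+ 2) <=
    D * \sum_(i < n) (\sum_j al j * f i j ord0 - be * x i) ^+ 2 ;
  phase_score_f : forall l : 'I_p,
    `|\sum_(i < n) f i l ord0 * residual a D f x mu i| <= eps * (n%:R * D) ;
  phase_score_x : `|\sum_(i < n) x i * residual a D f x mu i| <= eps * (n%:R * D) }.

Lemma mean_driftE p (phi : R -> 'cV[R]_p) th s :
  mean_drift phi th s = \sum_j th.1 j ord0 * phi s j ord0.
Proof. by rewrite /mean_drift mxE; apply: eq_bigr => j _; rewrite mxE. Qed.

Section PhaseEstimates.
Context d (Omega : measurableType d) (P : probability Omega R).
Context (B : R -> {RV P >-> R}) (hB : brownian_motion B).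
Context (p : nat) (phi : R -> 'cV[R]_p) (A2 : assumption2 phi).
Context (th : 'cV[R]_p * R) (sg CM : R).

(** The constant c comes before eps, since the error of the estimate is of order
  eps / c. The bound on the initial value is kept as a premise inside the event: its
  probability depends on the law of X at s0. *)
Lemma phase_estimates : 0 < th.2 -> 0 < sg -> 0 <= CM ->
  exists2 c : R, 0 < c & forall eps eta : R, 0 < eps -> 0 < eta ->
  exists S0 D0 kap : R, [/\ 0 < S0, 0 < D0, 0 < kap &
  forall (s0 D : R) (n : nat) (X : R -> Omega -> R),
    0 <= s0 -> 0 < D -> D <= D0 -> S0 <= n%:R * D ->
    (forall i, riemann (fun s => `|phi s - phi (tick s0 D i)|) (tick s0 D i)
       (tick s0 D i + D) <= CM * D * Num.sqrt D) ->
    (forall t, measurable_fun setT (X t)) ->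
    {ae P, forall w, [/\ {within `[0, +oo[, continuous (X ^~ w)},
      {within `[0, +oo[, continuous (B ^~ w)} &
      solves_on phi th sg `[s0, s0 + n%:R * D] (X ^~ w) (B ^~ w)]} ->
    whp P eta (fun w => X s0 w ^+ 2 <= kap * (n%:R * D) ->
      phase_good c eps D th.2 n th.1 (fun i => phi (tick s0 D i)) (fun i => X (tick s0 D i) w))].
Proof.
move=> a0 sg0 CM0.
have [Cf Cf0 fC] := phi_bounded A2.
set a := th.2 in a0 *.
pose M1 := \sum_j `|th.1 j ord0|.
have M10 : 0 <= M1 by exact: sumr_ge0.
pose Cb := Cf * M1 + (M1 * CM + a * (Cf * M1)).
have Cb0 : 0 <= Cb by rewrite !addr_ge0 ?mulr_ge0// ltW.
pose Cg := 2 * Cb / a.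
have Cg0 : 0 <= Cg by rewrite divr_ge0 ?mulr_ge0// ltW.
pose s1 := sg ^+ 2 / (48 * a).
pose k0 := Num.min 1 (s1 / (2 * (Cg ^+ 2 + 1))).
have s10 : 0 < s1 by rewrite divr_gt0 ?exprn_gt0 ?mulr_gt0.
have k00 : 0 < k0 by rewrite lt_min ltr01 divr_gt0// mulr_gt0// ltr_wpDl// sqr_ge0.
exists (Num.min (k0 / 16) (s1 / 8)); first by rewrite lt_min (divr_gt0 k00)// (divr_gt0 s10).
move=> eps eta eps0 eta0.
pose K := score_const a sg Cf Cb.
have K0 : 0 <= K.
  rewrite /K /score_const; have := ltW sg0; have := ltW a0; move=> a1 sg1.
  by rewrite addr_ge0 ?mulr_ge0 ?addr_ge0 ?mulr_ge0 ?addr_ge0 ?sqr_ge0 ?divr_ge0 ?mulr_ge0.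
pose den := sg * (p%:R + 2) / 2 + 2 / a.
have den0 : 0 < den by rewrite addr_gt0 ?divr_gt0 ?mulr_gt0 ?ltr_wpDl.
(* each term serves one smallness condition of [gram_lower], the last one the scores *)
pose kap := Num.min (Num.min 96^-1 (k0 / 8 / sg)) (Num.min (s1 / 8 / den) (eps / (2 * (K + 1)))).
have K1 : 0 < 2 * (K + 1) by rewrite mulr_gt0// ltr_wpDl.
have kap0 : 0 < kap.
  by rewrite !lt_min invr_gt0 ltr0n (divr_gt0 (divr_gt0 k00 _) sg0)// (divr_gt0 (divr_gt0 s10 _) den0)// (divr_gt0 eps0 K1).
have kapK : kap * (2 * (K + 1)) <= eps by rewrite -ler_pdivlMr// !ge_min lexx !orbT.
have kap96 : kap <= 96^-1 by rewrite !ge_min lexx.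
have kapk0 : sg * kap <= k0 / 8 by rewrite mulrC -ler_pdivlMr// !ge_min lexx !orbT.
have kapden : kap * den <= s1 / 8 by rewrite -ler_pdivlMr// !ge_min lexx !orbT.
pose Ch := Num.max Cf Cg.
have [S0 [D1 [S00 D10 H]]] := @phase_whp _ _ P B hB a Ch kap eta p.+1 a0 kap0 eta0.
pose q0 := Num.min (eps / (2 * (K + 1))) (4^-1 / (2 * Cf * CM * p%:R + 1)).
have q00 : 0 < q0.
  by rewrite lt_min (divr_gt0 eps0 K1) divr_gt0// ltr_wpDl// !mulr_ge0.
exists (Num.max S0 8), (Num.min (Num.min D1 1) (Num.min a^-1 (q0 ^+ 2))), kap; split => //.
- by rewrite lt_max S00.
- by rewrite !lt_min D10 ltr01 invr_gt0 a0 exprn_gt0.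
move=> s0 D n X s00 D0; rewrite !le_min => /andP[/andP[DD1 Dle1] /andP[Da Dq]].
rewrite ge_max => /andP[S0S S8] md mX hae.
have rq : Num.sqrt D <= q0.
  by rewrite -[leRHS]gtr0_norm// -sqrtr_sqr ler_sqrt// sqr_ge0.
have r0 : 0 < Num.sqrt D by rewrite sqrtr_gt0.
have aD : a * D <= 1 by rewrite mulrC -ler_pdivlMr// div1r.
have n0 : (0 < n)%N.
  by case: n S8 {hae S0S} => //; rewrite mul0r => ?; lra.
pose rho := expR (- (a * D)).
have t0 i : 0 <= tick s0 D i by rewrite addr_ge0// mulr_ge0// ltW.
have tS i : tick s0 D i.+1 = tick s0 D i + D by rewrite /tick -natr1; ring.
have inI i u : (i < n)%N -> tick s0 D i <= u <= tick s0 D i + D -> `[s0, s0 + n%:R * D]%classic u.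
  move=> ni /andP[u1 u2]; rewrite /= in_itv/=; apply/andP; split.
    by apply: le_trans u1; rewrite lerDl mulr_ge0// ltW.
  apply: le_trans u2 _; rewrite -tS lerD2l; apply: ler_wpM2r; first exact: ltW.
  by rewrite ler_nat.
pose bt i := if (i < n)%N then ar_mean a (tick s0 D i) D (mean_drift phi th) else 0.
pose xi i w := (X (tick s0 D i.+1) w - rho * X (tick s0 D i) w - bt i) / sg.
have mxi i : measurable_fun setT (xi i).
  apply: measurable_funM => //; apply: measurable_funB => //; apply: measurable_funB => //.
  exact: measurable_funM.
have xcvg : {ae P, forall w, forall i, (i < n)%N ->
    ar_noise a (tick s0 D i) D (B ^~ w) q @[q --> \oo] --> xi i w}.
  apply: filterS hae => w [xc bc sol] i ni.
  rewrite /xi /bt ni tS.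
  by apply: (path_ar_noise _ (t0 i) D0 _ xc bc sol); [rewrite gt_eqF|move=> u; exact: inI].
have mb s : 0 <= s -> `|mean_drift phi th s| <= Cf * M1.
  by move=> s0'; rewrite mean_driftE; exact: lincomb_bound.
have bclose i : (i < n)%N -> `|bt i - D * mean_drift phi th (tick s0 D i)| <=
    (M1 * CM + a * (Cf * M1)) * D * Num.sqrt D.
  move=> ni; rewrite /bt ni.
  (* integrability is a deterministic fact, read off one good path *)
  have [w [xc bc sol]] := whp_exists ltr01 (whp_ae hae).
  have di := path_decay_integrable (lt0r_neq0 a0) (t0 i) D0 (fun u => @inI i u ni) xc bc sol.
  have [mi ml] := lincomb_modulus A2 (fun j => th.1 j ord0) (t0 i) (ltW D0) (md i).
  have mE : mean_drift phi th = fun s => \sum_j th.1 j ord0 * phi s j ord0.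
    by apply/funext => s; exact: mean_driftE.
  rewrite -mE in mi ml.
  apply: le_trans (ar_mean_bound D0 a0 mi di (M := Cf * M1) _) _.
    by move=> u /andP[u1 _]; apply: mb; exact: le_trans u1.
  rewrite mE; apply: le_trans (lerD ml (lexx _)) _.
  have DD : D ^+ 2 <= D * Num.sqrt D.
    rewrite expr2; apply: ler_wpM2l; first exact: ltW.
    have e1 : Num.sqrt D <= 1 by rewrite -(sqrtr1 R) ler_sqrt.
    have e2 : Num.sqrt D * Num.sqrt D = D by rewrite -expr2 sqr_sqrtr// ltW.
    by rewrite -{1}e2 ler_piMr// ltW.
  have c0 : 0 <= a * (Cf * M1) by rewrite !mulr_ge0// ltW.
  have := ler_wpM2l c0 DD; rewrite -/M1; lra.
have r1 : Num.sqrt D <= 1 by rewrite -(sqrtr1 R) ler_sqrt.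
have ble i : `|bt i| <= Cb * D.
  have [ni|ni] := boolP (i < n)%N; last first.
    by rewrite /bt (negbTE ni) normr0 mulr_ge0// ltW.
  have := bclose i ni; have := mb _ (t0 i).
  set m := mean_drift _ _ _ => h1 h2.
  have -> : bt i = (bt i - D * m) + D * m by ring.
  apply: le_trans (ler_normD _ _) _; rewrite normrM (gtr0_norm D0).
  have c1 : 0 <= (M1 * CM + a * (Cf * M1)) * D by rewrite !mulr_ge0 ?addr_ge0 ?mulr_ge0// ltW.
  have := ler_wpM2l c1 r1; have := ler_wpM2l (ltW D0) h1; rewrite /Cb mulr1.
  lra.
pose f i := phi (tick s0 D i).
pose h := weights rho f bt.
have hC l i : `|h l i| <= Ch.
  rewrite /h /weights /Ch le_max.
  case: insubP => [j _ _|_] /=; first by rewrite fC.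
  by rewrite (@ar_bound a D rho a0 D0 aD erefl bt Cb i ble) orbT.
have HH := H s0 D n h xi s00 D0 DD1 S0S hC mxi xcvg.
apply: whp_imp HH => // w G init.
have rec i : (i < n)%N -> X (tick s0 D i.+1) w = rho * X (tick s0 D i) w + bt i + sg * xi i w.
  by move=> ni; rewrite /xi; field; rewrite gt_eqF.
have bclose' i : (i < n)%N ->
    `|bt i - D * (th.1^T *m f i) ord0 ord0| <= Cb * D * Num.sqrt D.
  move=> ni; apply: le_trans (bclose i ni) _; rewrite -!mulrA; apply: ler_wpM2r.
    by rewrite mulr_ge0 ?ltW.
  by rewrite lerDr mulr_ge0.
have init' : X (tick s0 D 0) w ^+ 2 <= kap * (n%:R * D).
  by rewrite /tick mul0r addr0.
have fl i (l : 'I_p) : `|f i l ord0| <= Cf by exact: fC.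
have score_small v : `|v| <= K * ((kap + Num.sqrt D) * (n%:R * D)) -> `|v| <= eps * (n%:R * D).
  move=> /le_trans; apply; rewrite (mulrA K); apply: ler_wpM2r; first by rewrite mulr_ge0// ltW.
  have rK : Num.sqrt D * (2 * (K + 1)) <= eps.
    by rewrite -ler_pdivlMr//; apply: le_trans rq _; rewrite ge_min lexx.
  by have := kapK; have := kap0; have := r0; lra.
split.
- move=> al be.
  have := gram_lower (rho := rho) (x := fun i => X (tick s0 D i) w) (f := f) a0 sg0 D0 aD n0 kap0
    erefl rec ble init' G (al := al) be.
  apply => //.
    apply: (@gram_riemann _ _ A2 Cf CM al s0 D n) => //.
    have den1 : 0 < 2 * Cf * CM * p%:R + 1 by rewrite ltr_wpDl// !mulr_ge0.
    have : Num.sqrt D * (2 * Cf * CM * p%:R + 1) <= 4^-1.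
      by rewrite -ler_pdivlMr//; apply: le_trans rq _; rewrite ge_min lexx orbT.
    by have := r0; lra.
  by apply: le_trans kapden; rewrite /den; apply: ler_of_eq; ring.
- move=> l; apply: score_small.
  exact: (score_f (rho := rho) (x := fun i => X (tick s0 D i) w) (f := f) a0 sg0 D0 aD Dle1 n0 kap0 Cf0 Cb0 erefl rec fl ble bclose' init' G l).
- apply: score_small.
  exact: (score_x (rho := rho) (x := fun i => X (tick s0 D i) w) (f := f) a0 sg0 D0 aD Dle1 n0 kap0 Cf0 Cb0 erefl rec ble bclose' init' G).
Qed.
End PhaseEstimates.

(** * The positive semidefinite square root *)

Lemma cvg_seq_sum (I : Type) (s : seq I) (u : nat -> I -> R) (l : I -> R) :
  (forall i, u k i @[k --> \oo] --> l i) ->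
  \sum_(i <- s) u k i @[k --> \oo] --> \sum_(i <- s) l i.
Proof.
move=> ul; elim: s => [|i s IH].
  have -> : (fun k => \sum_(i <- [::]) u k i) = (fun=> 0) by apply/funext => k; rewrite big_nil.
  by rewrite big_nil; exact: cvg_cst.
have -> : (fun k => \sum_(j <- i :: s) u k j) = (fun k => u k i + \sum_(j <- s) u k j).
  by apply/funext => k; rewrite big_cons.
by rewrite big_cons; apply: (@cvgD _ R^o); [exact: ul|exact: IH].
Qed.

Section SquareRoot.
Variable n : nat.
Implicit Types (A B C M : 'M[R]_n) (v : 'cV[R]_n).

Definition qform A v : R := (v^T *m A *m v) ord0 ord0.

Definition psd A := forall v, 0 <= qform A v.

Lemma qformD A C v : qform (A + C) v = qform A v + qform C v.
Proof. by rewrite /qform mulmxDr mulmxDl mxE. Qed.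

Lemma qformZ c A v : qform (c *: A) v = c * qform A v.
Proof. by rewrite /qform -scalemxAr -scalemxAl mxE. Qed.

Lemma qformB A C v : qform (A - C) v = qform A v - qform C v.
Proof. by rewrite -scaleN1r qformD qformZ mulN1r. Qed.

Lemma qform_sandwich A C v : C^T = C -> qform (C *m A *m C) v = qform A (C *m v).
Proof. by move=> Cs; rewrite /qform trmx_mul Cs !mulmxA. Qed.

Lemma qform1 v : qform 1%:M v = \sum_i v i ord0 ^+ 2.
Proof. by rewrite /qform mulmx1 mxE; apply: eq_bigr => i _; rewrite mxE expr2. Qed.

Lemma psd1 : psd 1%:M.
Proof. by move=> v; rewrite qform1; apply: sumr_ge0 => i _; exact: sqr_ge0. Qed.

Lemma qform1_eq0 v : qform 1%:M v = 0 -> v = 0.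
Proof.
rewrite qform1 => /eqP; rewrite psumr_eq0; last by move=> i _; exact: sqr_ge0.
move=> /allP H; apply/matrixP => i j; rewrite (ord1 j) mxE.
by have := H i (mem_index_enum _); rewrite sqrf_eq0 => /eqP.
Qed.

Lemma qformE A v : qform A v = \sum_i \sum_j A i j * v i ord0 * v j ord0.
Proof.
rewrite /qform mxE exchange_big /=; apply: eq_bigr => j _; rewrite mxE mulr_suml.
by apply: eq_bigr => i _; rewrite mxE; ring.
Qed.


Lemma qform_add A v w : qform A (v + w) = qform A v + qform A w +
  ((v^T *m A *m w) ord0 ord0 + (w^T *m A *m v) ord0 ord0).
Proof.
rewrite /qform [(v + w)^T]linearD /= mulmxDl mulmxDr !mulmxDl.
have E (C D : 'M[R]_1) : (C + D) ord0 ord0 = C ord0 ord0 + D ord0 ord0 by rewrite mxE.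
by rewrite !E; ring.
Qed.

Lemma polarization A i j : A^T = A ->
  A i j = 2^-1 * (qform A (delta_mx i ord0 + delta_mx j ord0) -
    qform A (delta_mx i ord0) - qform A (delta_mx j ord0)).
Proof.
move=> As; have E k l : ((delta_mx k ord0 : 'cV[R]_n)^T *m A *m (delta_mx l ord0 : 'cV[R]_n)) ord0 ord0 = A k l.
  by rewrite trmx_delta -rowE -colE !mxE.
have Aji : A j i = A i j by rewrite -[in LHS]As mxE.
by rewrite qform_add !E Aji; field.
Qed.

Lemma sym_form_eq0 A : A^T = A -> (forall v, qform A v = 0) -> A = 0.
Proof.
by move=> As A0; apply/matrixP => i j; rewrite (polarization _ _ As) !A0 !subr0 mulr0 mxE.
Qed.

Definition mxcvg (X : nat -> 'M[R]_n) (L : 'M[R]_n) :=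
  forall i j, X k i j @[k --> \oo] --> L i j.

Lemma mxcvg_unique X L L' : mxcvg X L -> mxcvg X L' -> L = L'.
Proof.
move=> h h'; apply/matrixP => i j.
by apply: (cvg_unique _ (h i j) (h' i j)); exact: Rhausdorff.
Qed.

Lemma mxcvg_cst L : mxcvg (fun=> L) L.
Proof. by move=> i j; exact: cvg_cst. Qed.

Lemma mxcvgD X Y L L' : mxcvg X L -> mxcvg Y L' -> mxcvg (fun k => X k + Y k) (L + L').
Proof.
move=> h h' i j; rewrite mxE; under eq_fun do rewrite mxE.
by apply: (@cvgD _ R^o); [exact: h|exact: h'].
Qed.

Lemma mxcvgM X Y L L' : mxcvg X L -> mxcvg Y L' -> mxcvg (fun k => X k *m Y k) (L *m L').
Proof.
move=> h h' i j; rewrite mxE; under eq_fun do rewrite mxE.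
apply: (@cvg_seq_sum _ _ (fun k l => X k i l * Y k l j)) => l.
by apply: cvgM; [exact: h|exact: h'].
Qed.

Lemma mxcvgZ c X L : mxcvg X L -> mxcvg (fun k => c *: X k) (c *: L).
Proof.
move=> h i j; rewrite mxE; under eq_fun do rewrite mxE.
by apply: cvgM; [exact: cvg_cst|exact: h].
Qed.

Lemma mxcvg_form X L v : mxcvg X L -> qform (X k) v @[k --> \oo] --> qform L v.
Proof.
move=> h; have -> : (fun k => qform (X k) v) = (fun k => \sum_(i : 'I_n) \sum_j X k i j * v i ord0 * v j ord0).
  by apply/funext => k; rewrite qformE.
rewrite qformE; apply: (@cvg_seq_sum _ _ (fun k i => \sum_j X k i j * v i ord0 * v j ord0)) => i.
apply: (@cvg_seq_sum _ _ (fun k j => X k i j * v i ord0 * v j ord0)) => j.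
by do 2 (apply: cvgM; last exact: cvg_cst); exact: h.
Qed.

Section Iteration.
Variable B : 'M[R]_n.
Hypotheses (Bs : B^T = B) (B0 : psd B) (B1 : psd (1%:M - B)).

(** The cone of polynomials in B with nonnegative coefficients: unlike the set of all
  psd matrices, it is closed under products. *)
Inductive poly_cone : 'M[R]_n -> Prop :=
| PolyCone0 : poly_cone 0
| PolyConeD c k A : 0 <= c -> poly_cone A -> poly_cone (c *: B ^+ k + A).

Lemma poly_cone_add A C : poly_cone A -> poly_cone C -> poly_cone (A + C).
Proof.
move=> hA hC; elim: hA => [|c k A' c0 _ IH]; first by rewrite add0r.
by rewrite -addrA; exact: PolyConeD.
Qed.

Lemma poly_coneZ a A : 0 <= a -> poly_cone A -> poly_cone (a *: A).
Proof.
move=> a0; elim=> [|c k A' c0 _ IH]; first by rewrite scaler0; exact: PolyCone0.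
by rewrite scalerDr scalerA; apply: PolyConeD => //; exact: mulr_ge0.
Qed.

Lemma poly_coneM A C : poly_cone A -> poly_cone C -> poly_cone (A *m C).
Proof.
move=> hA hC; elim: hA => [|c k A' c0 _ IH]; first by rewrite mul0mx; exact: PolyCone0.
rewrite mulmxDl -scalemxAl; apply: poly_cone_add => //; apply: poly_coneZ => //.
elim: hC => [|e l C' e0 _ IH']; first by rewrite mulmx0; exact: PolyCone0.
rewrite mulmxDr -scalemxAr; apply: poly_cone_add => //.
have -> : B ^+ k *m B ^+ l = B ^+ (k + l) by rewrite exprD.
by rewrite -[_ *: _]addr0; apply: PolyConeD => //; exact: PolyCone0.
Qed.

Lemma poly_cone_gen : poly_cone B.
Proof. by rewrite -[B]scale1r -[_ *: B]addr0 -{1}[B]expr1; apply: PolyConeD => //; exact: PolyCone0. Qed.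

Lemma comm_pow C k : C *m B = B *m C -> C *m B ^+ k = B ^+ k *m C.
Proof. by move=> CB; exact: (@commrX _ C B k CB). Qed.

Lemma poly_cone_comm A C : C *m B = B *m C -> poly_cone A -> C *m A = A *m C.
Proof.
move=> CB; elim=> [|c k A' _ _ IH]; first by rewrite mulmx0 mul0mx.
by rewrite mulmxDr mulmxDl IH -scalemxAr -scalemxAl comm_pow.
Qed.

Lemma pow_sym k : (B ^+ k)^T = B ^+ k.
Proof.
elim: k => [|k IH]; first by rewrite expr0 trmx1.
by rewrite exprS trmx_mul IH Bs -comm_pow.
Qed.

Lemma poly_cone_sym A : poly_cone A -> A^T = A.
Proof.
elim=> [|c k A' _ _ IH]; first by rewrite trmx0.
by rewrite linearD linearZ /= IH pow_sym.
Qed.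

(** An even power is the square of a symmetric matrix; an odd one is B
  between two copies of one. *)
Lemma pow_psd k : psd (B ^+ k).
Proof.
move=> v; rewrite -(odd_double_half k) -addnn exprD exprD.
case: (odd k) => /=.
  have -> : B ^+ 1 * (B ^+ k./2 * B ^+ k./2) = B ^+ k./2 *m B *m B ^+ k./2.
    by rewrite expr1 mulrA; congr (_ * _); exact: comm_pow.
  by rewrite qform_sandwich// pow_sym.
have -> : B ^+ 0 * (B ^+ k./2 * B ^+ k./2) = B ^+ k./2 *m 1%:M *m B ^+ k./2.
  by rewrite expr0 mul1r mulmx1.
by rewrite qform_sandwich ?pow_sym//; exact: psd1.
Qed.

Lemma poly_cone_psd A : poly_cone A -> psd A.
Proof.
elim=> [|c k A' c0 _ IH] v; first by rewrite /qform mulmx0 mul0mx mxE.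
by rewrite qformD qformZ addr_ge0 ?mulr_ge0//; exact: pow_psd.
Qed.

(** A fixed point L of this iteration satisfies (1 - L)^2 = 1 - B. *)
Fixpoint root_iter k : 'M[R]_n :=
  if k is l.+1 then 2^-1 *: (B + root_iter l *m root_iter l) else 0.

Lemma root_iter_cone k : poly_cone (root_iter k).
Proof.
elim: k => [|k IH] /=; first exact: PolyCone0.
apply: poly_coneZ => //; apply: poly_cone_add; first exact: poly_cone_gen.
exact: poly_coneM.
Qed.

Lemma root_iter_comm C k : C *m B = B *m C -> C *m root_iter k = root_iter k *m C.
Proof. by move=> CB; apply: poly_cone_comm => //; exact: root_iter_cone. Qed.

(** The increments satisfy X_(k+2) - X_(k+1) = (X_(k+1) + X_k) (X_(k+1) - X_k) / 2,
  a product of elements of the cone. *)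
Lemma root_iter_incr k : poly_cone (root_iter k.+1 - root_iter k).
Proof.
elim: k => [|k IH].
  rewrite /= subr0 mul0mx addr0; apply: poly_coneZ => //; exact: poly_cone_gen.
have -> : root_iter k.+2 - root_iter k.+1 =
    2^-1 *: ((root_iter k.+1 + root_iter k) *m (root_iter k.+1 - root_iter k)).
  have E : root_iter k.+1 *m root_iter k = root_iter k *m root_iter k.+1.
    apply: poly_cone_comm; last exact: root_iter_cone.
    by symmetry; apply: root_iter_comm.
  move: E; set Y := root_iter k.+1; set X := root_iter k => E.
  transitivity (2^-1 *: (B + Y *m Y) - 2^-1 *: (B + X *m X)); first by [].
  rewrite -scalerBr; congr (_ *: _); rewrite mulmxDl !mulmxBr E.
  move: (X *m Y) (X *m X) (Y *m Y) => U V W.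
  by apply/matrixP => i j; rewrite !mxE; ring.
apply: poly_coneZ => //; apply: poly_coneM => //.
by apply: poly_cone_add; exact: root_iter_cone.
Qed.

(** From X <= 1 follows X^2 <= X, since X - X^2 = X (1 - X) X + (1 - X) X (1 - X). *)
Lemma root_iter_le1 k : psd (1%:M - root_iter k).
Proof.
elim: k => [|k IH] v; first by rewrite subr0; exact: psd1.
set X := root_iter k in IH *.
have Xs : X^T = X by apply: poly_cone_sym; exact: root_iter_cone.
have X0 : psd X by apply: poly_cone_psd; exact: root_iter_cone.
have Ys : (1%:M - X)^T = 1%:M - X by rewrite linearB /= trmx1 Xs.
rewrite /= -/X qformB qformZ qformD.
have hX : qform (X *m X) v <= qform X v.
  rewrite -subr_ge0 -qformB.
  have -> : X - X *m X = X *m (1%:M - X) *m X + (1%:M - X) *m X *m (1%:M - X).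
    rewrite !(mulmxBl, mulmxBr, mulmx1, mul1mx).
    move: (X *m X *m X) (X *m X) => U V.
    by apply/matrixP => i j; rewrite !mxE; ring.
  by rewrite qformD !qform_sandwich// addr_ge0.
have := B1 v; rewrite qformB; have := IH v; rewrite qformB; lra.
Qed.

Lemma root_iter_sym k : (root_iter k)^T = root_iter k.
Proof. by apply: poly_cone_sym; exact: root_iter_cone. Qed.

(** The quadratic forms are nondecreasing and bounded, so they converge, and by
  polarization so do the entries. *)
Lemma root_iter_cvg : exists L : 'M[R]_n, mxcvg root_iter L.
Proof.
have cv v : cvgn (fun k => qform (root_iter k) v).
  apply: nondecreasing_is_cvgn.
    apply/nondecreasing_seqP => k; rewrite -subr_ge0 -qformB.
    by apply: poly_cone_psd; exact: root_iter_incr.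
  exists (qform 1%:M v) => _ [k _ <-].
  by rewrite -subr_ge0 -qformB; exact: root_iter_le1.
exists (\matrix_(i, j) (2^-1 * (lim (qform (root_iter k) (delta_mx i ord0 + delta_mx j ord0) @[k --> \oo]) -
  lim (qform (root_iter k) (delta_mx i ord0) @[k --> \oo]) -
  lim (qform (root_iter k) (delta_mx j ord0) @[k --> \oo])))) => i j.
rewrite mxE; under eq_fun do rewrite (polarization _ _ (root_iter_sym _)).
apply: cvgM; first exact: cvg_cst.
by do 2 (apply: (@cvgB _ R^o); last exact: cv); exact: cv.
Qed.

Lemma root_iter_limit L : mxcvg root_iter L ->
  [/\ L^T = L, psd (1%:M - L), (1%:M - L) *m (1%:M - L) = 1%:M - B &
      forall C, C *m B = B *m C -> C *m L = L *m C].
Proof.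
move=> XL; split.
- apply: (@mxcvg_unique root_iter) => // i j; rewrite mxE.
  have -> : (fun k => root_iter k i j) = (fun k => root_iter k j i); last exact: XL.
  by apply/funext => k; rewrite -{1}root_iter_sym mxE.
- move=> v; have h : qform (1%:M - root_iter k) v @[k --> \oo] --> qform (1%:M - L) v.
    apply: mxcvg_form; rewrite -scaleN1r; apply: mxcvgD; first exact: mxcvg_cst.
    have -> : (fun k => - root_iter k) = (fun k => (-1) *: root_iter k).
      by apply/funext => k; rewrite scaleN1r.
    exact: mxcvgZ.
  rewrite -(cvg_lim (@Rhausdorff _) h); apply: limr_ge; first by apply/cvg_ex; eexists; exact: h.
  by apply: nearW => k; exact: root_iter_le1.
- have E : L = 2^-1 *: (B + L *m L).
    apply: (@mxcvg_unique (fun k => root_iter k.+1)).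
      by move=> i j; have := XL i j; rewrite -(cvg_shiftS (fun k => root_iter k i j)).
    by apply: mxcvgZ; apply: mxcvgD; [exact: mxcvg_cst|exact: mxcvgM].
  have E2 : 2%:R *: L = B + L *m L by rewrite {1}E scalerA divff ?scale1r// pnatr_eq0.
  have -> : B = 2%:R *: L - L *m L by rewrite E2 addrK.
  rewrite mulmxBl !mulmxBr !mulmx1 mul1mx; move: (L *m L) => U.
  by apply/matrixP => i j; rewrite !mxE; ring.
- move=> C CB; apply: (@mxcvg_unique (fun k => C *m root_iter k)).
    by apply: mxcvgM => //; exact: mxcvg_cst.
  have -> : (fun k => C *m root_iter k) = (fun k => root_iter k *m C).
    by apply/funext => k; exact: root_iter_comm.
  by apply: mxcvgM => //; exact: mxcvg_cst.
Qed.

End Iteration.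

Definition is_psd_root M S := [/\ S^T = S, psd S & S *m S = M].

(** Dominates M as a quadratic form; the 1 makes it positive. *)
Definition entry_sum M : R := 1 + \sum_i \sum_j `|M i j|.

Definition contraction M : 'M[R]_n := 1%:M - (entry_sum M)^-1 *: M.

Lemma entry_sum_gt0 M : 0 < entry_sum M.
Proof. by rewrite ltr_pwDl//; apply: sumr_ge0 => i _; exact: sumr_ge0. Qed.

Lemma qform_le M v : qform M v <= entry_sum M * qform 1%:M v.
Proof.
have sq0 : 0 <= qform 1%:M v by exact: psd1.
rewrite /entry_sum mulrDl mul1r ler_wpDl// qformE mulr_suml; apply: ler_sum => i _.
rewrite mulr_suml; apply: ler_sum => j _; apply: le_trans (ler_norm _) _.
rewrite -mulrA normrM ler_wpM2l//.
have le k : v k ord0 ^+ 2 <= qform 1%:M v.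
  by rewrite qform1 (bigD1 k)//= lerDl; apply: sumr_ge0 => l _; exact: sqr_ge0.
have := le i; have := le j; have := sqr_ge0 (v i ord0 - v j ord0); have := sqr_ge0 (v i ord0 + v j ord0).
by rewrite ler_norml; move=> ? ? ? ?; apply/andP; split; nra.
Qed.

Section Root.
Variable M : 'M[R]_n.
Hypotheses (Ms : M^T = M) (M0 : psd M).

Let B := contraction M.

Let r0 := entry_sum_gt0 M.

Lemma contraction_sym : B^T = B.
Proof. by rewrite /B /contraction linearB linearZ /= trmx1 Ms. Qed.

Lemma contraction_psd : psd B.
Proof.
move=> v; rewrite /B /contraction qformB qformZ subr_ge0 ler_pdivrMl// mulrC.
by rewrite mulrC; exact: qform_le.
Qed.

Lemma contraction_le1 : psd (1%:M - B).
Proof.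
by move=> v; rewrite /B /contraction opprB addrC subrK qformZ mulr_ge0// invr_ge0 ltW.
Qed.

Lemma psd_root_exists : exists L, [/\ mxcvg (root_iter B) L,
  is_psd_root M (Num.sqrt (entry_sum M) *: (1%:M - L)) &
  forall C, C *m M = M *m C -> C *m L = L *m C].
Proof.
have [L XL] := root_iter_cvg contraction_sym contraction_psd contraction_le1.
have [Ls L1 LL LC] := root_iter_limit contraction_sym contraction_psd contraction_le1 XL.
exists L; split => //; first split.
- by rewrite linearZ linearB /= trmx1 Ls.
- by move=> v; rewrite qformZ mulr_ge0 ?sqrtr_ge0.
- rewrite -scalemxAl -scalemxAr scalerA LL -expr2 sqr_sqrtr ?ltW//.
  by rewrite /B /contraction opprB addrC subrK scalerA divff ?scale1r// gt_eqF.
- move=> C CM; apply: LC.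
  by rewrite /B /contraction mulmxBr mulmxBl mulmx1 mul1mx -scalemxAr -scalemxAl CM.
Qed.

End Root.

(** For commuting roots, D = S - S' satisfies D S D + D S' D = 0, so both forms
  vanish and D^3 = D S D - D S' D = 0; being symmetric, D is then 0. *)
Lemma psd_root_unique M S S' : is_psd_root M S -> is_psd_root M S' ->
  S *m S' = S' *m S -> S = S'.
Proof.
move=> [Ss S0 SM] [Ss' S0' SM'] SS.
pose D := S - S'.
have Ds : D^T = D by rewrite /D linearB /= Ss Ss'.
have DC : D *m (S + S') = 0.
  rewrite mulmxDr !mulmxBl SM SM' SS; move: (S' *m S) => U.
  by apply/matrixP => i j; rewrite !mxE; ring.
have DSv v : qform (D *m S *m D) v = 0 /\ qform (D *m S' *m D) v = 0.
  have : qform (D *m S *m D) v + qform (D *m S' *m D) v = 0.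
    by rewrite -qformD -mulmxDl -mulmxDr DC mul0mx /qform mulmx0 mul0mx mxE.
  rewrite !qform_sandwich//; have := S0 (D *m v); have := S0' (D *m v).
  by move=> ? ? ?; split; lra.
have DDD : D *m D *m D = 0.
  apply: sym_form_eq0; first by rewrite !trmx_mul !Ds mulmxA.
  move=> v; have [h1 h2] := DSv v.
  have -> : D *m D *m D = D *m S *m D - D *m S' *m D by rewrite -mulmxBl -mulmxBr.
  by rewrite qformB h1 h2 subr0.
have DD : D *m D = 0.
  apply: sym_form_eq0; first by rewrite !trmx_mul !Ds.
  move=> v; have : qform 1%:M (D *m D *m v) = 0.
    have DDs : (D *m D)^T = D *m D by rewrite trmx_mul Ds.
    by rewrite -qform_sandwich// mulmx1 !mulmxA DDD mul0mx /qform mulmx0 mul0mx mxE.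
  by move/qform1_eq0 => E; rewrite /qform -mulmxA E mulmx0 mxE.
have D0 : D = 0.
  apply: sym_form_eq0 => // v; have : qform 1%:M (D *m v) = 0.
    by rewrite -qform_sandwich// mulmx1 DD /qform mulmx0 mul0mx mxE.
  by move/qform1_eq0 => E; rewrite /qform -mulmxA E mulmx0 mxE.
by apply/eqP; rewrite -subr_eq0; apply/eqP.
Qed.

(** Any root commutes with M, hence with the limit of polynomials in M, to which
  uniqueness among commuting roots applies. *)
Lemma psd_sqrtE M L : M^T = M -> psd M -> mxcvg (root_iter (contraction M)) L ->
  psd_sqrt M = Num.sqrt (entry_sum M) *: (1%:M - L).
Proof.
move=> Ms M0 XL; have [L' [XL' rL LC]] := psd_root_exists Ms M0.
rewrite (mxcvg_unique XL XL'); apply: xget_unique => // S' rS.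
have [S's S'0 S'M] := rS.
symmetry; apply: (psd_root_unique rL rS).
have SM : S' *m M = M *m S' by rewrite -S'M mulmxA.
have := LC _ SM; rewrite -scalemxAl -scalemxAr mulmxBr mulmxBl mulmx1 mul1mx.
by move->.
Qed.

Lemma psd_sqrtP M : M^T = M -> psd M -> is_psd_root M (psd_sqrt M).
Proof.
move=> Ms M0; have [L [XL rL LC]] := psd_root_exists Ms M0.
by rewrite (psd_sqrtE Ms M0 XL).
Qed.

End SquareRoot.

Section Measurability.
Context d (Omega : measurableType d).

Definition mxmeasurable m n (A : Omega -> 'M[R]_(m, n)) :=
  forall i j, measurable_fun setT (fun w => A w i j).

Lemma mxmeasurable_cst m n (A : 'M[R]_(m, n)) : mxmeasurable (fun=> A).
Proof. by move=> i j; exact: measurable_cst. Qed.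

Lemma mxmeasurableD m n (A C : Omega -> 'M[R]_(m, n)) :
  mxmeasurable A -> mxmeasurable C -> mxmeasurable (fun w => A w + C w).
Proof.
by move=> mA mC i j; under eq_fun do rewrite mxE; exact: measurable_funD.
Qed.

Lemma mxmeasurableZ m n (c : Omega -> R) (A : Omega -> 'M[R]_(m, n)) :
  measurable_fun setT c -> mxmeasurable A -> mxmeasurable (fun w => c w *: A w).
Proof.
by move=> mc mA i j; under eq_fun do rewrite mxE; exact: measurable_funM.
Qed.

Lemma mxmeasurableB m n (A C : Omega -> 'M[R]_(m, n)) :
  mxmeasurable A -> mxmeasurable C -> mxmeasurable (fun w => A w - C w).
Proof.
by move=> mA mC i j; under eq_fun do rewrite !mxE; exact: measurable_funB.
Qed.

Lemma mxmeasurableM m n k (A : Omega -> 'M[R]_(m, n)) (C : Omega -> 'M[R]_(n, k)) :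
  mxmeasurable A -> mxmeasurable C -> mxmeasurable (fun w => A w *m C w).
Proof.
move=> mA mC i j; under eq_fun do rewrite mxE.
by apply: measurable_sum => l; exact: measurable_funM.
Qed.

Lemma mxmeasurable_tr m n (A : Omega -> 'M[R]_(m, n)) :
  mxmeasurable A -> mxmeasurable (fun w => (A w)^T).
Proof. by move=> mA i j; under eq_fun do rewrite mxE; exact: mA. Qed.

Lemma mxmeasurable_sum m n (I : Type) (s : seq I) (A : I -> Omega -> 'M[R]_(m, n)) :
  (forall i, mxmeasurable (A i)) -> mxmeasurable (fun w => \sum_(i <- s) A i w).
Proof.
move=> mA; elim: s => [|i s IH].
  by under eq_fun do rewrite big_nil; exact: mxmeasurable_cst.
under eq_fun do rewrite big_cons; exact: mxmeasurableD.
Qed.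

Lemma measurable_prod (I : Type) (s : seq I) (f : I -> Omega -> R) :
  (forall i, measurable_fun setT (f i)) ->
  measurable_fun setT (fun w => \prod_(i <- s) f i w).
Proof.
move=> mf; elim: s => [|i s IH].
  by under eq_fun do rewrite big_nil; exact: measurable_cst.
by under eq_fun do rewrite big_cons; exact: measurable_funM.
Qed.

Lemma measurable_det n (A : Omega -> 'M[R]_n) :
  mxmeasurable A -> measurable_fun setT (fun w => \det (A w)).
Proof.
move=> mA; rewrite /determinant; apply: measurable_sum => s.
apply: measurable_funM; first exact: measurable_cst.
by apply: measurable_prod => i; exact: mA.
Qed.

Lemma mxmeasurable_adj n (A : Omega -> 'M[R]_n) :
  mxmeasurable A -> mxmeasurable (fun w => \adj (A w)).
Proof.
move=> mA i j; under eq_fun do rewrite mxE /cofactor.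
apply: measurable_funM; first exact: measurable_cst.
by apply: measurable_det => k l; under eq_fun do rewrite !mxE; exact: mA.
Qed.

Lemma measurable_funV (f : Omega -> R) :
  measurable_fun setT f -> measurable_fun setT (fun w => (f w)^-1).
Proof.
move=> mf; have -> : (fun w => (f w)^-1) = (fun w => f w * ((f w ^+ 2) `^ (-1))).
  apply/funext => w; rewrite powR_inv1 ?sqr_ge0//.
  have [->|f0] := eqVneq (f w) 0; first by rewrite invr0 mul0r.
  by field.
apply: measurable_funM => //; apply: (measurableT_comp (measurable_powR _)).
exact: measurable_funX _ mf.
Qed.

Lemma measurable_fun_sqrt (f : Omega -> R) : (forall w, 0 <= f w) ->
  measurable_fun setT f -> measurable_fun setT (fun w => Num.sqrt (f w)).
Proof.
move=> f0 mf; have -> : (fun w => Num.sqrt (f w)) = (fun w => f w `^ 2^-1).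
  by apply/funext => w; rewrite powR12_sqrt.
exact: (measurableT_comp (measurable_powR _)).
Qed.

Lemma mxmeasurable_inv n (A : Omega -> 'M[R]_n) :
  mxmeasurable A -> mxmeasurable (fun w => invmx (A w)).
Proof.
move=> mA; have md := measurable_det mA.
have mz : measurable_fun setT (fun w => \det (A w) == 0).
  by apply: measurable_fun_eqr => //; exact: measurable_cst.
move=> i j.
have -> : (fun w => invmx (A w) i j) = (fun w => if \det (A w) == 0 then A w i j else
    (\det (A w))^-1 * \adj (A w) i j).
  apply/funext => w; rewrite /invmx unitmxE unitfE.
  by case: eqVneq => //= _; rewrite mxE.
apply: measurable_fun_ifT => //.
by apply: measurable_funM; [exact: measurable_funV|exact: mxmeasurable_adj].
Qed.

Lemma mxmeasurable_psd_sqrt n (M : Omega -> 'M[R]_n) : mxmeasurable M ->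
  (forall w, (M w)^T = M w) -> (forall w, psd (M w)) ->
  mxmeasurable (fun w => psd_sqrt (M w)).
Proof.
move=> mM Ms M0 i j.
have mr : measurable_fun setT (fun w => entry_sum (M w)).
  apply: measurable_funD; first exact: measurable_cst.
  apply: measurable_sum => k; apply: measurable_sum => l.
  by apply: measurableT_comp; [exact: normr_measurable|exact: mM].
have mB : mxmeasurable (fun w => contraction (M w)).
  apply: mxmeasurableB; first exact: mxmeasurable_cst.
  by apply: mxmeasurableZ => //; exact: measurable_funV.
have mX k : mxmeasurable (fun w => root_iter (contraction (M w)) k).
  elim: k => [|k IH] /=; first exact: mxmeasurable_cst.
  apply: mxmeasurableZ; first exact: measurable_cst.
  by apply: mxmeasurableD => //; exact: mxmeasurableM.
apply: (@measurable_fun_cvg _ _ _ setT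
  (fun k w => (Num.sqrt (entry_sum (M w)) *: (1%:M - root_iter (contraction (M w)) k)) i j)) => //.
  move=> k; apply: mxmeasurableZ.
    by apply: measurable_fun_sqrt => // w; apply: ltW; exact: entry_sum_gt0.
  by apply: mxmeasurableB => //; exact: mxmeasurable_cst.
move=> w _; have [L [XL _ _]] := psd_root_exists (Ms w) (M0 w).
rewrite (psd_sqrtE (Ms w) (M0 w) XL).
apply: mxcvgZ => // a b.
rewrite mxE [X in _ + X]mxE; under eq_fun do rewrite mxE [X in _ + X]mxE.
by apply: (@cvgB _ R^o); [exact: cvg_cst|exact: XL].
Qed.
End Measurability.

(** * Least squares and the detector *)

Section Coercive.
Variable q : nat.
Implicit Types (G : 'M[R]_q) (v w : 'cV[R]_q).

Local Notation nsq := (qform (1%:M : 'M[R]_q)).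

Lemma nsq_le_entries v (e : R) : (forall k, `|v k ord0| <= e) -> nsq v <= q%:R * e ^+ 2.
Proof.
move=> ve; rewrite qform1 mulrC -[q in q%:R]card_ord mulr_natr -sumr_const.
by apply: ler_sum => k _; exact: sqr_le_norm.
Qed.

Lemma nsq_triangle u v w : nsq (u + v + w) <= 3 * (nsq u + nsq v + nsq w).
Proof.
rewrite !qform1 -!big_split /= mulr_sumr; apply: ler_sum => k _; rewrite !mxE.
move: (u k ord0) (v k ord0) (w k ord0) => a b c.
have := sqr_ge0 (a - b); have := sqr_ge0 (a - c); have := sqr_ge0 (b - c); nra.
Qed.

Lemma nsqN v : nsq (- v) = nsq v.
Proof. by rewrite !qform1; apply: eq_bigr => k _; rewrite mxE sqrrN. Qed.

Lemma nsq_gt0 v : v != 0 -> 0 < nsq v.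
Proof.
by move=> v0; rewrite lt_def psd1 andbT; apply: contra v0 => /eqP/qform1_eq0 ->.
Qed.

Lemma coercive_unit G (k : R) : 0 < k -> (forall v, k * nsq v <= qform G v) -> G \in unitmx.
Proof.
move=> k0 Gk; rewrite -row_free_unit; apply/inj_row_free => v vG.
have /qform1_eq0 E : nsq v^T = 0.
  apply/eqP; rewrite eq_le psd1 andbT -(pmulr_rle0 _ k0).
  by apply: le_trans (Gk _) _; rewrite /qform trmxK vG mul0mx mxE.
by rewrite -[v]trmxK E trmx0.
Qed.

(** The error u solves G u = r for the score r, so that
  k |u|^2 <= u^T G u = u^T r, and Young's inequality concludes. *)
Lemma coercive_solve G (k e : R) (m th : 'cV[R]_q) : 0 < k ->
  (forall v, k * nsq v <= qform G v) -> (forall i, `|(m - G *m th) i ord0| <= e) ->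
  nsq (invmx G *m m - th) <= q%:R * (e / k) ^+ 2.
Proof.
move=> k0 Gk re; have Gu := coercive_unit k0 Gk.
set r := m - G *m th in re; set u := _ - th.
have Gur : G *m u = r by rewrite /u mulmxBr mulmxA mulmxV// mul1mx.
have uG : qform G u = \sum_i u i ord0 * r i ord0.
  by rewrite /qform -mulmxA Gur mxE; apply: eq_bigr => i _; rewrite mxE.
have young : \sum_i u i ord0 * r i ord0 <= 2^-1 * (k * nsq u + k^-1 * nsq r).
  rewrite !qform1 !mulr_sumr -big_split /= mulr_sumr; apply: ler_sum => i _.
  move: (u i ord0) (r i ord0) => a b.
  have -> : 2^-1 * (k * a ^+ 2 + k^-1 * b ^+ 2) = a * b + 2^-1 * k * (a - k^-1 * b) ^+ 2.
    by field; rewrite gt_eqF.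
  by rewrite lerDl mulr_ge0 ?sqr_ge0// mulr_ge0 ?invr_ge0// ltW.
have H : k * nsq u <= k^-1 * nsq r by have := Gk u; rewrite uG; lra.
have H2 : nsq u * k ^+ 2 <= nsq r.
  by rewrite expr2 mulrA -ler_pdivlMr// mulrC [leRHS]mulrC.
rewrite exprMn exprVn mulrA ler_pdivlMr ?exprn_gt0//.
exact: le_trans (nsq_le_entries re).
Qed.

Lemma nsq_le_norm v : nsq v <= q%:R * `|v| ^+ 2.
Proof.
by apply: nsq_le_entries => k; exact: component_le_norm.
Qed.

End Coercive.

Section LeastSquares.
Variables (p : nat) (D : R) (f : nat -> 'cV[R]_p) (x : nat -> R).
Hypothesis D0 : 0 < D.

Local Notation q := (p + 1)%N.
Local Notation nsq := (qform (1%:M : 'M[R]_q)).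

Definition theta (th : 'cV[R]_p * R) : 'cV[R]_q := col_mx th.1 th.2%:M.

Definition regressor i : 'cV[R]_q := col_mx (f i) (- x i)%:M.

Definition gram n : 'M[R]_q := \sum_(i < n) D *: (regressor i *m (regressor i)^T).

Definition moment n : 'cV[R]_q := \sum_(i < n) (x i.+1 - x i) *: regressor i.

Definition score (th : 'cV[R]_p * R) n : 'cV[R]_q :=
  \sum_(i < n) residual th.2 D f x th.1 i *: regressor i.

(** The normal equations, in terms of the one-step prediction errors. *)
Lemma moment_score th n : moment n - gram n *m theta th = score th n.
Proof.
rewrite /moment /gram mulmx_suml -sumrB; apply: eq_bigr => i _.
have -> : (D *: (regressor i *m (regressor i)^T)) *m theta th =
    (D * ((th.1^T *m f i) ord0 ord0 - th.2 * x i)) *: regressor i.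
  rewrite -scalemxAl -mulmxA.
  have -> : (regressor i)^T *m theta th = (((th.1^T *m f i) ord0 ord0 - th.2 * x i))%:M.
    rewrite /regressor /theta tr_col_mx mul_row_col [LHS]mx11_scalar mxE; congr (_%:M).
    congr (_ + _).
      by rewrite !mxE; apply: eq_bigr => j _; rewrite !mxE mulrC.
    by rewrite tr_scalar_mx -scalar_mxM mxE mulr1n; ring.
  by rewrite mul_mx_scalar scalerA.
by rewrite -scalerBl.
Qed.

Lemma qform_gram n v : qform (gram n) v =
  D * \sum_(i < n) (\sum_j v (lshift 1 j) ord0 * f i j ord0 - v (rshift p ord0) ord0 * x i) ^+ 2.
Proof.
rewrite /gram /qform mulmx_sumr mulmx_suml summxE mulr_sumr; apply: eq_bigr => i _.
rewrite -scalemxAr -scalemxAl mxE; congr (_ * _).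
rewrite -!mulmxA mulmxA [LHS]mxE big_ord1 expr2.
have E : (v^T *m regressor i) ord0 ord0 =
    \sum_j v (lshift 1 j) ord0 * f i j ord0 - v (rshift p ord0) ord0 * x i.
  rewrite mxE big_split_ord /=; congr (_ + _).
    by apply: eq_bigr => j _; rewrite mxE col_mxEu.
  by rewrite big_ord1 mxE col_mxEd mxE mulr1n; ring.
by rewrite -[(regressor i)^T *m v]trmxK trmx_mul trmxK [X in _ * X]mxE E.
Qed.

Lemma nsq_split (v : 'cV[R]_q) :
  nsq v = \sum_j v (lshift 1 j) ord0 ^+ 2 + v (rshift p ord0) ord0 ^+ 2.
Proof. by rewrite qform1 big_split_ord /= big_ord1. Qed.

Variables (c eps : R) (th : 'cV[R]_p * R) (n : nat).
Hypothesis good : phase_good c eps D th.2 n th.1 f x.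

Lemma gram_coercive v : c * (n%:R * D) * nsq v <= qform (gram n) v.
Proof.
by rewrite nsq_split qform_gram; exact: (phase_gram good (fun j => v (lshift 1 j) ord0)).
Qed.

Lemma score_small k : `|score th n k ord0| <= eps * (n%:R * D).
Proof.
rewrite summxE -[k]splitK; case: (fintype.split k) => l /=.
  rewrite (eq_bigr (fun i : 'I_n => f i l ord0 * residual th.2 D f x th.1 i)).
    exact: (phase_score_f good).
  by move=> i _; rewrite mxE col_mxEu mulrC.
rewrite (eq_bigr (fun i : 'I_n => - (x i * residual th.2 D f x th.1 i))).
  by rewrite sumrN normrN; exact: (phase_score_x good).
by move=> i _; rewrite mxE col_mxEd mxE (ord1 l) mulr1n mulrC mulNr.
Qed.

End LeastSquares.

Section Concatenation.
Variables (p : nat) (D : R) (f : nat -> 'cV[R]_p) (x : nat -> R) (m n : nat).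

Lemma gram_cat : gram D f x (m + n) =
  gram D f x m + gram D (fun i => f (m + i)%N) (fun i => x (m + i)%N) n.
Proof. by rewrite /gram big_split_ord. Qed.

Lemma score_cat th : score D f x th (m + n) =
  score D f x th m + score D (fun i => f (m + i)%N) (fun i => x (m + i)%N) th n.
Proof.
rewrite /score big_split_ord; congr (_ + _); apply: eq_bigr => i _.
by rewrite /residual /= -(addnS m i).
Qed.

End Concatenation.

Section Detector.
Variables (p : nat) (phi : R -> 'cV[R]_p) (delta T : R) (x : R -> R).
Hypotheses (T0 : 0 < T) (N0 : (0 < nobs delta T)%N).

Local Notation q := (p + 1)%N.
Local Notation nsq := (qform (1%:M : 'M[R]_q)).
Local Notation N := (nobs delta T).
Local Notation D := (mesh delta T).
Local Notation f := (fun i => phi (grid delta T i)).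
Local Notation xs := (fun i => x (grid delta T i)).

Lemma mesh_gt0 : 0 < D.
Proof. by rewrite divr_gt0// ltr0n. Qed.

Lemma nobs_mesh : N%:R * D = T.
Proof. by rewrite /mesh mulrCA divff ?mulr1// pnatr_eq0 -lt0n. Qed.

Lemma ZobsE i : Zobs phi delta T x i.+1 = Num.sqrt D *: regressor f xs i.
Proof. by []. Qed.

Lemma Zobs_outer i : Zobs phi delta T x i.+1 *m (Zobs phi delta T x i.+1)^T =
  D *: (regressor f xs i *m (regressor f xs i)^T).
Proof.
rewrite ZobsE linearZ /= -scalemxAl -scalemxAr scalerA -expr2 sqr_sqrtr//.
exact: ltW mesh_gt0.
Qed.

Lemma lseE n : lse phi delta T x n = invmx (gram D f xs n) *m moment f xs n.
Proof.
rewrite /lse; congr (invmx _ *m _); rewrite big_add1 big_mkord; apply: eq_bigr => i _.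
  exact: Zobs_outer.
rewrite ZobsE /Yobs scalerA divfK//.
by rewrite gt_eqF// sqrtr_gt0 mesh_gt0.
Qed.

Lemma ZmatE : (Zmat phi delta T x)^T *m Zmat phi delta T x = gram D f xs N.
Proof.
rewrite /gram; under eq_bigr do rewrite -Zobs_outer.
apply/matrixP => k l; rewrite mxE summxE; apply: eq_bigr => i _.
by rewrite !mxE big_ord1 !mxE.
Qed.

Lemma Zgram_sym : (T^-1 *: ((Zmat phi delta T x)^T *m Zmat phi delta T x))^T =
  T^-1 *: ((Zmat phi delta T x)^T *m Zmat phi delta T x).
Proof. by rewrite linearZ /= trmx_mul trmxK. Qed.

Lemma Zgram_psd : psd (T^-1 *: ((Zmat phi delta T x)^T *m Zmat phi delta T x)).
Proof.
move=> v; rewrite qformZ ZmatE qform_gram mulr_ge0 ?invr_ge0 ?(ltW T0)//.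
by rewrite mulr_ge0 ?(ltW mesh_gt0)// sumr_ge0// => i _; exact: sqr_ge0.
Qed.

(** The square root in the detector turns its squared Euclidean norm into the Gram
  form of the difference of the two estimates. *)
Lemma detector_nsq K : nsq (detector phi delta T x K) =
  qform (gram D f xs N) (lse phi delta T x (N + K) - lse phi delta T x N).
Proof.
rewrite /detector; have [] := psd_sqrtP Zgram_sym Zgram_psd.
set S := psd_sqrt _; move=> Ss _ SS; set u := _ - _.
have E : nsq (Num.sqrt T *: (S *m u)) = T * nsq (S *m u).
  rewrite !qform1 mulr_sumr; apply: eq_bigr => i _.
  by rewrite mxE exprMn sqr_sqrtr// ltW.
rewrite E -qform_sandwich// mulmx1 SS qformZ mulrA divff ?mul1r ?ZmatE//.
by rewrite gt_eqF.
Qed.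

(** Both estimates are within a twelfth of the squared distance of their targets,
  so their difference keeps a sixth of it, and the Gram form on N observations is at
  least c0 T. The last premise on the score bounds what the first m observations,
  governed partly by th0, contribute to the score of th1. *)
Lemma detector_large (th0 th1 : 'cV[R]_p * R) (c0 c1 eps : R) (K m n : nat) :
  0 < c0 -> 0 < c1 -> 0 < eps -> (0 < n)%N -> (N + K = m + n)%N ->
  phase_good c0 eps D th0.2 N th0.1 f xs ->
  phase_good c1 eps D th1.2 n th1.1 (fun i => f (m + i)%N) (fun i => xs (m + i)%N) ->
  (forall k, `|score D f xs th1 m k ord0| <= eps * (n%:R * D)) ->
  q%:R * (eps / c0) ^+ 2 <= nsq (theta th1 - theta th0) / 12 ->
  q%:R * (2 * eps / c1) ^+ 2 <= nsq (theta th1 - theta th0) / 12 ->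
  c0 * T * (nsq (theta th1 - theta th0) / 6) <= q%:R * `|detector phi delta T x K| ^+ 2.
Proof.
move=> c00 c10 eps0 n0 NK g0 g1 Fm e0 e1.
apply: le_trans (nsq_le_norm _); rewrite detector_nsq.
have := gram_coercive g0; rewrite nobs_mesh => cG; apply: le_trans (cG _).
have nD : 0 < n%:R * D by rewrite mulr_gt0 ?mesh_gt0 ?ltr0n.
rewrite ler_pM2l ?mulr_gt0//.
set u := lse _ _ _ _ _ - lse _ _ _ _ _; set u1 := lse phi delta T x N - theta th0.
set u2 := lse phi delta T x (N + K) - theta th1.
have h1 : nsq u1 <= nsq (theta th1 - theta th0) / 12.
  apply: le_trans e0; rewrite /u1 lseE.
  have -> : eps / c0 = (eps * T) / (c0 * T) by field; rewrite !gt_eqF.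
  apply: coercive_solve => //; first exact: mulr_gt0.
  by move=> k; rewrite moment_score; have := score_small g0 k; rewrite nobs_mesh.
have h2 : nsq u2 <= nsq (theta th1 - theta th0) / 12.
  apply: le_trans e1; rewrite /u2 lseE NK.
  have -> : 2 * eps / c1 = (2 * eps * (n%:R * D)) / (c1 * (n%:R * D)).
    by field; rewrite !gt_eqF ?mesh_gt0 ?ltr0n.
  apply: coercive_solve => //; first exact: mulr_gt0.
    move=> v; rewrite gram_cat qformD.
    apply: le_trans (gram_coercive g1 v) _; rewrite lerDr qform_gram.
    by rewrite mulr_ge0 ?(ltW mesh_gt0)// sumr_ge0// => i _; exact: sqr_ge0.
  move=> k; rewrite moment_score score_cat mxE; apply: le_trans (ler_normD _ _) _.
  by have := Fm k; have := score_small g1 k; lra.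
have := nsq_triangle u u1 (- u2).
have -> : u + u1 - u2 = theta th1 - theta th0.
  rewrite /u /u1 /u2; move: (lse phi delta T x (N + K)) (lse phi delta T x N) => a b.
  move: (theta th1) (theta th0) => t1 t0; apply/matrixP => i j; rewrite !mxE; ring.
rewrite nsqN; lra.
Qed.

End Detector.

Lemma ell_gt0_le1 (gamma s : R) : 0 <= gamma -> 0 < s -> 0 < ell gamma s <= 1.
Proof.
move=> g0 s0; have s1 : 0 < 1 + s by rewrite addr_gt0.
rewrite /ell powR_gt0 ?divr_gt0//=.
apply: (@le_trans _ _ (1 `^ gamma)); last by rewrite powR1.
apply: ge0_ler_powR => //.
- by rewrite nnegrE; apply: divr_ge0; exact: ltW.
- by rewrite nnegrE ler01.
- by rewrite ler_pdivrMr// mul1r lerDr.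
Qed.

Lemma theta_inj p (th th' : 'cV[R]_p * R) : theta th = theta th' -> th = th'.
Proof.
case: th th' => [mu a] [mu' a'] /eq_col_mx[/= -> /matrixP/(_ ord0 ord0)].
by rewrite !mxE !mulr1n => ->.
Qed.

(** * Tightness and measurability of the detection events *)

Section Tightness.
Context d (Omega : measurableType d) (P : probability Omega R).

Lemma measurable_ge (f : Omega -> R) (c : R) :
  measurable_fun setT f -> measurable [set w | c <= f w].
Proof.
move=> mf; have := measurable_fun_ler (measurable_cst c) mf measurableT (Y := [set true]).
by rewrite setTI; apply.
Qed.

(** The events k < |f| decrease to the empty set. *)
Lemma whp_tight (f : Omega -> R) (eta : R) : measurable_fun setT f -> 0 < eta ->
  exists2 C : R, 0 < C & whp P eta (fun w => `|f w| <= C).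
Proof.
move=> mf eta0; pose A (k : nat) := [set w | k.+1%:R < `|f w|].
have mA k : measurable (A k).
  by apply: measurable_gt; apply: measurableT_comp => //; exact: normr_measurable.
have A0 : \bigcap_k A k = set0.
  apply/seteqP; split => // w Aw.
  have := Aw (Num.bound `|f w|) I; rewrite /A /= ltNge => /negP; apply.
  apply: le_trans (ltW (archi_boundP (normr_ge0 (f w)))) _.
  by rewrite ler_nat.
have := @nonincreasing_cvg_mu _ _ _ P A.
rewrite A0 measure0 => /(_ _ _ _ _)/fine_cvgP[||||].
- by rewrite (le_lt_trans (probability_le1 _ _))// ltry.
- exact: mA.
- exact: measurable0.
- move=> i j ij; apply/subsetPset => w; rewrite /A /=; apply: le_lt_trans.
  by rewrite ler_nat.
move=> fnA /(@cvgrPdist_lt _ R^o)/(_ eta eta0) Ae.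
near \oo => k.
exists k.+1%:R; first by rewrite ltr0n.
exists (A k); split => //; last by move=> w /negP; rewrite -leNgt.
have fk : P (A k) \is a fin_num by near: k; exact: fnA.
rewrite -(fineK fk) lee_fin.
have : `|0 - fine (P (A k))| < eta by near: k; exact: Ae.
by rewrite sub0r normrN => /ltW; apply: le_trans; exact: ler_norm.
Unshelve. all: by end_near. Qed.

End Tightness.

Section Events.
Context d (Omega : measurableType d).
Context (p : nat) (phi : R -> 'cV[R]_p) (gamma delta T : R) (X : R -> Omega -> R).
Hypotheses (T0 : 0 < T) (N0 : (0 < nobs delta T)%N).
Hypothesis mX : forall t, measurable_fun setT (X t).

Local Notation det K := (fun w => `|detector phi delta T (X ^~ w) K|).

Lemma mxmeasurable_regressor f (x : nat -> Omega -> R) i :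
  measurable_fun setT (x i) -> mxmeasurable (fun w => @regressor p f (x ^~ w) i).
Proof.
move=> mx k l; rewrite -[k]splitK; case: (fintype.split k) => j /=.
  by under eq_fun do rewrite col_mxEu; exact: measurable_cst.
have -> : (fun w => regressor f (x ^~ w) i (rshift p j) l) = (fun w => - x i w).
  by apply/funext => w; rewrite col_mxEd mxE (ord1 l) (ord1 j) mulr1n.
by apply: measurableT_comp => //; exact: mx.
Qed.

Lemma mxmeasurable_gram D f (x : nat -> Omega -> R) n :
  (forall i, measurable_fun setT (x i)) -> mxmeasurable (fun w => @gram p D f (x ^~ w) n).
Proof.
move=> mx; apply: mxmeasurable_sum => i; apply: mxmeasurableZ; first exact: measurable_cst.
have := mxmeasurable_regressor f (mx i) => h.
by apply: mxmeasurableM => //; exact: mxmeasurable_tr.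
Qed.

Lemma mxmeasurable_lse n : mxmeasurable (fun w => lse phi delta T (X ^~ w) n).
Proof.
have -> : (fun w => lse phi delta T (X ^~ w) n) = (fun w =>
    invmx (gram (mesh delta T) (fun i => phi (grid delta T i)) (fun i => X (grid delta T i) w) n) *m
    moment (fun i => phi (grid delta T i)) (fun i => X (grid delta T i) w) n).
  by apply/funext => w; rewrite lseE.
apply: mxmeasurableM; first by apply: mxmeasurable_inv; exact: (@mxmeasurable_gram _ _ (fun i w => X _ w)).
apply: mxmeasurable_sum => i; apply: mxmeasurableZ; first exact: measurable_funB.
exact: (@mxmeasurable_regressor _ (fun i w => X _ w)).
Qed.

Lemma mxmeasurable_score D f (x : nat -> Omega -> R) th n :
  (forall i, measurable_fun setT (x i)) -> mxmeasurable (fun w => @score p D f (x ^~ w) th n).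
Proof.
move=> mx; apply: mxmeasurable_sum => i.
apply: mxmeasurableZ; last exact: mxmeasurable_regressor.
rewrite /residual; apply: measurable_funB; first exact: measurable_funB.
apply: measurable_funM; first exact: measurable_cst.
by apply: measurable_funB; [exact: measurable_cst|apply: measurable_funM => //; exact: measurable_cst].
Qed.

Lemma measurable_mxnorm m n (A : Omega -> 'M[R]_(m, n)) :
  mxmeasurable A -> measurable_fun setT (fun w => `|A w|).
Proof.
move=> mA.
have -> : (fun w => `|A w|) = (fun w => \big[Order.max/0]_(ij : 'I_m * 'I_n) `|A w ij.1 ij.2|).
  by apply/funext => w; exact: (mx_normrE (A w)).
elim: (index_enum _) => [|ij s IH].
  by under eq_fun do rewrite big_nil; exact: measurable_cst.
have -> : (fun w => \big[Order.max/0]_(k <- ij :: s) `|A w k.1 k.2|) =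
    (fun w => Order.max `|A w ij.1 ij.2| (\big[Order.max/0]_(k <- s) `|A w k.1 k.2|)).
  by apply/funext => w; rewrite big_cons.
apply: measurable_maxr => //.
by apply: measurableT_comp; [exact: normr_measurable|exact: mA].
Qed.

Lemma measurable_detector K : measurable_fun setT (det K).
Proof.
apply: measurable_mxnorm; apply: mxmeasurableZ; first exact: measurable_cst.
apply: mxmeasurableM; last by apply: mxmeasurableB; exact: mxmeasurable_lse.
apply: mxmeasurable_psd_sqrt => [|w|w].
- apply: mxmeasurableZ; first exact: measurable_cst.
  under eq_fun do rewrite ZmatE//.
  exact: (@mxmeasurable_gram _ _ (fun i w => X _ w)).
- exact: Zgram_sym.
- exact: Zgram_psd.
Qed.

Lemma sup_statistic_gt (M : R) x :
  (M%:E < sup_statistic phi gamma delta T x)%E <->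
  exists2 K, (1 <= K)%N & M < `|detector phi delta T x K| / ell gamma (K%:R / (nobs delta T)%:R).
Proof.
split=> [|[K K1 MK]].
  by move=> /ereal_sup_gt[_ [K K1 <-]]; rewrite lte_fin; exists K.
apply: (@lt_le_trans _ _ (`|detector phi delta T x K| / ell gamma (K%:R / (nobs delta T)%:R))%:E).
  by rewrite lte_fin.
by apply: ereal_sup_ubound; exists K.
Qed.

Lemma stopping_time_lty (c : R) x :
  (stopping_time phi gamma delta c T x < +oo)%E <->
  exists2 K, (1 <= K)%N & c * ell gamma (K%:R / (nobs delta T)%:R) <= `|detector phi delta T x K|.
Proof.
split=> [|[K K1 MK]].
  by move=> /ereal_inf_lt[_ [K [K1 cK] <-] _]; exists K.
apply: (@le_lt_trans _ _ (K%:R)%:E); last exact: ltry.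
by apply: ereal_inf_lbound; exists K.
Qed.

Lemma measurable_sup_statistic (M : R) :
  measurable [set w | (M%:E < sup_statistic phi gamma delta T (X ^~ w))%E].
Proof.
have -> : [set w | (M%:E < sup_statistic phi gamma delta T (X ^~ w))%E] =
    \bigcup_(K in [set K | (1 <= K)%N])
      [set w | M < `|detector phi delta T (X ^~ w) K| / ell gamma (K%:R / (nobs delta T)%:R)].
  by apply/seteqP; split=> w; [move=> /sup_statistic_gt[K]; exists K|
    move=> [K K1 MK]; apply/sup_statistic_gt; exists K].
apply: bigcup_measurable => K _; apply: measurable_gt.
by apply: measurable_funM; [exact: measurable_detector|exact: measurable_cst].
Qed.

Lemma measurable_stopping_time (c : R) :
  measurable [set w | (stopping_time phi gamma delta c T (X ^~ w) < +oo)%E].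
Proof.
have -> : [set w | (stopping_time phi gamma delta c T (X ^~ w) < +oo)%E] =
    \bigcup_(K in [set K | (1 <= K)%N])
      [set w | c * ell gamma (K%:R / (nobs delta T)%:R) <= `|detector phi delta T (X ^~ w) K|].
  by apply/seteqP; split=> w; [move=> /stopping_time_lty[K]; exists K|
    move=> [K K1 MK]; apply/stopping_time_lty; exists K].
by apply: bigcup_measurable => K _; apply: measurable_ge; exact: measurable_detector.
Qed.

End Events.

Lemma probability_cvg1 d (Omega : measurableType d) (P : probability Omega R)
    (E : R -> set Omega) :
  (\forall T \near +oo, measurable (E T)) ->
  (forall eta : R, 0 < eta -> \forall T \near +oo, whp P eta (E T)) ->
  P (E T) @[T --> +oo] --> 1%E.
Proof.
move=> mE H; apply: cvg_EFin.
  by apply: filterS mE => T mET; exact: fin_num_measure.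
apply/(@cvgrPdist_le _ R^o) => eta eta0.
near=> T.
have mET : measurable (E T) by near: T.
have := whp_prob mET (near (H _ eta0) T _).
have fin := fin_num_measure P _ mET.
rewrite -[X in (_ <= X)%E](fineK fin) lee_fin => h.
have le1 : fine (P (E T)) <= 1.
  by rewrite -lee_fin fineK//; exact: probability_le1.
by rewrite /= ger0_norm ?subr_ge0// lerBlDr addrC -lerBlDr h.
Unshelve. all: by end_near. Qed.

(** * Detection of the change *)

Lemma le_add3 (u v w y : R) : 0 <= u -> 0 <= v -> 0 <= w -> u + v + w <= y ->
  [/\ u <= y, v <= y & w <= y].
Proof. by move=> *; split; lra. Qed.

Lemma tick_grid0 delta T : tick 0 (mesh delta T) = grid delta T.
Proof. by apply/funext => i; rewrite /tick /grid add0r. Qed.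

Lemma tick_grid delta T m i :
  tick (grid delta T m) (mesh delta T) i = grid delta T (m + i).
Proof. by rewrite /tick /grid natrD; symmetry; exact: mulrDl. Qed.

Lemma gridS delta T i : grid delta T i.+1 = grid delta T i + mesh delta T.
Proof.
rewrite /grid -natr1; apply: etrans (mulrDl _ _ _) _.
by congr (_ + _); exact: mul1r.
Qed.

Lemma nobs_gt0 (delta T : R) : 0 <= delta -> 1 <= T -> (0 < nobs delta T)%N.
Proof.
move=> d0 T1; rewrite /nobs truncn_gt0.
apply: (@le_trans _ _ (T `^ 0)); first by rewrite powRr0.
exact: ler_powR.
Qed.

Lemma modulus_bound p (phi : R -> 'cV[R]_p) (delta : R) : 0 <= delta -> assumption4 phi delta ->
  exists2 CM : R, 0 <= CM & \forall T \near +oo, forall i,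
    riemann (fun s => `|phi s - phi (grid delta T i)|) (grid delta T i) (grid delta T i + mesh delta T)
      <= CM * mesh delta T * Num.sqrt (mesh delta T).
Proof.
move=> d0 [C HC]; exists (Num.max C 0); first by rewrite le_max lexx orbT.
near=> T => i.
have T1 : 1 <= T by near: T; exact: (nbhs_pinfty_ge (num_real _)).
have D0 : 0 < mesh delta T by apply: mesh_gt0; [exact: lt_le_trans T1|exact: nobs_gt0].
have : (phi_modulus phi delta T <= (C * Num.sqrt (mesh delta T))%:E)%E by near: T.
move=> /(le_trans (ereal_sup_ubound _)) - /(_ ((mesh delta T)^-1 *
   riemann (fun s => `|phi s - phi (grid delta T i)|) (grid delta T i) (grid delta T i.+1))%:E).
rewrite lee_fin -gridS => h.
have {}h := h (ex_intro2 _ _ i.+1 isT erefl).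
rewrite ler_pdivrMl// in h; apply: le_trans h _.
rewrite mulrA [_ * C]mulrC; apply: ler_wpM2r; first exact: sqrtr_ge0.
by apply: ler_wpM2r; [exact: ltW|rewrite le_max lexx].
Unshelve. all: by end_near. Qed.

Lemma solves_on_sub p (phi : R -> 'cV[R]_p) th sg (I J : set R) x b :
  I `<=` J -> solves_on phi th sg J x b -> solves_on phi th sg I x b.
Proof. by move=> IJ sol s t Is It; apply: sol; exact: IJ. Qed.

Section Detection.
Context d (Omega : measurableType d) (P : probability Omega R).
Context (p : nat) (phi : R -> 'cV[R]_p) (sigma : R) (sigma_gt0 : 0 < sigma).
Context (th0 th1 : 'cV[R]_p * R) (a0_gt0 : 0 < th0.2) (a1_gt0 : 0 < th1.2).
Context (gamma delta : R) (Kstar : R -> nat).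
Context (X0 : {RV P >-> R}) (B : R -> {RV P >-> R}) (X : R -> R -> {RV P >-> R}).
Hypotheses (hB : brownian_motion B) (A2 : assumption2 phi).
Hypotheses (A3 : assumption3 gamma delta) (A4 : assumption4 phi delta).
Hypothesis H1 : alternative_H1 phi delta sigma th0 th1 Kstar X0 B X.

Local Notation q := (p + 1)%N.

(** The order of the choices matters: eps is fixed by the distance of the two
  parameters, then T is taken large; only then n is chosen, so large that X at the
  time of change and the score of the earlier observations, which depend on T, are
  negligible against n times the mesh. *)
Lemma change_detected (M eta : R) : 0 < eta -> \forall T \near +oo,
  exists2 K, (1 <= K)%N &
    whp P eta (fun w => M < `|detector phi delta T (fun t => X T t w) K|).
Proof.
move=> eta0.
have dge0 : 0 <= delta by apply: le_trans (ltW (delta_gt A3)).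
have [CM CM0 HCM] := modulus_bound dge0 A4.
have [c0 c00 est0] := @phase_estimates _ _ _ _ hB _ _ A2 th0 sigma CM a0_gt0 sigma_gt0 CM0.
have [c1 c10 est1] := @phase_estimates _ _ _ _ hB _ _ A2 th1 sigma CM a1_gt0 sigma_gt0 CM0.
set dl := qform (1%:M : 'M[R]_q) (theta th1 - theta th0).
have dl0 : 0 < dl.
  apply: nsq_gt0; rewrite subr_eq0; apply/eqP => /theta_inj; exact: (H1_change H1).
have q0 : 0 < q%:R :> R by rewrite ltr0n addn1.
pose kp := Num.sqrt (dl / 12 / q%:R).
have kp0 : 0 < kp by rewrite sqrtr_gt0 !divr_gt0.
have kpE : q%:R * kp ^+ 2 = dl / 12.
  by rewrite sqr_sqrtr ?divr_ge0 ?ltW// mulrC divfK// gt_eqF.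
pose eps := Num.min (kp * c0) (kp * c1 / 2).
have eps0 : 0 < eps by rewrite lt_min (mulr_gt0 kp0 c00) (divr_gt0 (mulr_gt0 kp0 c10)).
have sq_le u : 0 <= u -> u <= kp -> q%:R * u ^+ 2 <= dl / 12.
  move=> u0 uk; rewrite -kpE; apply: ler_wpM2l; first exact: ltW.
  by rewrite ler_pXn2r// nnegrE ltW.
have e0 : q%:R * (eps / c0) ^+ 2 <= dl / 12.
  apply: sq_le; first by rewrite divr_ge0 ?ltW.
  by rewrite ler_pdivrMr// ge_min lexx.
have e1 : q%:R * (2 * eps / c1) ^+ 2 <= dl / 12.
  apply: sq_le; first by rewrite divr_ge0 ?mulr_ge0 ?(ltW eps0) ?(ltW c10).
  by rewrite ler_pdivrMr// mulrC -ler_pdivlMr// ge_min lexx orbT.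
pose e := eta / 5.
have ee0 : 0 < e by rewrite divr_gt0.
have [S0 [D0 [kap0 [S00 D00 kap00 ph0]]]] := est0 eps e eps0 ee0.
have [S1 [D1 [kap1 [S10 D10 kap10 ph1]]]] := est1 eps e eps0 ee0.
have mX0 : measurable_fun setT X0 by exact: measurable_funPT.
have meshe (r : R) : 0 < r -> \forall t \near +oo, mesh delta t <= r.
  move=> r0; have := mesh_cvg0 A3 => /(@cvgrPdist_le _ R^o)/(_ _ r0).
  by apply: filterS => t; rewrite sub0r normrN; apply: le_trans; exact: ler_norm.
have [C0 C00 wX0] := @whp_tight _ _ P _ _ mX0 ee0.
near=> T.
have T1 : 1 <= T by near: T; exact: (nbhs_pinfty_ge (num_real _)).
have T0 : 0 < T by exact: lt_le_trans T1.
have TS : S0 <= T by near: T; exact: (nbhs_pinfty_ge (num_real _)).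
have TC : C0 ^+ 2 / kap0 <= T by near: T; exact: (nbhs_pinfty_ge (num_real _)).
have TM : q%:R * M ^+ 2 / (c0 * (dl / 6)) < T by near: T; exact: (nbhs_pinfty_gt (num_real _)).
have md : forall i, riemann (fun s => `|phi s - phi (grid delta T i)|) (grid delta T i)
    (grid delta T i + mesh delta T) <= CM * mesh delta T * Num.sqrt (mesh delta T).
  by near: T; exact: HCM.
have DD0 : mesh delta T <= D0 by near: T; exact: meshe.
have DD1 : mesh delta T <= D1 by near: T; exact: meshe.
have N0 : (0 < nobs delta T)%N by exact: nobs_gt0.
have D_gt0 := mesh_gt0 T0 N0.
have ND : (nobs delta T)%:R * mesh delta T = T by exact: nobs_mesh.
set D := mesh delta T in D_gt0 DD0 DD1 md ND *.
set N := nobs delta T in N0 ND *.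
pose m := (N + Kstar T)%N.
pose Xf (t : R) (w : Omega) := X T t w.
have mX t : measurable_fun setT (Xf t) by exact: measurable_funPT.
have [C1 C10 wX1] := @whp_tight _ _ P _ _ (mX (grid delta T m)) ee0.
pose F w := score D (fun i => phi (grid delta T i)) (fun i => X T (grid delta T i) w) th1 m.
have mF : measurable_fun setT (fun w => `|F w|).
  by apply: measurable_mxnorm; exact: (@mxmeasurable_score _ _ _ D _ (fun i w => X T _ w)).
have [C2 C20 wF] := @whp_tight _ _ P _ _ mF ee0.
(* L bounds what n times the mesh must exceed in the second stretch *)
pose L := S1 + C1 ^+ 2 / kap1 + C2 / eps.
have L0 : 0 <= L by rewrite /L !addr_ge0 ?divr_ge0 ?sqr_ge0// ltW.
pose n := (Num.bound (L / D)).+1.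
have nL : L <= n%:R * D.
  rewrite -ler_pdivrMr//; apply: le_trans (ltW (archi_boundP _)) _.
    by rewrite divr_ge0// ltW.
  by rewrite ler_nat.
have L3 : [/\ S1 <= n%:R * D, C1 ^+ 2 / kap1 <= n%:R * D & C2 / eps <= n%:R * D].
  have a1 : 0 <= C1 ^+ 2 / kap1 by rewrite divr_ge0 ?sqr_ge0// ltW.
  have a2 : 0 <= C2 / eps by rewrite divr_ge0// ltW.
  by apply: le_add3 nL => //; exact: ltW.
have [nS nC nF] := L3.
exists (Kstar T + n)%N; first by rewrite addnS.
have NK : (N + (Kstar T + n) = m + n)%N by rewrite addnA.
have proc := H1_process H1 T1.
have cB := brownian_continuous hB.
have wstart : whp P 0 (fun w => X T 0 w = X0 w).
  by apply: whp_ae; apply: filterS proc => w [].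
have w0 : whp P e (fun w => Xf 0 w ^+ 2 <= kap0 * (N%:R * D) ->
    phase_good c0 eps D th0.2 N th0.1 (fun i => phi (tick 0 D i)) (fun i => Xf (tick 0 D i) w)).
  apply: ph0 => //; first by rewrite ND.
  - by move=> i; rewrite tick_grid0; exact: md.
  - apply: filterS2 proc cB => w [_ cX sol _] cb; split => //.
    apply: solves_on_sub sol => t /=; rewrite !in_itv/= add0r => /andP[-> /le_trans]; apply.
    by rewrite /grid ler_wpM2r ?(ltW D_gt0)// ler_nat leq_addr.
have gm0 : 0 <= grid delta T m by rewrite mulr_ge0// ltW.
have w1 : whp P e (fun w => Xf (grid delta T m) w ^+ 2 <= kap1 * (n%:R * D) ->
    phase_good c1 eps D th1.2 n th1.1 (fun i => phi (tick (grid delta T m) D i))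
      (fun i => Xf (tick (grid delta T m) D i) w)).
  apply: ph1 => //.
  - by move=> i; rewrite tick_grid; exact: md.
  - apply: filterS2 proc cB => w [_ cX _ sol] cb; split => //.
    by apply: solves_on_sub sol => t /=; rewrite !in_itv/= andbT => /andP[].
have W := whp_and wstart (whp_and (whp_and w0 wX0) (whp_and w1 (whp_and wX1 wF))).
apply: whp_imp W.
  have -> : 0 + (e + e + (e + (e + e))) = e * 5 by ring.
  by rewrite divfK.
move=> w [st [[g0 b0] [g1 [b1 bF]]]].
have G0 := g0 _; rewrite tick_grid0 in G0.
have {}G0 : phase_good c0 eps D th0.2 N th0.1 (fun i => phi (grid delta T i))
    (fun i => X T (grid delta T i) w).
  apply: G0; rewrite ND /Xf st; apply: le_trans (sqr_le_norm b0) _.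
  by rewrite mulrC -ler_pdivrMr.
have G1 : phase_good c1 eps D th1.2 n th1.1 (fun i => phi (grid delta T (m + i)))
    (fun i => X T (grid delta T (m + i)) w).
  have -> : (fun i => phi (grid delta T (m + i))) = (fun i => phi (tick (grid delta T m) D i)).
    by apply/funext => i; rewrite tick_grid.
  have -> : (fun i => X T (grid delta T (m + i)) w) = (fun i => Xf (tick (grid delta T m) D i) w).
    by apply/funext => i; rewrite tick_grid.
  apply: g1; apply: le_trans (sqr_le_norm b1) _.
  by rewrite mulrC -ler_pdivrMr.
have Fm k : `|F w k ord0| <= eps * (n%:R * D).
  apply: le_trans (component_le_norm _ _) _.
  apply: (@le_trans _ _ C2); last by rewrite mulrC -ler_pdivrMr.
  by rewrite normr_id in bF.
have big := @detector_large p phi delta T (fun t => X T t w) T0 N0 th0 th1 c0 c1 eps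
  (Kstar T + n) m n c00 c10 eps0 isT NK G0 G1 Fm e0 e1.
rewrite ltNge; apply/negP => dM.
have d0 : 0 <= `|detector phi delta T (fun t => X T t w) (Kstar T + n)| by exact: normr_ge0.
have dM2 : `|detector phi delta T (fun t => X T t w) (Kstar T + n)| ^+ 2 <= M ^+ 2.
  by rewrite ler_pXn2r// nnegrE (le_trans d0).
move: TM; rewrite ltr_pdivrMr ?mulr_gt0 ?divr_gt0// => TM.
move: big; rewrite -/dl.
have -> : c0 * T * (dl / 6) = T * (c0 * (dl / 6)) by ring.
by move=> /(lt_le_trans TM); rewrite ltNge ler_wpM2l// ltW.
Unshelve. all: by end_near. Qed.

End Detection.

Theorem theorem4p4 (d : measure_display) (Omega : measurableType d)
    (P : probability Omega R) (P_complete : measure_is_complete P)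
    (p : nat) (p_ge1 : (1 <= p)%N) (phi : R -> 'cV[R]_p)
    (sigma : R) (sigma_gt0 : 0 < sigma)
    (th0 th1 : 'cV[R]_p * R) (a0_gt0 : 0 < th0.2) (a1_gt0 : 0 < th1.2)
    (gamma delta : R) (Kstar : R -> nat)
    (X0 : {RV P >-> R}) (B : R -> {RV P >-> R}) (X : R -> R -> {RV P >-> R})
    (B_brownian : brownian_motion B)
    (A1 : assumption1 X0 B) (A2 : assumption2 phi)
    (A3 : assumption3 gamma delta) (A4 : assumption4 phi delta)
    (H1 : alternative_H1 phi delta sigma th0 th1 Kstar X0 B X) :
  (forall M : R,
     P [set w | (M%:E < sup_statistic phi gamma delta T (fun t => X T t w))%E]
       @[T --> +oo] --> 1%E) /\
  (forall c : R, 0 < c ->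
     P [set w | (stopping_time phi gamma delta c T (fun t => X T t w) < +oo)%E]
       @[T --> +oo] --> 1%E).
Proof.
have dge0 : 0 <= delta by apply: le_trans (ltW (delta_gt A3)).
have admissible : \forall T \near +oo, 0 < T /\ (0 < nobs delta T)%N.
  near=> T; have T1 : 1 <= T by near: T; exact: (nbhs_pinfty_ge (num_real _)).
  by split; [exact: lt_le_trans T1|exact: nobs_gt0].
have mX T t : measurable_fun setT (X T t) by exact: measurable_funPT.
have detected := change_detected sigma_gt0 a0_gt0 a1_gt0 B_brownian A2 A3 A4 H1.
have ell01 T K : (0 < nobs delta T)%N -> (1 <= K)%N ->
    0 < ell gamma (K%:R / (nobs delta T)%:R) <= 1.
  by move=> N0 K1; apply: ell_gt0_le1; [exact: gamma_ge0 A3|rewrite divr_gt0 ?ltr0n].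
split=> [M|c c0]; apply: probability_cvg1.
- apply: filterS admissible => T [T0 N0].
  exact: (@measurable_sup_statistic _ _ p phi gamma delta T (fun t w => X T t w)).
- move=> eta eta0; apply: filterS2 admissible (detected M eta eta0).
  move=> T [T0 N0] [K K1]; apply: whp_imp => // w Mw.
  apply/sup_statistic_gt; exists K => //; apply: lt_le_trans Mw _.
  have /andP[l0 l1] := ell01 T K N0 K1.
  by rewrite ler_pdivlMr// ler_piMr.
- apply: filterS admissible => T [T0 N0].
  exact: (@measurable_stopping_time _ _ p phi gamma delta T (fun t w => X T t w)).
- move=> eta eta0; apply: filterS2 admissible (detected c eta eta0).
  move=> T [T0 N0] [K K1]; apply: whp_imp => // w Mw.
  apply/stopping_time_lty; exists K => //; apply: le_trans (ltW Mw).
  have /andP[l0 l1] := ell01 T K N0 K1.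
  by rewrite ler_piMr// ltW.
Unshelve. all: by end_near. Qed.
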